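(* The assignment $e_i\mapsto u_{\alpha_i}$ ($i\in\mathbb{N}$), where $u_{\alpha_i}$ is the basis element corresponding to the simple representation $S_i$, extends to a $\mathbb{Q}(r,s)$-algebra isomorphism $$\eta:U^+_{r,s}(\mathfrak{sl}_\infty)\longrightarrow H_{r,s}(A_\infty).$$
   Context: $\mathbb{N}=\{1,2,3,\dots\}$, and $\mathbb{Q}(r,s)$ is the field of rational functions in two independent variables $r,s$. On the free abelian group with basis $\alpha_i$ ($i\in\mathbb{N}$) let $\langle i,j\rangle:=\langle\alpha_i,\alpha_j\rangle$ be $1$ if $i=j$, $-1$ if $j=i+1$, and $0$ otherwise (extended bilinearly). $U_{r,s}(\mathfrak{sl}_\infty)$ is the unital associative $\mathbb{Q}(r,s)$-algebra generated by $e_i,f_i,w_i^{\pm1},w_i'^{\pm1}$ ($i\in\mathbb{N}$) subject to the relations: - all $w_i^{\pm1},w_j'^{\pm1}$ commute with each other, $w_i^{\pm1}w_i^{\mp1}=1=w_i'^{\pm1}w_i'^{\mp1}$; - $w_ie_j=r^{\langle j,i\rangle}s^{-\langle i,j\rangle}e_jw_i$, $\;w_i'e_j=r^{-\langle i,j\rangle}s^{\langle j,i\rangle}e_jw_i'$; - $w_if_j=r^{-\langle j,i\rangle}s^{\langle i,j\rangle}f_jw_i$, $\;w_i'f_j=r^{\langle i,j\rangle}s^{-\langle j,i\rangle}f_jw_i'$; - $e_if_j-f_je_i=\delta_{i,j}\dfrac{w_i-w_i'}{r-s}$; - $e_ie_j-e_je_i=f_if_j-f_jf_i=0$ for $|i-j|>1$;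 - $e_i^2e_{i+1}-(r+s)e_ie_{i+1}e_i+rs\,e_{i+1}e_i^2=0$, $\;e_ie_{i+1}^2-(r+s)e_{i+1}e_ie_{i+1}+rs\,e_{i+1}^2e_i=0$; - $f_i^2f_{i+1}-(r^{-1}+s^{-1})f_if_{i+1}f_i+(rs)^{-1}f_{i+1}f_i^2=0$, $\;f_if_{i+1}^2-(r^{-1}+s^{-1})f_{i+1}f_if_{i+1}+(rs)^{-1}f_{i+1}^2f_i=0$. $U^+_{r,s}(\mathfrak{sl}_\infty)$ is the subalgebra generated by all $e_i$. $A_\infty$ is the infinite linear quiver $1\to2\to3\to\cdots$. For $i\le j$ let $M_{ij}$ be the indecomposable finite dimensional representation with top the simple $S_i$ and composition factors $S_i,\dots,S_j$, corresponding to the positive root $\alpha_{ij}=\alpha_i+\dots+\alpha_j$; $\Phi^+$ is the set of these roots. The set $\mathcal{P}$ of isomorphism classes of finite dimensional representations of $A_\infty$ is identified, independently of the field $k$, with the finitely supported maps $\lambda:\Phi^+\to\mathbb{Z}_{\ge0}$, via $M_k(\lambda)=\bigoplus_{a\in\Phi^+}\lambda(a)M_k(a)$. For $\alpha,\beta\in\mathcal{P}$, $\langle\alpha,\beta\rangle=\dim_k\mathrm{Hom}(M_k(\alpha),M_k(\beta))-\dim_k\mathrm{Ext}^1(M_k(\alpha),M_k(\beta))$. $F^\lambda_{\alpha\beta}(x)\in\mathbb{Z}[x]$ is the Hall polynomial: for every finite field $k$ with $q$ elements, $F^\lambda_{\alpha\beta}(q)$ is the number of subrepresentations $N$ of $M_k(\lambda)$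 with $N\cong M_k(\beta)$ and $M_k(\lambda)/N\cong M_k(\alpha)$. $H_{r,s}(A_\infty)$ is the $\mathbb{Q}(r,s)$-algebra with basis $\{u_\alpha\mid\alpha\in\mathcal{P}\}$ and product $u_\alpha u_\beta=\sum_{\lambda}s^{-\langle\alpha,\beta\rangle}F^\lambda_{\alpha\beta}(rs^{-1})u_\lambda$. *)

(* Defs.v *)
From HB Require Import structures.
From mathcomp Require Import all_boot all_order all_algebra.
From mathcomp Require Import finmap.
From mathcomp.multinomials Require Import monalg.
From mathcomp Require Import boolp classical_sets functions cardinality fsbigop.

Set Implicit Arguments.
Unset Strict Implicit.
Unset Printing Implicit Defensive.

Import Order.TTheory GRing.Theory Num.Theory.
Local Open Scope ring_scope.
Local Open Scope quotient_scope.

(* The indices 1, 2, 3, ... are renumbered 0, 1, 2, ... throughout. *)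

Section ModuleQuotient.
Variables (R : pzRingType) (V : lmodType R) (S : submodClosed V).

Definition submod_pred : {pred V} := fun x => x \in S.

Fact submod_pred_zmod_closed : zmod_closed submod_pred.
Proof.
have E x : (x \in submod_pred) = (x \in S) by [].
split=> [|x y]; rewrite !E; first exact: rpred0.
by move=> xS yS; rewrite rpredD // -scaleN1r rpredZ.
Qed.

HB.instance Definition _ :=
  GRing.isZmodClosed.Build V submod_pred submod_pred_zmod_closed.

Definition lquot : Type := Quotient.quot submod_pred.

HB.instance Definition _ := GRing.Zmodule.on lquot.
HB.instance Definition _ := EqQuotient.on lquot.

Definition lquot_pi (x : V) : lquot := \pi x.

Lemma lquot_piE x y : lquot_pi x = lquot_pi y <-> x - y \in S.
Proof.
have -> : (x - y \in S) = (x - y \in submod_pred) by [].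
by rewrite Quotient.idealrBE; split=> [h|/eqP//]; apply/eqP.
Qed.

Lemma lquot_repr x : lquot_pi (repr x) = x.
Proof. exact: reprK. Qed.

Lemma lquot_pi_is_zmod_morphism : zmod_morphism lquot_pi.
Proof. by move=> x y; rewrite /lquot_pi !piE. Qed.

HB.instance Definition _ :=
  GRing.isZmodMorphism.Build V lquot lquot_pi lquot_pi_is_zmod_morphism.

Definition lquot_scale (a : R) (x : lquot) : lquot := lquot_pi (a *: repr x).

Lemma lquot_scaleE a x : lquot_scale a (lquot_pi x) = lquot_pi (a *: x).
Proof.
by apply/lquot_piE; rewrite -scalerBr rpredZ //; apply/lquot_piE/lquot_repr.
Qed.

Lemma lquot_scaleA a b x :
  lquot_scale a (lquot_scale b x) = lquot_scale (a * b) x.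
Proof. by rewrite -[x]lquot_repr !lquot_scaleE scalerA. Qed.

Lemma lquot_scale1 : left_id 1 lquot_scale.
Proof. by move=> x; rewrite -[x]lquot_repr lquot_scaleE scale1r. Qed.

Lemma lquot_scaleDr : right_distributive lquot_scale +%R.
Proof.
move=> a x y; rewrite -[x]lquot_repr -[y]lquot_repr -raddfD !lquot_scaleE.
by rewrite scalerDr raddfD.
Qed.

Lemma lquot_scaleDl x : {morph lquot_scale^~ x : a b / a + b}.
Proof.
by move=> a b; rewrite -[x]lquot_repr !lquot_scaleE scalerDl raddfD.
Qed.

HB.instance Definition _ := GRing.Zmodule_isLmodule.Build R lquot
  lquot_scaleA lquot_scale1 lquot_scaleDr lquot_scaleDl.

Lemma lquot_pi_is_scalable : scalable lquot_pi.
Proof. by move=> a x; apply/esym/lquot_scaleE. Qed.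

HB.instance Definition _ :=
  GRing.isScalable.Build R V lquot *:%R lquot_pi lquot_pi_is_scalable.

End ModuleQuotient.

Section VectorQuotient.
Variables (k : fieldType) (V : vectType k) (W : {vspace V}).

Definition vquot : Type := lquot (pred_of_vspace W : submodClosed V).

HB.instance Definition _ := GRing.Lmodule.on vquot.

Definition vquot_pi : V -> vquot := @lquot_pi _ _ (pred_of_vspace W).

HB.instance Definition _ := GRing.Linear.on vquot_pi.

Let p : 'End(V) := daddv_pi W^C W.

Let pW u : u \in W -> p u = 0.
Proof.
move=> uW; have uWW : u \in (W^C + W)%VS by rewrite addvC addv_complf memvf.
have cap0 : (W^C :&: W = 0)%VS by rewrite capvC capv_compl.
have := daddv_pi_add cap0 uWW; rewrite -/p.
rewrite [X in _ + X](daddv_pi_id (capv_compl W) uW) => /(congr1 (fun v => v - u)).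
by rewrite addrK subrr.
Qed.

Let subpW u : u - p u \in W.
Proof.
have uWW : u \in (W^C + W)%VS by rewrite addvC addv_complf memvf.
have cap0 : (W^C :&: W = 0)%VS by rewrite capvC capv_compl.
by rewrite -{1}(daddv_pi_add cap0 uWW) addrC addKr memv_pi.
Qed.

Let piE x y : vquot_pi x = vquot_pi y <-> x - y \in W.
Proof. exact: lquot_piE. Qed.

Fact vquot_vect_iso : Vector.axiom (\dim W^C) vquot.
Proof.
have [c c_lin c_bij] := subvs_vect_iso W^C.
pose f (x : vquot) := c (vsproj W^C (p (repr x))).
have fE u : f (vquot_pi u) = c (vsproj W^C (p u)).
  rewrite /f; congr (c (vsproj _ _)).
  apply/eqP; rewrite -subr_eq0 -linearB /=; apply/eqP/pW.
  by apply/piE/lquot_repr.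
exists f => [a x y|].
  have fE' u : f (@lquot_pi _ _ (pred_of_vspace W) u) = _ := fE u.
  by rewrite -[x]lquot_repr -[y]lquot_repr -linearP !fE' !linearP c_lin.
case: c_bij => d cK dK; exists (fun v => vquot_pi (vsval (d v))) => [x|v].
  rewrite /f cK vsprojK ?memv_pi // -[RHS]lquot_repr.
  by apply/piE; rewrite -memvN opprB.
rewrite fE -[RHS]dK; congr (c _).
by rewrite /p daddv_pi_id ?subvsP ?vsvalK // capvC capv_compl.
Qed.

HB.instance Definition _ := Lmodule_hasFinDim.Build k vquot vquot_vect_iso.

End VectorQuotient.

Lemma malg_scalerAr (M : monomType) (K : comNzRingType) (c : K)
    (x y : {malg K[M]}) : c *: (x * y) = x * (c *: y).
Proof.
apply/malgP=> m; rewrite mcoeffZ mcoeffMl.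
rewrite (mcoeffMlw _ (fsubset_refl _) (msuppZ_le c y)) mulr_sumr.
apply: eq_bigr => m1 _; rewrite mulr_sumr; apply: eq_bigr => m2 _.
by rewrite mcoeffZ mulrnAr mulrCA.
Qed.

Section FreeAlgebra.
Variables (K : comNzRingType) (I : choiceType).

Definition falg : Type := {malg K[{fmonom I}]}.

HB.instance Definition _ := GRing.Lalgebra.on falg.

HB.instance Definition _ := GRing.Lalgebra_isAlgebra.Build K falg
  (@malg_scalerAr _ K).

Definition falg_gen (i : I) : falg := << fmu i >>.

Definition falg_prod (h : I -> K) (m : {fmonom I}) : K := \prod_(i <- m) h i.

Fact falg_prod_mmorphism h : mmorphism (falg_prod h).
Proof.
by split=> [m1 m2|]; rewrite /falg_prod ?fmM ?big_cat // fm1 big_nil.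
Qed.

HB.instance Definition _ h :=
  isMultiplicative.Build _ _ (falg_prod h) (falg_prod_mmorphism h).

Definition falg_eval (h : I -> K) : falg -> K := mmap idfun (falg_prod h).

HB.instance Definition _ h := GRing.LRMorphism.copy (falg_eval h)
  (mmap idfun (falg_prod h)).

Lemma falg_eval_gen h i : falg_eval h (falg_gen i) = h i.
Proof. by rewrite /falg_eval mmapU mul1r /falg_prod fmU big_seq1. Qed.

End FreeAlgebra.

Section Ideals.
Variables (K : comNzRingType) (A : algType K) (rel : A -> A -> Prop).

Inductive ideal_gen : A -> Prop :=
| IdealRel a b x y : rel x y -> ideal_gen (a * (x - y) * b)
| Ideal0 : ideal_gen 0
| IdealD x y : ideal_gen x -> ideal_gen y -> ideal_gen (x + y).

Lemma ideal_genMl a x : ideal_gen x -> ideal_gen (a * x).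
Proof.
elim=> [b c y z yz||y z _ IHy _ IHz].
- by rewrite !mulrA; apply: IdealRel.
- by rewrite mulr0; apply: Ideal0.
- by rewrite mulrDr; apply: IdealD.
Qed.

Lemma ideal_genMr a x : ideal_gen x -> ideal_gen (x * a).
Proof.
elim=> [b c y z yz||y z _ IHy _ IHz].
- by rewrite -mulrA; apply: IdealRel.
- by rewrite mul0r; apply: Ideal0.
- by rewrite mulrDl; apply: IdealD.
Qed.

Definition ideal_pred : {pred A} := fun x => `[< ideal_gen x >].

Lemma ideal_predE x : (x \in ideal_pred) = `[< ideal_gen x >].
Proof. by []. Qed.

Fact ideal_pred_submod_closed : submod_closed ideal_pred.
Proof.
split=> [|c x y]; rewrite !ideal_predE; first exact/asboolP/Ideal0.
move=> /asboolP Ix /asboolP Iy; apply/asboolP/IdealD => //.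
by rewrite -[x]mul1r scalerAl; apply: ideal_genMl.
Qed.

HB.instance Definition _ :=
  GRing.isSubmodClosed.Build K A ideal_pred ideal_pred_submod_closed.

End Ideals.

(* <alpha_i, alpha_j> *)
Definition simple_form (i j : nat) : int :=
  if i == j then 1 else if j == i.+1 then -1 else 0.

(* [Uv i] stands for w'_i, and [Uwinv i], [Uvinv i] for the inverses of w_i and
   w'_i. *)
Inductive ugen : Type :=
  Ue of nat | Uf of nat | Uw of nat | Uwinv of nat | Uv of nat | Uvinv of nat.

Definition ugen_code (g : ugen) : nat * nat :=
  match g with
  | Ue i => (0, i) | Uf i => (1, i) | Uw i => (2, i)
  | Uwinv i => (3, i) | Uv i => (4, i) | Uvinv i => (5, i)
  end%N.

Definition ugen_decode (c : nat * nat) : option ugen :=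
  match c with
  | (0, i) => Some (Ue i) | (1, i) => Some (Uf i) | (2, i) => Some (Uw i)
  | (3, i) => Some (Uwinv i) | (4, i) => Some (Uv i) | (5, i) => Some (Uvinv i)
  | _ => None
  end%N.

Lemma ugen_codeK : pcancel ugen_code ugen_decode. Proof. by case. Qed.

HB.instance Definition _ := Countable.copy ugen (pcan_type ugen_codeK).

Definition is_torus (g : ugen) : bool :=
  match g with Ue _ | Uf _ => false | _ => true end.

Section Relations.
Variables (K : fieldType) (r s : K) (A : algType K) (gen : ugen -> A).

Let e i := gen (Ue i).
Let f i := gen (Uf i).
Let w i := gen (Uw i).
Let winv i := gen (Uwinv i).
Let w' i := gen (Uv i).
Let w'inv i := gen (Uvinv i).
Let form := simple_form.

Inductive urel : A -> A -> Prop :=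
| Rel_torus x y : is_torus x -> is_torus y ->
    urel (gen x * gen y) (gen y * gen x)
| Rel_wV i : urel (w i * winv i) 1
| Rel_Vw i : urel (winv i * w i) 1
| Rel_w'V i : urel (w' i * w'inv i) 1
| Rel_Vw' i : urel (w'inv i * w' i) 1
| Rel_we i j :
    urel (w i * e j) ((r ^ form j i * s ^ (- form i j)) *: (e j * w i))
| Rel_w'e i j :
    urel (w' i * e j) ((r ^ (- form i j) * s ^ form j i) *: (e j * w' i))
| Rel_wf i j :
    urel (w i * f j) ((r ^ (- form j i) * s ^ form i j) *: (f j * w i))
| Rel_w'f i j :
    urel (w' i * f j) ((r ^ form i j * s ^ (- form j i)) *: (f j * w' i))
| Rel_ef i j :
    urel (e i * f j - f j * e i)
         (if i == j then (r - s)^-1 *: (w i - w' i) else 0)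
| Rel_ee i j : (i.+1 < j)%N || (j.+1 < i)%N -> urel (e i * e j - e j * e i) 0
| Rel_ff i j : (i.+1 < j)%N || (j.+1 < i)%N -> urel (f i * f j - f j * f i) 0
| Rel_eeS i :
    urel (e i ^+ 2 * e i.+1 - (r + s) *: (e i * e i.+1 * e i)
          + (r * s) *: (e i.+1 * e i ^+ 2)) 0
| Rel_eSS i :
    urel (e i * e i.+1 ^+ 2 - (r + s) *: (e i.+1 * e i * e i.+1)
          + (r * s) *: (e i.+1 ^+ 2 * e i)) 0
| Rel_ffS i :
    urel (f i ^+ 2 * f i.+1 - (r^-1 + s^-1) *: (f i * f i.+1 * f i)
          + (r * s)^-1 *: (f i.+1 * f i ^+ 2)) 0
| Rel_fSS i :
    urel (f i * f i.+1 ^+ 2 - (r^-1 + s^-1) *: (f i.+1 * f i * f i.+1)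
          + (r * s)^-1 *: (f i.+1 ^+ 2 * f i)) 0.

End Relations.

(* The counit, used only to see that the quotient algebra is nonzero. *)
Fact urel_counit (K : fieldType) (r s : K) (A : algType K) (gen : ugen -> A)
    (h : {lrmorphism A -> K | *%R}) :
    (forall g, h (gen g) = (is_torus g)%:R) ->
  forall x y, urel r s gen x y -> h x = h y.
Proof.
move=> E x y.
case=> {x y} [x' y' _ _|i|i|i|i|i j|i j|i j|i j|i j|i j _|i j _|i|i|i|i].
- by rewrite !rmorphM mulrC.
1-4: by rewrite rmorphM rmorph1 /= !E mulr1.
1-4: by rewrite linearZ /= !rmorphM /= !E mulr0 mul0r mulr0.
- rewrite rmorphB !rmorphM /= !E mul0r subrr.
  by case: ifP => _; rewrite ?rmorph0 // linearZ rmorphB /= !E subrr mulr0.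
1-2: by rewrite rmorphB !rmorphM rmorph0 /= !E mulr0 subrr.
all: by rewrite rmorphD rmorphB rmorph0 /= !linearZ /= !rmorphM /= !E;
  rewrite !(mulr0, mul0r) subrr addr0.
Qed.

Section QuantumGroup.
Variables (K : fieldType) (r s : K).

Let F := falg K ugen.
Let urel := urel r s (@falg_gen K ugen).

Definition Ursl : Type := lquot (ideal_pred urel : submodClosed F).

HB.instance Definition _ := GRing.Lmodule.on Ursl.

Let pi : F -> Ursl := @lquot_pi K F (ideal_pred urel).

Let pi_eq x y : pi x = pi y <-> ideal_gen urel (x - y).
Proof.
rewrite /pi lquot_piE ideal_predE; split=> [/asboolP//|h]; exact/asboolP.
Qed.

Let pi_repr x : pi (repr x) = x.
Proof. exact: lquot_repr. Qed.

Let eps : F -> K := falg_eval (fun g : ugen => (is_torus g)%:R).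

Let eps_ideal x : ideal_gen urel x -> eps x = 0.
Proof.
elim=> [a b y z yz||y z _ IHy _ IHz]; first 1 last.
- by rewrite /eps rmorph0.
- by move: IHy IHz; rewrite /eps rmorphD /= => -> ->; rewrite addr0.
have E := urel_counit (h := falg_eval _) (falg_eval_gen _) yz.
by rewrite /eps !rmorphM rmorphB /= E subrr mulr0 mul0r.
Qed.

Definition Ursl_mul (x y : Ursl) : Ursl := pi (repr x * repr y).

Let mulE x y : Ursl_mul (pi x) (pi y) = pi (x * y).
Proof.
apply/pi_eq; set x' := repr _; set y' := repr _.
have Ix : ideal_gen urel (x' - x) by apply/pi_eq/pi_repr.
have Iy : ideal_gen urel (y' - y) by apply/pi_eq/pi_repr.
have -> : x' * y' - x * y = (x' - x) * y' + x * (y' - y).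
  by rewrite mulrBl mulrBr addrA subrK.
by apply: IdealD; [apply: ideal_genMr | apply: ideal_genMl].
Qed.

Let piD x y : pi x + pi y = pi (x + y).
Proof. by rewrite /pi raddfD. Qed.

Fact Ursl_mulA : associative Ursl_mul.
Proof.
by move=> x y z; rewrite -[x]pi_repr -[y]pi_repr -[z]pi_repr !mulE mulrA.
Qed.

Fact Ursl_mul1 : left_id (pi 1) Ursl_mul.
Proof. by move=> x; rewrite -[x]pi_repr mulE mul1r. Qed.

Fact Ursl_mulr1 : right_id (pi 1) Ursl_mul.
Proof. by move=> x; rewrite -[x]pi_repr mulE mulr1. Qed.

Fact Ursl_mulDl : left_distributive Ursl_mul +%R.
Proof.
move=> x y z; rewrite -[x]pi_repr -[y]pi_repr -[z]pi_repr.
by rewrite piD !mulE piD mulrDl.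
Qed.

Fact Ursl_mulDr : right_distributive Ursl_mul +%R.
Proof.
move=> x y z; rewrite -[x]pi_repr -[y]pi_repr -[z]pi_repr.
by rewrite piD !mulE piD mulrDr.
Qed.

Fact Ursl_1neq0 : pi 1 != 0.
Proof.
apply/eqP=> h; have : ideal_gen urel (1 - 0) by apply/pi_eq; rewrite h /pi raddf0.
rewrite subr0 => /eps_ideal; rewrite /eps /falg_eval rmorph1 => /eqP.
by rewrite oner_eq0.
Qed.

HB.instance Definition _ := GRing.Zmodule_isNzRing.Build Ursl
  Ursl_mulA Ursl_mul1 Ursl_mulr1 Ursl_mulDl Ursl_mulDr Ursl_1neq0.

Let piM x y : pi x * pi y = pi (x * y).
Proof. exact: mulE. Qed.

Let piZ c x : c *: pi x = pi (c *: x).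
Proof. by rewrite /pi linearZ. Qed.

Fact Ursl_scalerAl (c : K) (x y : Ursl) : c *: (x * y) = c *: x * y.
Proof.
by rewrite -[x]pi_repr -[y]pi_repr piM !piZ piM scalerAl.
Qed.

HB.instance Definition _ :=
  GRing.Lmodule_isLalgebra.Build K Ursl Ursl_scalerAl.

Fact Ursl_scalerAr (c : K) (x y : Ursl) : c *: (x * y) = x * (c *: y).
Proof.
by rewrite -[x]pi_repr -[y]pi_repr piM !piZ piM scalerAr.
Qed.

HB.instance Definition _ :=
  GRing.Lalgebra_isAlgebra.Build K Ursl Ursl_scalerAr.

Definition Ursl_gen (g : ugen) : Ursl := @lquot_pi K F (ideal_pred urel) (falg_gen K g).

End QuantumGroup.

Section Subalgebra.
Variables (K : comNzRingType) (A : algType K) (S : A -> Prop).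

Inductive subalg_gen : A -> Prop :=
| SubalgGen x : S x -> subalg_gen x
| Subalg1 : subalg_gen 1
| SubalgZ c x : subalg_gen x -> subalg_gen (c *: x)
| SubalgD x y : subalg_gen x -> subalg_gen y -> subalg_gen (x + y)
| SubalgM x y : subalg_gen x -> subalg_gen y -> subalg_gen (x * y).

Definition subalg_pred : {pred A} := fun x => `[< subalg_gen x >].

Lemma subalg_predE x : (x \in subalg_pred) = `[< subalg_gen x >].
Proof. by []. Qed.

Fact subalg_pred_closed : subalg_closed subalg_pred.
Proof.
split=> [|c x y|x y]; rewrite !subalg_predE; first exact/asboolP/Subalg1.
- move=> /asboolP Sx /asboolP Sy; apply/asboolP/SubalgD => //.
  exact: SubalgZ.
- by move=> /asboolP Sx /asboolP Sy; apply/asboolP/SubalgM.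
Qed.

HB.instance Definition _ :=
  GRing.isSubalgClosed.Build K A subalg_pred subalg_pred_closed.

End Subalgebra.

Section PositivePart.
Variables (K : fieldType) (r s : K).

Definition Uplus_pred : {pred Ursl r s} :=
  subalg_pred (fun x => exists i, x = Ursl_gen r s (Ue i)).

HB.instance Definition _ := GRing.SubalgClosed.on Uplus_pred.

Record Uplus : Type :=
  MkUplus { Uplus_val : Ursl r s; Uplus_valP : Uplus_val \in Uplus_pred }.

HB.instance Definition _ := [isSub for Uplus_val].
HB.instance Definition _ := [Choice of Uplus by <:].
HB.instance Definition _ := [SubChoice_isSubAlgebra of Uplus by <:].

Fact Uplus_e_subproof i : Ursl_gen r s (Ue i) \in Uplus_pred.
Proof. by apply/asboolP/SubalgGen; exists i. Qed.

Definition Uplus_e (i : nat) : Uplus := MkUplus (Uplus_e_subproof i).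

End PositivePart.

(* The root alpha_i + ... + alpha_j is the pair (i, j). *)
Definition proot : Type := {a : nat * nat | (a.1 <= a.2)%N}.

HB.instance Definition _ := SubChoice.on proot.

Definition isoclass : Type := {fsfun proot -> nat with 0%N}.

HB.instance Definition _ := Choice.on isoclass.

Definition simple_root (i : nat) : proot := exist _ (i, i) (leqnn i).
Definition class_of_root (a : proot) : isoclass :=
  [fsfun b in [fset a]%fset => 1%N].
Definition zero_class : isoclass := [fsfun].

Section Representations.
Variable k : fieldType.

Record rep := Rep {
  space : nat -> vectType k;
  arrow : forall i, 'Hom(space i, space i.+1)
}.

Definition is_hom (M N : rep) (h : forall i, 'Hom(space M i, space N i)) :=
  forall i x, h i.+1 (arrow M i x) = arrow N i (h i x).

Definition rep_iso (M N : rep) :=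
  exists2 h : forall i, 'Hom(space M i, space N i),
    is_hom h & forall i, bijective (h i).

Definition rep0 : rep := @Rep (fun=> 'rV[k]_0) (fun=> 0).

Definition repD (M N : rep) : rep :=
  @Rep (fun i => (space M i * space N i)%type)
       (fun i => linfun (fun x => (arrow M i x.1, arrow N i x.2))).

(* M_ij: the space at a vertex is k for the vertices from i to j and 0 for the
   others, and all arrows from i to j are identities. *)
Definition rep_root (a : proot) : rep :=
  @Rep (fun i => 'rV[k]_((val a).1 <= i <= (val a).2)%N)
       (fun i => linfun (mulmxr (const_mx 1))).

Definition rep_of (lam : isoclass) : rep :=
  \big[repD/rep0]_(a <- finsupp lam) iter (lam a) (repD (rep_root a)) rep0.

Definition is_subrep (M : rep) (W : forall i, {vspace space M i}) :=
  forall i x, x \in W i -> arrow M i x \in W i.+1.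

(* The arrows of [subrep] and [quotrep] are only meaningful under [is_subrep]. *)
Definition subrep (M : rep) (W : forall i, {vspace space M i}) : rep :=
  @Rep (fun i => subvs_of (W i))
       (fun i => linfun (fun x => vsproj (W i.+1) (arrow M i (vsval x)))).

Definition quotrep (M : rep) (W : forall i, {vspace space M i}) : rep :=
  @Rep (fun i => vquot (W i))
       (fun i => linfun (fun x : vquot (W i) =>
          vquot_pi (W i.+1) (arrow M i (repr x)))).

(* [has_dim n Z R] says that n is the dimension of the quotient of the space Z
   of families by the congruence R. *)
Definition has_dim (V : nat -> lmodType k) (n : nat)
    (Z : (forall i, V i) -> Prop)
    (R : (forall i, V i) -> (forall i, V i) -> Prop) :=
  exists b : 'I_n -> forall i, V i,
    (forall j, Z (b j)) /\
    forall z, Z z -> exists! c : 'rV[k]_n, R z (fun i => \sum_j c 0 j *: b j i).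

Definition hom_dim (M N : rep) (n : nat) :=
  has_dim (V := fun i => 'Hom(space M i, space N i)) n (@is_hom M N) eq.

(* A family z of linear maps M_i -> N_{i+1} defines an extension
   0 -> N -> E -> M -> 0 with E_i = N_i + M_i. Each extension of M by N is
   equivalent to one of this form, and the Baer sum is the sum of families. *)
Definition extrep (M N : rep)
    (z : forall i, 'Hom(space M i, space N i.+1)) : rep :=
  @Rep (fun i => (space N i * space M i)%type)
       (fun i => linfun (fun x => (arrow N i x.1 + z i x.2, arrow M i x.2))).

Definition ext_equiv (M N : rep)
    (z z' : forall i, 'Hom(space M i, space N i.+1)) :=
  exists h : forall i, 'Hom(space (extrep z) i, space (extrep z') i),
    [/\ is_hom h, forall i (y : space N i), h i (y, 0) = (y, 0)
      & forall i x, (h i x).2 = x.2].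

Definition ext_dim (M N : rep) (n : nat) :=
  has_dim (V := fun i => 'Hom(space M i, space N i.+1)) n
          (fun=> True) (@ext_equiv M N).

Definition hall_set (al be lam : isoclass) :
    set (forall i, {vspace space (rep_of lam) i}) :=
  [set W | [/\ is_subrep W, rep_iso (subrep W) (rep_of be)
             & rep_iso (quotrep W) (rep_of al)]].

End Representations.

Arguments hall_set k al be lam : clear implicits.

(* The Euler form and the Hall polynomials do not depend on the field: each of
   the sets below is a singleton, and the default value of xget plays no role. *)
Definition euler_form (al be : isoclass) : int :=
  xget 0 [set n : int | forall k : fieldType, exists h e : nat,
    [/\ hom_dim (rep_of k al) (rep_of k be) h,
        ext_dim (rep_of k al) (rep_of k be) e & n = h%:Z - e%:Z]]%classic.

Definition hall_poly (al be lam : isoclass) : {poly int} :=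
  xget 0 [set p : {poly int} | forall k : finFieldType, exists2 n : nat,
    (hall_set k al be lam #= `I_n)%card & p.[#|k|%:R] = n%:R]%classic.

Section HallAlgebra.
Variables (K : fieldType) (r s : K).

Definition Hall : Type := {malg K[isoclass]}.

HB.instance Definition _ := GRing.Lmodule.on Hall.

Definition hall_u (al : isoclass) : Hall := << al >>.

(* Only finitely many terms of the sum are nonzero. *)
Definition hall_mul_basis (al be : isoclass) : Hall :=
  \sum_(lam \in setT)
    (s ^ (- euler_form al be) *
     (map_poly intr (hall_poly al be lam)).[r / s]) *: hall_u lam.

Definition hall_mul (x y : Hall) : Hall :=
  \sum_(al <- msupp x) \sum_(be <- msupp y)
    (x@_al * y@_be) *: hall_mul_basis al be.

End HallAlgebra.

Definition Qrs : fieldType := {fraction {poly {poly rat}}}.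
Definition var_r : Qrs := tofrac ('X : {poly rat})%:P.
Definition var_s : Qrs := tofrac ('X : {poly {poly rat}}).

(* Main.v *)
(** Let T be the free algebra on the e_i. It acts on the Hall algebra, e_i acting as
    left multiplication by the class of S_i, and both U^+ and the Hall algebra turn
    out to be the quotient of T by its Serre ideal.

    On the Hall side, a representation is determined by the ranks of the compositions
    of its arrows, so that Hall numbers count families of subspaces with prescribed
    ranks. Multiplication by S_i amounts to counting hyperplanes: it raises one root of
    a class at a time, with an explicit coefficient. It follows that quantum root
    vectors add a root to a class, that ordered products of root vectors send u_0 to
    nonzero multiples of all the u_lambda, and that the Serre elements annihilate u_0.
    Over the integers the first two facts express the Hall numbers as exact quotients
    of polynomials in the cardinality of the field, which yields the Hall polynomials
    and the associativity of the product; hence the action of T commutes with right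
    multiplications, and the Serre ideal acts by 0.

    On the other side, T is a Verma module for the generators of U, the f_i lowering
    words, and all the defining relations of U act into the Serre ideal. An element of
    T that vanishes in U is therefore in the Serre ideal, so t |-> t u_0 is well defined
    on U^+. The ordered products of root vectors span U^+, by their commutation
    relations, and they are sent to multiples of distinct basis elements. *)

Require Import Defs.
From HB Require Import structures.
From mathcomp Require Import all_boot all_order all_algebra.
From mathcomp Require Import finmap zify ring.
From mathcomp Require mxabelem.
From mathcomp.multinomials Require Import monalg.
From mathcomp Require Import boolp classical_sets functions cardinality fsbigop.
Import Defs.

Set Implicit Arguments.
Unset Strict Implicit.
Unset Printing Implicit Defensive.

Import GRing.Theory.
Local Open Scope ring_scope.

(** * Subquotients of representations *)

(** Two circularities shape the proof. The Hall product is defined through Hall polynomials, whose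
    existence has to be proved; and a relation between the e_i in U^+, a subalgebra of U, may come
    from relations involving all generators of U. The first is broken over the integers with s = 1.
    There only products with a simple class on the left are computed explicitly, and they suffice:
    ordered products of root vectors carry u_0 to u_al times a monic polynomial in q, monicity
    permits division with remainder in Z[x], and growth shows that the remainder is 0. The second is
    broken without a triangular decomposition of U, by letting words in the e_i act on the vacuum
    vector of the Verma module. Ranks replace decompositions into indecomposables because the rank
    of a map in a subquotient W2/W1 is a difference of dimensions inside M, so flags of
    subrepresentations are counted without forming quotients. Over Q(r, s) the coefficients that
    occur are invertible because q = r/s is not a root of unity. *)

Section Gluing.
Variables (k : fieldType) (V V' : vectType k).
Implicit Types (U C : {vspace V}).

Lemma hom_glue U C (p e : 'Hom(V, V')) : (U :&: C = 0)%VS ->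
  exists p' : 'Hom(V, V'), {in U, p' =1 p} /\ {in C, p' =1 e}.
Proof.
move=> UC0; have CU0 : (C :&: U = 0)%VS by rewrite capvC.
exists ((p \o daddv_pi U C)%VF + (e \o daddv_pi C U)%VF).
split=> x xU; rewrite add_lfunE !comp_lfunE.
  rewrite (daddv_pi_id UC0) //.
  have /(daddv_pi_add UC0) : x \in (U + C)%VS by apply: (subvP (addvSl _ _)).
  rewrite (daddv_pi_id UC0) // => /eqP; rewrite -subr_eq0 addrAC subrr add0r => /eqP->.
  by rewrite linear0 addr0.
rewrite (daddv_pi_id CU0) //.
have /(daddv_pi_add CU0) : x \in (C + U)%VS by apply: (subvP (addvSl _ _)).
rewrite (daddv_pi_id CU0) // => /eqP; rewrite -subr_eq0 addrAC subrr add0r => /eqP->.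
by rewrite linear0 add0r.
Qed.

Lemma hom_of_dim C (C' : {vspace V'}) : \dim C = \dim C' ->
  exists2 e : 'Hom(V, V'), (e @: C = C')%VS & {in C, forall x, e x = 0 -> x = 0}.
Proof.
move=> dimC.
have [f fE] := linear_of_free (vbasis C) (vbasis C').
have {}fE : map f (vbasis C) = vbasis C'.
  by apply: fE; [exact: basis_free (vbasisP _) | rewrite !size_tuple].
have eC : (linfun f @: C = C')%VS.
  rewrite -{1}(span_basis (vbasisP C)) limg_span.
  rewrite (eq_map (lfunE _)) fE; exact: span_basis (vbasisP C').
exists (linfun f) => // x xC ex0.
have := limg_ker_dim (linfun f) C; rewrite eC -dimC.
move=> /eqP; rewrite -[X in _ == X]add0n eqn_add2r dimv_eq0 => /eqP C0.
by apply/eqP; rewrite -memv0 -C0 memv_cap xC memv_ker ex0 eqxx.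
Qed.

End Gluing.

Lemma memvDr (k : fieldType) (V : vectType k) (U : {vspace V}) x y :
  y \in U -> (x + y \in U) = (x \in U).
Proof. by move=> yU; rewrite rpredDr. Qed.

Section FlagExtension.
Variables (k : fieldType) (V V' : vectType k) (A W : {vspace V}).
Variables (F : nat -> {vspace V}) (F' : nat -> {vspace V'}).
Variable g : 'Hom(V, V').
Hypotheses (FS : forall n, (F n <= F n.+1)%VS) (F'S : forall n, (F' n <= F' n.+1)%VS).
Hypotheses (F'0 : F' 0 = 0%VS) (AW : (A <= W)%VS).
Hypothesis dimF : forall n, \dim (F n) = (\dim (F 0%N) + \dim (F' n))%N.
Hypothesis gA : forall x n, x \in A -> (g x \in F' n) = (x \in F n).

(** The equivalence at j = 0 forces the kernel of p on U to be the part of U in F 0, which is what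
    makes dimensions comparable. *)
Let flag_hom (U : {vspace V}) (p : 'Hom(V, V')) :=
  {in A, p =1 g} /\ forall x j, x \in U -> (p x \in F' j) = (x \in F j).

Let subF m n x : (m <= n)%N -> x \in F m -> x \in F n.
Proof.
move=> mn; apply: subvP; elim: n mn => [|n IH]; first by rewrite leqn0 => /eqP->.
rewrite leq_eqVlt => /orP[/eqP->//|/IH h]; exact: subv_trans h (FS n).
Qed.

Let subF' m n x : (m <= n)%N -> x \in F' m -> x \in F' n.
Proof.
move=> mn; apply: subvP; elim: n mn => [|n IH]; first by rewrite leqn0 => /eqP->.
rewrite leq_eqVlt => /orP[/eqP->//|/IH h]; exact: subv_trans h (F'S n).
Qed.

Let flag_dim U p (X : {vspace V}) : flag_hom U p -> (F 0%N <= X)%VS -> (X <= U)%VS ->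
  (\dim (F 0%N) + \dim (p @: X) = \dim X)%N.
Proof.
move=> [_ pU] FX XU; rewrite -(limg_ker_dim p X); congr (\dim _ + _)%N.
apply/vspaceP=> x; rewrite memv_cap memv_ker.
apply/idP/andP=> [xF|[xX /eqP px0]].
  have xX := subvP FX _ xF; split=> //.
  by rewrite -memv0 -F'0 pU // (subvP XU).
by rewrite -pU ?px0 ?mem0v // (subvP XU).
Qed.

Let flag_img U p n : flag_hom U p -> (F n <= U)%VS -> (p @: F n)%VS = F' n.
Proof.
move=> pU FU; apply/eqP; rewrite eqEdim; apply/andP; split.
  apply/subvP=> _ /memv_imgP[x xF ->]; case: pU => _ ->//.
  exact: (subvP FU).
have F0n : (F 0%N <= F n)%VS by apply/subvP=> x; apply: subF.
by have := flag_dim pU F0n FU; have := dimF n; lia.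
Qed.

Let flag_step n p : flag_hom (A + F n) p -> exists p', flag_hom (A + F n.+1) p'.
Proof.
move=> pP; have [pA pU] := pP.
set U := (A + F n)%VS in pP pU *.
pose D := (U :&: F n.+1)%VS; pose C := (F n.+1 :\: D)%VS.
have F0n : (F 0%N <= F n)%VS by apply/subvP=> x; apply: subF.
have FU : (F n <= U)%VS by apply: addvSr.
have FD : (F n <= D)%VS by rewrite subv_cap FU FS.
have pD : (p @: D <= F' n.+1)%VS.
  apply/subvP=> _ /memv_imgP[x + ->]; rewrite memv_cap => /andP[xU xF].
  by rewrite pU.
pose C' := (F' n.+1 :\: (p @: D))%VS.
have dimD : (\dim C = \dim C')%N.
  have h1 := dimv_cap_compl (F n.+1) D; have h2 := dimv_cap_compl (F' n.+1) (p @: D).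
  have h3 := flag_dim pP (subv_trans F0n FD) (capvSl _ _).
  have h4 := dimF n.+1.
  move: h1 h2; rewrite (capv_idPr (capvSr U (F n.+1))) (capv_idPr pD) -/D -/C -/C'.
  by lia.
have CD0 : (C :&: D = 0)%VS by apply: capv_diff.
have UC0 : (U :&: C = 0)%VS.
  apply/eqP; rewrite -subv0; apply/subvP=> x; rewrite memv_cap => /andP[xU xC].
  rewrite -CD0 memv_cap xC memv_cap xU; exact: (subvP (diffvSl _ _)) xC.
have [e eC e0] := hom_of_dim dimD.
have [p' [p'U p'C]] := hom_glue p e UC0.
exists p'; split=> [x xA|x j].
  by rewrite p'U ?pA // (subvP (addvSl _ _)).
move=> /memv_addP[a aA [z zF ->]].
have /memv_addP[c cC [d dD ->]] : z \in (C + D)%VS by rewrite addv_diff (addv_idPl _) // capvSr.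
have dU : d \in U by apply: subvP (capvSl _ _) _ dD.
rewrite addrCA addrC.
set y := a + d; have yU : y \in U by rewrite memvD // (subvP (addvSl _ _)).
have cF : c \in F n.+1 by apply: (subvP (diffvSl _ _)) cC.
have ecC : e c \in C' by rewrite -eC memv_img.
have p'cF : p' c \in F' n.+1 by rewrite p'C //; apply: (subvP (diffvSl _ (p @: D))).
have C'D0 : (C' :&: p @: D = 0)%VS by apply: capv_diff.
rewrite linearD /= (p'U y) //.
(* For j > n the component c lies in F j and its image in F' j, so only y matters. For j <= n
   membership on either side forces c = 0. *)
have [nj|jn] := ltnP n j.
  by rewrite (memvDr _ (subF' nj p'cF)) (memvDr _ (subF nj cF)) pU.
have key : p y + e c \in F' n -> c = 0.
  move=> h; apply: e0 => //; apply/eqP; rewrite -memv0 -C'D0 memv_cap ecC /=.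
  have pyF : p y \in F' n.+1.
    have ecF : e c \in F' n.+1 by rewrite -p'C.
    by rewrite -(memvDr _ ecF); apply: subF' h.
  have -> : e c = p y + e c - p y by rewrite addrC addKr.
  apply: memvB.
    move: h; rewrite -(flag_img pP FU) => h; apply: subvP h; exact: limgS.
  by apply: memv_img; rewrite memv_cap yU -pU.
apply/idP/idP.
  rewrite p'C // => h; have /key c0 : p y + e c \in F' n by apply: subF' h.
  by move: h; rewrite c0 linear0 !addr0 pU.
move=> h; have yD : y \in D.
  by rewrite memv_cap yU -(memvDr _ cF); apply: (subF (leqW jn)) h.
have c0 : c = 0.
  apply/eqP; rewrite -memv0 -CD0 memv_cap cC /= -(memvDr _ yD) addrC.
  by apply: (subvP FD); apply: subF h.
by move: h; rewrite c0 linear0 !addr0 pU.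
Qed.

(* One flag step at a time: a complement of (A + F n) in F (n + 1) is sent to a
   complement of the image. *)
Lemma flag_extension N : F N = W ->
  exists p : 'Hom(V, V'),
    {in A, p =1 g} /\ forall x n, x \in W -> (p x \in F' n) = (x \in F n).
Proof.
move=> FN; suff [p [pA pU]] : exists p, flag_hom (A + F N) p.
  by exists p; split=> // x n xW; apply: pU; rewrite FN (subvP (addvSr _ _)).
elim: N {FN} => [|n [p /flag_step//]].
(* F 0 must go to F' 0 = 0. On the part of F 0 inside A this is true of g, and a complement of that
   part is sent to 0. *)
have [p0 [p0A p0C]] := hom_glue g (0 : 'Hom(V, V')) (etrans (capvC _ _) (capv_diff (F 0%N) A)).
exists p0; split=> // x n /memv_addP[a aA [z]].
rewrite -(addv_diff_cap (F 0%N) A) => /memv_addP[c cC [d + ->]] ->.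
rewrite memv_cap => /andP[dF dA].
rewrite addrCA addrC linearD /= (p0C c) // zero_lfunE addr0.
have adA : a + d \in A by rewrite memvD.
rewrite p0A // gA //.
have cF : c \in F n by apply: (subF (leq0n n)); apply: (subvP (diffvSl _ _)) cC.
by rewrite (memvDr _ cF).
Qed.

End FlagExtension.

Section RelativeKernels.
Variables (k : fieldType).
Implicit Types M N : rep k.

Definition family M := forall i, {vspace space M i}.
Definition fam_le M (W1 W2 : family M) := forall i, (W1 i <= W2 i)%VS.
Definition fam0 M : family M := fun i => 0%VS : {vspace space M i}.
Definition famT M : family M := fun i => {: space M i}%VS.

Lemma famP M (W W' : family M) : (forall i, W i = W' i) -> W = W'.
Proof. by move=> h; apply: functional_extensionality_dep. Qed.

(* The kernel of the map from vertex i to vertex i + n of the subquotient W2/W1,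
   pulled back to W2. *)
Fixpoint rker M (W1 W2 : family M) n i : {vspace space M i} :=
  if n is m.+1 then (W2 i :&: arrow M i @^-1: rker W1 W2 m i.+1)%VS else W1 i.

(** The rank of the map from vertex i to vertex i + n of W2/W1, read off at its source. *)
Definition rk M (W1 W2 : family M) i n := (\dim (W2 i) - \dim (rker W1 W2 n i))%N.

Definition rank M := rk (@fam0 M) (@famT M).

Lemma fam0_subrep M : is_subrep (@fam0 M).
Proof. by move=> i x; rewrite !memv0 => /eqP->; rewrite linear0. Qed.

Lemma famT_subrep M : is_subrep (@famT M).
Proof. by move=> i x _; rewrite memvf. Qed.

Section Subquotient.
Variables (M : rep k) (W1 W2 : family M).
Hypotheses (W12 : fam_le W1 W2) (W1s : is_subrep W1) (W2s : is_subrep W2).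

Lemma rker_le n i : (rker W1 W2 n i <= W2 i)%VS.
Proof. by case: n => [|n] /=; [exact: W12 | exact: capvSl]. Qed.

Lemma rkerS n i : (rker W1 W2 n i <= rker W1 W2 n.+1 i)%VS.
Proof.
elim: n i => [|n IH] i /=; rewrite subv_cap.
  rewrite W12; apply/subvP=> x /W1s; by rewrite memv_preim.
rewrite capvSl; apply: subv_trans (capvSr _ _) _; apply: lpreimS; exact: IH.
Qed.

Lemma mem_rkerS n i x : x \in W2 i ->
  (x \in rker W1 W2 n.+1 i) = (arrow M i x \in rker W1 W2 n i.+1).
Proof. by move=> xW; rewrite /= memv_cap xW memv_preim. Qed.

Lemma rker_mono m n i : (m <= n)%N -> (rker W1 W2 m i <= rker W1 W2 n i)%VS.
Proof.
elim: n => [|n IH]; first by rewrite leqn0 => /eqP->; exact: subvv.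
rewrite leq_eqVlt => /orP[/eqP->|/IH h]; first exact: subvv.
exact: subv_trans h (rkerS _ _).
Qed.

End Subquotient.

Lemma rker_top M (W1 W2 : family M) b n i : is_subrep W2 ->
  (forall j, (b <= j)%N -> W1 j = W2 j) ->
  (b <= n + i)%N -> rker W1 W2 n i = W2 i.
Proof.
move=> W2s W12; elim: n i => [|n IH] i bn /=; first exact: W12.
rewrite IH ?addnS //; apply/capv_idPl/subvP=> x /W2s.
by rewrite memv_preim.
Qed.

(* p presents M' as the subquotient W2/W1 of M; the values of p outside W2 are
   junk. *)
Record presents M (W1 W2 : family M) M'
    (p : forall i, 'Hom(space M i, space M' i)) : Prop := Presents {
  pres_arrow : forall i x, x \in W2 i -> p i.+1 (arrow M i x) = arrow M' i (p i x);
  pres_img : forall i, (p i @: W2 i)%VS = fullv;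
  pres_ker : forall i x, x \in W2 i -> (p i x == 0) = (x \in W1 i)
}.

Section Pullback.
Variables (M : rep k) (W1 W2 : family M) (M' : rep k).
Variable p : forall i, 'Hom(space M i, space M' i).
Hypotheses (W12 : fam_le W1 W2) (W2s : is_subrep W2) (pP : presents W1 W2 p).

(** The correspondence between families of subspaces of M' and families of M lying between W1 and
    W2; it preserves inclusions, subrepresentations and ranks. *)
Definition pullback (X : family M') : family M := fun i => (W2 i :&: p i @^-1: X i)%VS.

Lemma mem_pullback X i x : (x \in pullback X i) = (x \in W2 i) && (p i x \in X i).
Proof. by rewrite memv_cap memv_preim. Qed.

Lemma pullback0 : pullback (@fam0 M') = W1.
Proof.
apply: famP => i; apply/vspaceP=> x; rewrite mem_pullback memv0.
by apply/andP/idP=> [[xW]|xW]; rewrite ?(pres_ker pP) // ?(subvP (W12 i)).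
Qed.

Lemma pullbackT : pullback (@famT M') = W2.
Proof. by apply: famP => i; apply/vspaceP=> x; rewrite mem_pullback memvf andbT. Qed.

Lemma pullback_dim X i : \dim (pullback X i) = (\dim (W1 i) + \dim (X i))%N.
Proof.
rewrite -(limg_ker_dim (p i) (pullback X i)); congr (_ + _)%N; congr (\dim _); apply/vspaceP=> x.
  rewrite memv_cap mem_pullback memv_ker; case xW: (x \in W2 i) => /=.
    rewrite (pres_ker pP) // andbC; case: (boolP (x \in W1 i)) => //= xW1.
    by move: xW1; rewrite -(pres_ker pP) // => /eqP->; rewrite mem0v.
  by apply/esym/negbTE; apply: contraFN xW; apply: subvP.
apply/memv_imgP/idP=> [[y + ->]|xX]; first by rewrite mem_pullback => /andP[].
have /memv_imgP[y yW xE] : x \in (p i @: W2 i)%VS by rewrite (pres_img pP) memvf.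
by exists y => //; rewrite mem_pullback yW -xE.
Qed.

Lemma pullback_rker X1 X2 n i :
  rker (pullback X1) (pullback X2) n i = pullback (fun i => rker X1 X2 n i) i.
Proof.
elim: n i => [//|n IH] i; apply/vspaceP=> x /=.
rewrite memv_cap -memv_preim IH !mem_pullback memv_cap -memv_preim.
case xW: (x \in W2 i) => //=.
by rewrite (W2s xW) (pres_arrow pP) //; case: (p i x \in X2 i).
Qed.

Lemma pullback_rk X1 X2 i n : rk (pullback X1) (pullback X2) i n = rk X1 X2 i n.
Proof. by rewrite /rk pullback_rker !pullback_dim subnDl. Qed.

Lemma pres_rank i n : rk W1 W2 i n = rank M' i n.
Proof. by rewrite /rank -pullback_rk pullback0 pullbackT. Qed.

Lemma pullback_le X Y : fam_le (pullback X) (pullback Y) <-> fam_le X Y.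
Proof.
split=> XY i; apply/subvP=> x; last first.
  by rewrite !mem_pullback => /andP[-> /(subvP (XY i))->].
move=> xX; have /memv_imgP[y yW xE] : x \in (p i @: W2 i)%VS by rewrite (pres_img pP) memvf.
have : y \in pullback X i by rewrite mem_pullback yW -xE.
by move/(subvP (XY i)); rewrite mem_pullback -xE => /andP[].
Qed.

Lemma pullback_inj X Y : pullback X = pullback Y -> X = Y.
Proof.
move=> XY; have XY1 : fam_le (pullback X) (pullback Y) by rewrite XY => i; exact: subvv.
have XY2 : fam_le (pullback Y) (pullback X) by rewrite XY => i; exact: subvv.
apply: famP => i; apply/eqP; rewrite eqEsubv.
by move/pullback_le: XY1 => ->; move/pullback_le: XY2 => ->.
Qed.

Lemma pullback_surj Y : fam_le W1 Y -> fam_le Y W2 -> exists X, pullback X = Y.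
Proof.
move=> W1Y YW2; exists (fun i => p i @: Y i)%VS; apply: famP => i; apply/vspaceP=> x.
rewrite mem_pullback; apply/andP/idP=> [[xW /memv_imgP[y yY pxy]]|xY].
  have yW := subvP (YW2 i) _ yY.
  have : x - y \in W1 i by rewrite -(pres_ker pP) ?memvB // linearB /= pxy subrr.
  by move/(subvP (W1Y i)); rewrite memvDr ?memvN.
by rewrite (subvP (YW2 i)) // memv_img.
Qed.

Lemma pullback_subrep X : is_subrep (pullback X) <-> is_subrep X.
Proof.
split=> Xs i x.
  move=> xX; have /memv_imgP[y yW xE] : x \in (p i @: W2 i)%VS by rewrite (pres_img pP) memvf.
  have : y \in pullback X i by rewrite mem_pullback yW -xE.
  by move/Xs; rewrite mem_pullback (pres_arrow pP) // -xE => /andP[].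
by rewrite !mem_pullback => /andP[xW /Xs]; rewrite (pres_arrow pP) // W2s.
Qed.

End Pullback.

End RelativeKernels.

Lemma linfun_linear (k : fieldType) (aT rT : vectType k) (f : aT -> rT) :
  linear f -> linfun f =1 f.
Proof.
move=> f_lin; pose ff : {linear aT -> rT} := HB.pack f (GRing.isLinear.Build _ _ _ _ f f_lin).
exact: (lfunE ff).
Qed.

Lemma hom_factor (k : fieldType) (U V W : vectType k) (X : {vspace U})
    (f : 'Hom(U, V)) (h : 'Hom(U, W)) :
  (forall x, x \in X -> f x = 0 -> h x = 0) ->
  exists g : 'Hom(V, W), forall x, x \in X -> g (f x) = h x.
Proof.
move=> fh; pose f0 := (f \o projv X)%VF.
exists (h \o projv X \o f0^-1)%VF => x xX; rewrite !comp_lfunE /=.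
have fx : f x = f0 x by rewrite comp_lfunE projv_id.
set z := projv X _; have zX : z \in X by apply: memv_proj.
have fz : f z = f x.
  have -> : f z = f0 (f0^-1 (f x))%VF by rewrite comp_lfunE.
  by rewrite limg_lfunVK // fx memv_img // memvf.
apply/eqP; rewrite -subr_eq0 -linearB /= fh ?memvB //.
by rewrite linearB /= fz subrr.
Qed.

Definition bounded (k : fieldType) (M : rep k) (b : nat) :=
  forall j, (b <= j)%N -> \dim {: space M j} = 0%N.

Section Gabriel.
Variables (k : fieldType) (M : rep k) (W1 W2 : family M) (M' : rep k) (b : nat).
Hypotheses (W12 : fam_le W1 W2) (W1s : is_subrep W1) (W2s : is_subrep W2).
Hypotheses (bM' : bounded M' b) (rkE : forall i n, rk W1 W2 i n = rank M' i n).

Let K n i := rker W1 W2 n i.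
Let K' n i := rker (@fam0 _ M') (@famT _ M') n i.

Let fam0T : fam_le (@fam0 _ M') (@famT _ M').
Proof. by move=> i; apply: sub0v. Qed.

Let dimK n i : \dim (K n i) = (\dim (W1 i) + \dim (K' n i))%N.
Proof.
have := rkE i n; have := rkE i 0; rewrite /rank /rk /= dimv0 -/(K n i) -/(K' n i).
have := dimvS (rker_le W12 n i); have := dimvS (rker_le fam0T n i).
have := dimvS (W12 i); rewrite -/(K n i) -/(K' n i); lia.
Qed.

(** Compatibility with the whole flag of kernels, not with W1 alone, is what lets the construction
    go on at the next vertex. *)
Let good i (p : 'Hom(space M i, space M' i)) :=
  forall x n, x \in W2 i -> (p x \in K' n i) = (x \in K n i).

Let flag i (A : {vspace space M i}) (g : 'Hom(space M i, space M' i)) :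
  (A <= W2 i)%VS -> (forall x n, x \in A -> (g x \in K' n i) = (x \in K n i)) ->
  exists p : 'Hom(space M i, space M' i), {in A, p =1 g} /\ good p.
Proof.
move=> AW gA; apply: (flag_extension (F := K^~ i) (F' := K'^~ i) _ _ _ AW _ gA (N := b)) => //.
- by move=> n; apply: rkerS.
- by move=> n; apply: rkerS => //; apply: fam0_subrep.
apply/eqP; rewrite eqEdim rker_le //= dimK.
rewrite [K' _ _](rker_top (b := b)) ?leq_addr //; last 2 first.
- exact: famT_subrep.
- by move=> j /bM' M'0; apply/esym/eqP; rewrite -dimv_eq0 M'0.
have := rkE i 0; rewrite /rank /rk /= dimv0; have := dimvS (W12 i); rewrite /famT; lia.
Qed.

Let step i (p : 'Hom(space M i, space M' i)) : good p ->
  {p' : 'Hom(space M i.+1, space M' i.+1) |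
     good p' /\ forall x, x \in W2 i -> p' (arrow M i x) = arrow M' i (p x)}.
Proof.
move=> pg; apply: cid.
(* Commutation with the arrows forces the next map on the image of W2 i. It is well defined: an
   element killed by the arrow of M is in K 1 i, so p sends it to one killed by the arrow of M'. *)
have [x xW fx0|g gE] := @hom_factor _ _ _ _ (W2 i) (arrow M i) (arrow M' i \o p)%VF.
  rewrite comp_lfunE; apply/eqP; rewrite -memv0.
  suff : p x \in K' 1 i by rewrite /K' mem_rkerS ?memvf.
  by rewrite pg // /K mem_rkerS // fx0 mem0v.
have AW : (arrow M i @: W2 i <= W2 i.+1)%VS.
  by apply/subvP=> _ /memv_imgP[x xW ->]; apply: W2s.
have [|p' [p'A p'g]] := @flag i.+1 _ g AW.
  move=> _ n /memv_imgP[x xW ->]; rewrite gE // comp_lfunE.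
  have e1 : (p x \in K' n.+1 i) = (arrow M' i (p x) \in K' n i.+1).
    by apply: mem_rkerS; apply: memvf.
  have e2 : (x \in K n.+1 i) = (arrow M i x \in K n i.+1) by apply: mem_rkerS.
  by rewrite -e1 -e2; apply: pg.
exists p'; split=> // x xW; rewrite p'A ?memv_img // gE // comp_lfunE //.
Qed.

Let start : {p : 'Hom(space M 0, space M' 0) | good p}.
Proof.
apply: cid; have [|x n|p [_ pg]] := @flag 0%N 0%VS 0; first exact: sub0v.
  by rewrite memv0 => /eqP->; rewrite linear0 !mem0v.
by exists p.
Qed.

Let Fixpoint tower i : {p : 'Hom(space M i, space M' i) | good p} :=
  if i is j.+1 then
    let: exist p pg := tower j in
    let: exist p' h := step pg in exist _ p' (proj1 h)
  else start.

(** The maps are built from vertex 0 upwards. At vertex i + 1 the map is prescribed on the image of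
    vertex i, where it respects the flags because x is in K (n + 1) i exactly when its image is in K
    n (i + 1). Then [flag_extension] applies: equal ranks give its dimension hypothesis, and
    boundedness the end of the flag. *)
Lemma gabriel : exists p, presents W1 W2 (M' := M') p.
Proof.
exists (fun i => sval (tower i)); split=> i.
- move=> x xW /=; case: (tower i) => p pg /=; case: (step pg) => p' [p'g p'E] /=.
  exact: p'E.
- case: (tower i) => p pg /=; apply/eqP; rewrite eqEdim subvf /=.
  have W1K : (W2 i :&: lker p)%VS = W1 i.
    apply/vspaceP=> x; rewrite memv_cap memv_ker.
    case xW: (x \in W2 i) => /=; first by have := pg x 0 xW; rewrite memv0.
    by apply/esym/negbTE; apply: contraFN xW; apply: subvP.
  have := limg_ker_dim p (W2 i); rewrite W1K.
  have := rkE i 0; rewrite /rank /rk /= dimv0 /famT; lia.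
- move=> x xW; case: (tower i) => p pg /=.
  by have := pg x 0 xW; rewrite memv0.
Qed.

End Gabriel.

Section Isomorphism.
Variable k : fieldType.
Implicit Types M : rep k.

(** An isomorphism is a presentation of the subquotient M/0, so [gabriel] yields one from equal
    ranks. *)
Lemma rep_isoP M M' b : bounded M' b ->
  rep_iso M M' <-> (forall i n, rank M i n = rank M' i n).
Proof.
have M0T : fam_le (@fam0 _ M) (@famT _ M) by move=> i; apply: sub0v.
move=> bM'; split=> [[h h_hom h_bij] i n|rkE].
  apply: (@pres_rank _ _ _ _ _ h) => //; first exact: famT_subrep.
  split=> [j x _|j|j x _]; first exact: h_hom.
    apply/eqP; rewrite eqEsubv subvf /=; apply/subvP=> y _.
    by have [g _ gK] := h_bij j; rewrite -(gK y) memv_img ?memvf.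
  rewrite memv0 -(linear0 (h j)) (inj_eq (bij_inj (h_bij j))) //.
have [||p pP] := gabriel M0T _ _ bM' rkE; [exact: fam0_subrep|exact: famT_subrep|].
exists p => [i x|i]; first by apply: (pres_arrow pP); apply: memvf.
have /lker0P p_inj : lker (p i) == 0%VS.
  rewrite -subv0; apply/subvP=> x; rewrite memv_ker (pres_ker pP) ?memvf //.
exists (p i)^-1%VF => [x|y].
  by apply: p_inj; rewrite limg_lfunVK // memv_img // memvf.
by rewrite limg_lfunVK // (pres_img pP i) memvf.
Qed.

Lemma subrep_pres M (W : family M) : is_subrep W ->
  presents (@fam0 _ M) W (M' := subrep W) (fun i => linfun (vsproj (W i))).
Proof.
move=> Ws; split=> [i x xW|i|i x xW]; rewrite ?lfunE /=.
- rewrite linfun_linear ?vsprojK //.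
  by move=> a u v; rewrite !linearP.
- apply/eqP; rewrite eqEsubv subvf /=; apply/subvP=> y _.
  by rewrite -(vsvalK y) -(lfunE (vsproj (W i))) memv_img ?subvsP.
rewrite memv0; apply/eqP/eqP=> [x0|->]; last exact: linear0.
by rewrite -(vsprojK xW) x0 linear0.
Qed.

Lemma quotrep_pres M (W : family M) : is_subrep W ->
  presents W (@famT _ M) (M' := quotrep W) (fun i => linfun (vquot_pi (W i))).
Proof.
move=> Ws.
have piE i (x y : space M i) : vquot_pi (W i) x = vquot_pi (W i) y <-> x - y \in W i.
  exact: lquot_piE.
have piK i (x : vquot (W i)) : vquot_pi (W i) (repr x) = x by apply: lquot_repr.
have arrE i x : vquot_pi (W i.+1) (arrow M i (repr (vquot_pi (W i) x))) =
    vquot_pi (W i.+1) (arrow M i x).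
  by apply/piE; rewrite -linearB /= Ws //; apply/piE; rewrite piK.
split=> [i x _|i|i x _].
- rewrite !lfunE /= linfun_linear ?arrE // => a u v.
  rewrite -[u]piK -[v]piK -linearP /= !arrE !linearP /=; congr (_ + _).
- apply/eqP; rewrite eqEsubv subvf /=; apply/subvP=> y _.
  by rewrite -(piK _ y) -(lfunE (vquot_pi (W i))) memv_img ?memvf.
rewrite lfunE /= -[0](linear0 (vquot_pi (W i))).
by apply/eqP/idP=> [/piE|xW]; [rewrite subr0|apply/piE; rewrite subr0].
Qed.

End Isomorphism.

Lemma dim_prod (k : fieldType) (V V' : vectType k) (U : {vspace V}) (U' : {vspace V'})
    (X : {vspace (V * V')%type}) :
  (forall x, (x \in X) = (x.1 \in U) && (x.2 \in U')) ->
  \dim X = (\dim U + \dim U')%N.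
Proof.
move=> XE; pose f := linfun (fst : V * V' -> V); pose g := linfun (snd : V * V' -> V').
have fE x : f x = x.1 by rewrite linfun_linear.
have gE x : g x = x.2 by rewrite linfun_linear.
rewrite -(limg_ker_dim f X) addnC; congr (_ + _)%N.
  congr (\dim _); apply/vspaceP=> u; apply/memv_imgP/idP=> [[x + ->]|uU].
    by rewrite XE fE => /andP[].
  by exists (u, 0); rewrite ?fE // XE /= uU mem0v.
have -> : U' = (g @: (X :&: lker f))%VS.
  apply/vspaceP=> u; apply/idP/memv_imgP=> [uU|[x + ->]].
    by exists (0, u); rewrite ?gE // memv_cap memv_ker fE XE /= mem0v uU eqxx.
  by rewrite memv_cap XE gE => /andP[/andP[]].
apply/esym/limg_dim_eq/eqP; rewrite -subv0; apply/subvP=> x.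
rewrite !memv_cap !memv_ker memv0 fE gE => /andP[/andP[_ /eqP x1] /eqP x2].
by rewrite (surjective_pairing x) x1 x2.
Qed.

Lemma mul_const1_eq0 (R : nzRingType) (b1 b2 : bool) (x : 'rV[R]_b1) :
  b1 -> b2 -> x *m (const_mx 1 : 'M_(b1, b2)) = 0 -> x = 0.
Proof.
case: b1 b2 x => [] [] // x _ _ /rowP x0; apply/rowP=> j; have := x0 j.
by rewrite !ord1 !mxE big_ord1 !mxE mulr1 => ->.
Qed.

Section RankComputations.
Variable k : fieldType.
Implicit Types M N : rep k.

Lemma rkerD M N n i x :
  (x \in rker (@fam0 _ (repD M N)) (@famT _ _) n i) =
  (x.1 \in rker (@fam0 _ M) (@famT _ _) n i) && (x.2 \in rker (@fam0 _ N) (@famT _ _) n i).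
Proof.
elim: n i x => [|n IH] i x; first by rewrite /= !memv0.
have tT M' (y : space M' i) : y \in famT M' i by apply: memvf.
rewrite !mem_rkerS // IH /= linfun_linear // => a u v.
by rewrite !linearP.
Qed.

Lemma rankD M N i n : rank (repD M N) i n = (rank M i n + rank N i n)%N.
Proof.
rewrite /rank /rk (dim_prod (U := famT M i) (U' := famT N i)); last first.
  by move=> x; rewrite !memvf.
rewrite (dim_prod (@rkerD M N n i)).
have := dimvS (rker_le (W1 := @fam0 _ M) (W2 := @famT _ M) (fun i => sub0v _) n i).
have := dimvS (rker_le (W1 := @fam0 _ N) (W2 := @famT _ N) (fun i => sub0v _) n i).
lia.
Qed.

Lemma rank0 i n : rank (rep0 k) i n = 0%N.
Proof. by rewrite /rank /rk dimvf dim_matrix mul1r. Qed.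

Lemma rank_root a i n :
  rank (rep_root k a) i n = ((val a).1 <= i)%N && (i + n <= (val a).2)%N.
Proof.
set M := rep_root k a.
have dimM j : \dim {: space M j} = ((val a).1 <= j <= (val a).2)%N.
  by rewrite dimvf dim_matrix mul1r.
pose c n i := ((val a).1 <= i)%N && (i + n <= (val a).2)%N.
have K : (c n i -> rker (@fam0 _ M) (@famT _ M) n i = 0%VS) /\
    (~~ c n i -> rker (@fam0 _ M) (@famT _ M) n i = fullv).
  elim: n i => [|n IH] i.
    split=> // ai; apply/eqP; rewrite eq_sym -dimv_eq0.
    by rewrite dimM; move: ai; rewrite /c addn0 => /negbTE->.
  have TI (U : {vspace space M i}) : (famT M i :&: U = U)%VS by apply: capfv.
  have [IH0 IH1] := IH i.+1; split=> h; rewrite /rker -/(rker _ _ _ _) TI.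
    have h' : c n i.+1 by move: h; rewrite /c; lia.
    rewrite IH0 // lpreim0; apply/eqP; rewrite -subv0; apply/subvP=> x.
    rewrite memv_ker memv0 linfun_linear; last by move=> d u v; rewrite linearP.
    by move=> /eqP x0; apply/eqP; apply: mul_const1_eq0 x0; move: h; rewrite /c; lia.
  have [h'|h'] := boolP (c n i.+1); last first.
    by rewrite IH1 //; apply/vspaceP=> x; rewrite -memv_preim !memvf.
  have M0 : \dim {: space M i} = 0%N by rewrite dimM; move: h h'; rewrite /c; lia.
  by apply/eqP; rewrite eqEdim subvf M0.
rewrite /rank /rk -/(c n i); have [h|h] := boolP (c n i).
  rewrite (proj1 K h) dimv0 dimM; move: h; rewrite /c; lia.
by rewrite (proj2 K h) subnn.
Qed.

End RankComputations.

(** * Ranks and isomorphism classes *)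

Local Open Scope fset_scope.

(** Total in i and j, to avoid a proof argument: for j < i the truncated difference makes it the
    root (i, i). *)
Definition mkroot i j : proot := exist _ (i, i + (j - i))%N (leq_addr (j - i) i).

Lemma mkrootE i j : (i <= j)%N -> val (mkroot i j) = (i, j).
Proof. by move=> ij /=; rewrite subnKC. Qed.

Lemma mkrootK (a : proot) : mkroot (val a).1 (val a).2 = a.
Proof. by apply: val_inj; rewrite mkrootE ?(valP a) //; case: (val a). Qed.

Lemma mkroot_eq a i j : (i <= j)%N -> (a == mkroot i j) = (val a == (i, j)).
Proof. by move=> ij; rewrite -(inj_eq val_inj) mkrootE. Qed.

Implicit Types al be ga lam mu nu : isoclass.

Definition rootsum (lam : isoclass) (phi : nat -> nat -> nat) : nat :=
  (\sum_(b <- finsupp lam) lam b * phi (val b).1 (val b).2)%N.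

Lemma eq_rootsum lam phi psi :
  (forall i j, (i <= j)%N -> phi i j = psi i j) -> rootsum lam phi = rootsum lam psi.
Proof. by move=> h; apply: eq_bigr => b _; rewrite h // (valP b). Qed.

Lemma rootsumD lam phi psi :
  rootsum lam (fun i j => phi i j + psi i j)%N = (rootsum lam phi + rootsum lam psi)%N.
Proof. by rewrite -big_split; apply: eq_bigr => b _; rewrite mulnDr. Qed.

Lemma rootsum_sub lam (D : {fset proot}) phi : finsupp lam `<=` D ->
  rootsum lam phi = (\sum_(b <- D) lam b * phi (val b).1 (val b).2)%N.
Proof.
move=> sub; apply: big_fset_incl => // b _ /fsfun_dflt->; by rewrite mul0n.
Qed.

Lemma rootsum_delta lam i j : (i <= j)%N ->
  rootsum lam (fun i' j' => (i' == i) && (j' == j)) = lam (mkroot i j).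
Proof.
move=> ij; rewrite (@rootsum_sub lam (mkroot i j |` finsupp lam)) ?fsubsetUr //.
rewrite (big_fsetD1 (mkroot i j)) ?fset1U1 //= subnKC // !eqxx muln1.
rewrite big1_fset ?addn0 // => b; rewrite !inE => /andP[bij _] _.
suff -> : ((val b).1 == i) && ((val b).2 == j) = false by rewrite muln0.
by move: bij; rewrite mkroot_eq // -xpair_eqE -surjective_pairing => /negbTE.
Qed.

(* The rank of the map from vertex a to vertex a + n of M(lam). *)
Definition rho lam a n := rootsum lam (fun i j => (i <= a) && (a + n <= j))%N.

(** These are the indecomposable summands with top S_a and more than n composition factors. They
    give the rank that is new at vertex a ([rhoS]), and their differences in n are the
    multiplicities ([topsS]). *)
Definition tops lam a n := rootsum lam (fun i j => (i == a) && (a + n <= j))%N.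

Lemma rho0 lam n : rho lam 0 n = tops lam 0 n.
Proof. by apply: eq_rootsum => i j _; rewrite leqn0. Qed.

Lemma rhoS lam a n : rho lam a.+1 n = (rho lam a n.+1 + tops lam a.+1 n)%N.
Proof.
rewrite -rootsumD; apply: eq_rootsum => i j _.
by rewrite addSnnS leq_eqVlt ltnS; case: eqP => [->|_] /=; [rewrite ltnn | rewrite addn0].
Qed.

Lemma topsS lam a n : tops lam a n = (tops lam a n.+1 + lam (mkroot a (a + n)))%N.
Proof.
rewrite -rootsum_delta ?leq_addr // -rootsumD; apply: eq_rootsum => i j _.
by case: (i == a) => //=; rewrite addnS; case: (ltngtP (a + n)%N j).
Qed.

Lemma isoclass_inj lam mu : (forall a n, rho lam a n = rho mu a n) -> lam = mu.
Proof.
move=> h; have tE a n : tops lam a n = tops mu a n.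
  by case: a => [|a]; [rewrite -!rho0 | have := h a.+1 n; rewrite !rhoS h => /addnI].
apply/fsfunP=> b; rewrite -(mkrootK b).
have /subnKC <- := valP b.
by have := tE (val b).1 ((val b).2 - (val b).1)%N; rewrite topsS (topsS mu) tE => /addnI.
Qed.

Definition supp_bound (lam : isoclass) : nat := (\max_(b <- finsupp lam) (val b).2).+1.

Lemma supp_boundP lam b : lam b != 0 -> ((val b).2 < supp_bound lam)%N.
Proof.
by move=> lb; rewrite ltnS (big_fsetD1 b) ?mem_finsupp //= leq_maxl.
Qed.

Lemma rho_top lam a n : (supp_bound lam <= a + n)%N -> rho lam a n = 0%N.
Proof.
move=> h; apply: big1_seq => b /andP[_]; rewrite mem_finsupp => /supp_boundP lb.
suff -> : (a + n <= (val b).2)%N = false by rewrite andbF muln0.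
by apply/negbTE; rewrite -ltnNge; apply: leq_trans lb h.
Qed.

Lemma tops_top lam a n : (supp_bound lam <= a + n)%N -> tops lam a n = 0%N.
Proof.
move=> h; apply: big1_seq => b /andP[_]; rewrite mem_finsupp => /supp_boundP lb.
suff -> : (a + n <= (val b).2)%N = false by rewrite andbF muln0.
by apply/negbTE; rewrite -ltnNge; apply: leq_trans lb h.
Qed.

Section RepOf.
Variable k : fieldType.

Lemma rank_rep_of lam i n : rank (rep_of k lam) i n = rho lam i n.
Proof.
rewrite /rep_of /rho /rootsum; elim: (enum_fset (finsupp lam)) => [|b s IH].
  by rewrite !big_nil rank0.
rewrite !big_cons rankD IH; congr (_ + _)%N.
by elim: (lam b) => [|m IHm]; rewrite /= ?rank0 // rankD rank_root IHm mulSn.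
Qed.

Lemma dim_space (M : rep k) i : \dim {: Defs.space M i} = rank M i 0.
Proof. by rewrite /rank /rk /= dimv0 subn0. Qed.

Lemma rep_of_bounded lam : bounded (rep_of k lam) (supp_bound lam).
Proof. by move=> j h; rewrite dim_space rank_rep_of rho_top ?addn0. Qed.

Section Realization.
Variables (M : rep k) (W1 W2 : family M) (b : nat).
Hypotheses (W12 : fam_le W1 W2) (W1s : is_subrep W1) (W2s : is_subrep W2).
Hypothesis W_eq : forall j, (b <= j)%N -> W1 j = W2 j.

Let r := rk W1 W2.

(** What [tops] has to be, by [rhoS], if the ranks come from a class. *)
Definition jump i n := if i is j.+1 then (r i n - r j n.+1)%N else r 0 n.

(* The images of the previous vertex and of the kernel span a subspace of
   codimension jump i n. *)
Lemma dim_jump i n : let U := (arrow M i @: W2 i + rker W1 W2 n i.+1)%VS in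
  [/\ (U <= W2 i.+1)%VS, (r i n.+1 <= r i.+1 n)%N
    & (jump i.+1 n = \dim (W2 i.+1) - \dim U)%N].
Proof.
move=> U; have UW : (U <= W2 i.+1)%VS.
  rewrite subv_add rker_le // andbT; apply/subvP=> _ /memv_imgP[x xW ->].
  exact: W2s.
have K1 := rker_le W12 n.+1 i; have K2 := rker_le W12 n i.+1.
set f := arrow M i in U UW *; have kerE : (rker W1 W2 n.+1 i :&: lker f = W2 i :&: lker f)%VS.
  apply/vspaceP=> x; rewrite [LHS]memv_cap [RHS]memv_cap memv_ker.
  case: eqP => [fx0|]; rewrite ?andbF // !andbT.
  case xW: (x \in W2 i); last by apply/negbTE; apply: contraFN xW; apply: (subvP K1).
  by rewrite mem_rkerS // -/f fx0 mem0v.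
have imgE : ((f @: W2 i) :&: rker W1 W2 n i.+1 = f @: rker W1 W2 n.+1 i)%VS.
  apply/vspaceP=> y; rewrite memv_cap; apply/andP/memv_imgP.
    by case=> /memv_imgP[x xW ->] fxK; exists x; rewrite ?mem_rkerS.
  case=> x xK ->; have xW := subvP K1 _ xK.
  by rewrite memv_img // -mem_rkerS.
have := limg_ker_dim f (W2 i); have := limg_ker_dim f (rker W1 W2 n.+1 i).
rewrite kerE; have := dimv_sum_cap (f @: W2 i) (rker W1 W2 n i.+1).
rewrite imgE -/U; have := dimvS UW; have := dimvS K1; have := dimvS K2.
by move=> *; split=> //; rewrite /jump /r /rk; lia.
Qed.

Lemma jump_mono i n : (jump i n.+1 <= jump i n)%N.
Proof.
case: i => [|i].
  by rewrite /jump /r /rk; have := dimvS (rkerS W12 W1s n 0); lia.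
have [_ _ ->] := dim_jump i n; have [_ _ ->] := dim_jump i n.+1.
suff : (\dim (arrow M i @: W2 i + rker W1 W2 n i.+1) <=
  \dim (arrow M i @: W2 i + rker W1 W2 n.+1 i.+1))%N by lia.
by apply: dimvS; apply: addvS; [exact: subvv | exact: rkerS].
Qed.

Let r_top i n : (b <= i + n)%N -> r i n = 0%N.
Proof. by move=> h; rewrite /r /rk (rker_top (b := b)) ?subnn // addnC. Qed.

Let jump_top i n : (b <= i + n)%N -> jump i n = 0%N.
Proof. by move=> h; case: i h => [|i] h; rewrite /jump r_top. Qed.

(** The multiplicity of (a, a + n) is forced to be jump a n - jump a (n + 1), which [jump_mono]
    makes a true difference. Every subquotient thus gets a class without being decomposed. *)
Lemma rank_realized : exists lam, forall a n, rk W1 W2 a n = rho lam a n.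
Proof.
pose D := [fset a in [seq mkroot i j | i <- iota 0 b, j <- iota 0 b]].
pose m (a : proot) := let i := (val a).1 in let n := ((val a).2 - i)%N in
  (jump i n - jump i n.+1)%N.
pose lam : isoclass := [fsfun a in D => m a].
have lamE a n : lam (mkroot a (a + n)) = (jump a n - jump a n.+1)%N.
  have mE : m (mkroot a (a + n)) = (jump a n - jump a n.+1)%N.
    by rewrite /m mkrootE ?leq_addr //= addKn.
  rewrite fsfunE mE; case: ifP => // nD; have [h|h] := ltnP (a + n) b.
    case/negP: nD; rewrite inE; apply/allpairsP; exists (a, a + n)%N.
    by rewrite !mem_iota /=; split=> //; lia.
  by rewrite !jump_top // addnS leqW.
(* Descending induction on n from the range where both sides vanish; t bounds the distance to it. *)
have topsE a n : tops lam a n = jump a n.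
  have : exists t, (maxn b (supp_bound lam) <= a + n + t)%N.
    by exists (maxn b (supp_bound lam)); apply: leq_addl.
  case=> t; elim: t n => [|t IH] n h.
    by rewrite tops_top ?jump_top //; move: h; lia.
  rewrite topsS IH ?lamE; last by move: h; lia.
  by rewrite subnKC // jump_mono.
exists lam => a; elim: a => [|a IH] n; first by rewrite rho0 topsE.
have [_ h _] := dim_jump a n; move: h.
by rewrite rhoS -IH topsE /jump /r; lia.
Qed.

End Realization.
End RepOf.

Local Close Scope fset_scope.

(** * Hall numbers *)

Local Open Scope classical_set_scope.

(* 0 on infinite sets. *)
Definition fcard (T : Type) (A : set T) : nat := xget 0%N [set n | A #= `I_n]%card.

Lemma fcardP (T : Type) (A : set T) : finite_set A -> (A #= `I_(fcard A))%card.
Proof. by move/finite_setP => [n An]; apply: (xgetPex 0%N (P := [set n | A #= `I_n]%card)); exists n. Qed.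

Lemma fcard_def (T : Type) (A : set T) n : (A #= `I_n)%card -> fcard A = n.
Proof.
move=> An; have := fcardP (proj2 (finite_setP A) (ex_intro _ n An)).
rewrite card_eq_sym => /card_eqPle[] h1 h2; apply/eqP; rewrite eqn_leq.
move: An => /card_eqPle[] h3 h4.
by rewrite -!card_le_II (card_le_trans h1 h3) (card_le_trans h4 h2).
Qed.

Lemma fcard_eq (T U : Type) (A : set T) (B : set U) : finite_set B ->
  (A #= B)%card -> fcard A = fcard B.
Proof. by move=> /fcardP Bn AB; apply: fcard_def; apply: card_eq_trans AB Bn. Qed.

Lemma fcard_sum (T : Type) (s : {fset {classic T}}) (A : set T) :
  (forall x, A x -> (x : {classic T}) \in s) ->
  fcard A = (\sum_(x <- s) `[< A x >])%N.
Proof.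
move=> As; pose X : {fset {classic T}} := [fset x in s | `[< A x >]]%fset.
have XA : [set` X] = A.
  apply/seteqP; split=> x /=; rewrite !inE /=; first by case/andP=> _ /asboolP.
  by move=> Ax; apply/andP; split; [exact: As | exact/asboolP].
have -> : fcard A = #|` X|.
  rewrite -[in LHS]XA -[in RHS](set_fsetK X); apply/esym/card_fset_set.
  by apply: fcardP; apply: finite_fset.
rewrite -sum1_size big_fset /= big_mkcond /=; apply: eq_bigr => x _.
by case: `[< _ >].
Qed.

(** One side of the double count behind associativity: pairs (x, y) are counted by grouping the x by
    class, since the number h of partners y depends on the class only. *)
Lemma sum_fibers (T : Type) (s : {fset {classic T}}) (J : choiceType) (D : {fset J})
    (A : set T) (cl : T -> J) (h : J -> nat) (F : T -> T -> Prop) :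
  (forall x, A x -> cl x \notin D -> h (cl x) = 0%N) ->
  (forall x, A x -> h (cl x) = (\sum_(y <- s) `[< F x y >])%N) ->
  (\sum_(j <- D) h j * (\sum_(x <- s) `[< A x /\ cl x = j >]) =
   \sum_(x <- s) \sum_(y <- s) `[< A x /\ F x y >])%N.
Proof.
move=> hD hF; under eq_bigr do rewrite big_distrr /=.
rewrite exchange_big /=; apply: eq_bigr => x _.
have [Ax|nAx] := pselect (A x); last first.
  rewrite !big1 // => ? _; first by case: asboolP => // -[].
  by case: asboolP => [[]|]; rewrite ?muln0.
transitivity (h (cl x)).
  have [xD|xnD] := boolP (cl x \in D); last first.
    rewrite hD //.
    rewrite big_seq big1 // => j jD; case: asboolP => [[_ e]|]; rewrite ?muln0 //.
    by rewrite e jD in xnD.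
  rewrite (big_fsetD1 (cl x)) //= big1_fset ?addn0.
    by case: asboolP => [|[]]; rewrite ?muln1.
  move=> j; rewrite !inE => /andP[/eqP jx _] _.
  by case: asboolP => [[_ e]|_]; [case: jx | rewrite muln0].
rewrite hF //; apply: eq_bigr => y _; congr (nat_of_bool _).
by apply/asboolP/asboolP => // -[].
Qed.

Section HallNumbers.
Variable k : finFieldType.
Implicit Types M : rep k.

(** The Hall set of the subquotient W2/W1, with isomorphism types expressed by ranks, so that counts
    in a subrepresentation or a quotient take place inside M. *)
Definition hallfam M (W1 W2 : family M) al be : set (family M) := [set W |
  [/\ is_subrep W, fam_le W1 W, fam_le W W2, forall i n, rk W1 W i n = rho be i n
    & forall i n, rk W W2 i n = rho al i n]].

Lemma fam_le0 M (W : family M) : fam_le (@fam0 _ M) W.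
Proof. by move=> i; apply: sub0v. Qed.

Lemma fam_leT M (W : family M) : fam_le W (@famT _ M).
Proof. by move=> i; apply: subvf. Qed.

Lemma hall_setE al be lam :
  hall_set k al be lam = hallfam (@fam0 _ (rep_of k lam)) (@famT _ _) al be.
Proof.
have isoE (M : rep k) mu : rep_iso M (rep_of k mu) <-> (forall i n, rank M i n = rho mu i n).
  rewrite (rep_isoP M (@rep_of_bounded k mu)).
  by split=> h i n; rewrite h rank_rep_of.
apply/seteqP; split=> W /=.
  case=> Ws /isoE s1 /isoE s2; split=> //; try exact: fam_le0; try exact: fam_leT.
    by move=> i n; rewrite -s1; apply: (pres_rank (fam_le0 _) Ws (subrep_pres Ws)).
  move=> i n; rewrite -s2.
  exact: (pres_rank (@fam_leT _ W) (@famT_subrep _ _) (quotrep_pres Ws)).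
case=> Ws _ _ s1 s2; split=> //; apply/isoE=> i n.
  by rewrite -s1; apply/esym; apply: (pres_rank (fam_le0 _) Ws (subrep_pres Ws)).
rewrite -s2; apply/esym.
exact: (pres_rank (@fam_leT _ W) (@famT_subrep _ _) (quotrep_pres Ws)).
Qed.

(** From b on all spaces are 0, so a family is given by its first b members, each coded by a matrix
    over a finite field. *)
Lemma family_finite M b : bounded M b -> finite_set [set: family M].
Proof.
move=> bM; pose T := {dffun forall i : 'I_b, 'M[k]_(dim (space M i))}.
pose e (W : family M) : T := [ffun i : 'I_b => VectorInternalTheory.vs2mx (W i)].
have : finite_set (e @^-1` [set: T]).
  apply: finite_preimage; last exact: finite_finset.
  move=> W W' _ _ /ffunP eW; apply: famP => i; have [ib|bi] := ltnP i b.
    by have := eW (Ordinal ib); rewrite !ffunE /= => /(can_inj (@VectorInternalTheory.vs2mxK _ _)).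
  have M0 := bM i bi; apply/eqP; rewrite eqEdim; have := dimvS (subvf (W i)).
  have := dimvS (subvf (W' i)); rewrite M0 !leqn0 => /eqP-> /eqP W0; rewrite leq0n andbT.
  by move/eqP: W0; rewrite dimv_eq0 => /eqP->; exact: sub0v.
by rewrite preimage_setT.
Qed.

Lemma hallfam_pullback M (W1 W2 : family M) mu al be :
  fam_le W1 W2 -> is_subrep W1 -> is_subrep W2 ->
  (forall i n, rk W1 W2 i n = rho mu i n) ->
  (hallfam W1 W2 al be #= hall_set k al be mu)%card.
Proof.
move=> W12 W1s W2s rkE; rewrite hall_setE.
have rkE' i n : rk W1 W2 i n = rank (rep_of k mu) i n by rewrite rank_rep_of.
have [p pP] := gabriel W12 W1s W2s (@rep_of_bounded k mu) rkE'.
set H := hallfam (fam0 _) _ _ _.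
have -> : hallfam W1 W2 al be = [set pullback W2 p X | X in H].
  have p0 := pullback0 W12 pP; have pT := pullbackT W2 p.
  apply/seteqP; split=> [W [Ws W1W WW2 r1 r2]|_ [X [Xs _ _ r1 r2] <-]] /=.
    have [X XE] := pullback_surj pP W1W WW2; exists X => //; split; try exact: fam_le0; try exact: fam_leT.
    - by apply/(pullback_subrep W2s pP); rewrite XE.
    - by move=> i n; rewrite -(pullback_rk W12 W2s pP) p0 XE.
    - by move=> i n; rewrite -(pullback_rk W12 W2s pP) pT XE.
  split.
  - exact/(pullback_subrep W2s pP).
  - by rewrite -p0; apply/(pullback_le pP)/fam_le0.
  - by rewrite -[X in fam_le _ X]pT; apply/(pullback_le pP)/fam_leT.
  - by move=> i n; rewrite -r1 -(pullback_rk W12 W2s pP) p0.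
  - by move=> i n; rewrite -r2 -(pullback_rk W12 W2s pP) pT.
by apply: inj_card_eq => X Y _ _; apply: (pullback_inj pP).
Qed.

Definition hallnum al be lam := fcard (hall_set k al be lam).

Definition dim_classes (d : nat -> nat) : {fset isoclass} :=
  fset_set [set mu | forall i, rho mu i 0 = d i].

Lemma rho_ge lam i j n : (i <= n <= j)%N -> (lam (mkroot i j) <= rho lam n 0)%N.
Proof.
move=> /andP[ine nj]; rewrite -rootsum_delta ?(leq_trans ine) //.
rewrite /rho /rootsum; apply: leq_sum => b _; rewrite leq_mul2l addn0; apply/orP; right.
by case: eqP => //= ->; case: eqP => //= ->; rewrite ine nj.
Qed.

Lemma mem_dim_classes d b mu : (forall i, (b <= i)%N -> d i = 0%N) ->
  (mu \in dim_classes d) = `[< forall i, rho mu i 0 = d i >].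
Proof.
move=> d0; pose m := (\max_(i < b) d i)%N.
have dm i : (d i <= m)%N.
  by have [ib|bi] := ltnP i b; [exact: (leq_bigmax (Ordinal ib)) | rewrite d0].
pose e mu : {ffun 'I_b * 'I_b -> 'I_m.+1} :=
  [ffun ij : 'I_b * 'I_b => inord (mu (mkroot ij.1 ij.2))].
(* A multiplicity is at most the dimension at each vertex of its root ([rho_ge]), so a class in the
   set is determined by a function from pairs below b to numbers at most m. *)
have fin : finite_set [set mu | forall i, rho mu i 0 = d i].
  rewrite -(eq_finite_set (@inj_card_eq _ _ _ e _)); first exact: finite_finset.
  move=> nu nu'; rewrite !in_setE /= => h h' ee; apply/fsfunP=> a.
  rewrite -(mkrootK a); have := valP a; move: (val a).1 (val a).2 => i j ij.
  have [jb|bj] := ltnP j b; last first.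
    have := @rho_ge nu i j j; have := @rho_ge nu' i j j.
    by rewrite h h' d0 // ij leqnn !leqn0 => /(_ isT)/eqP-> /(_ isT)/eqP->.
  have ib := leq_ltn_trans ij jb.
  have /ffunP /(_ (Ordinal ib, Ordinal jb)) := ee; rewrite !ffunE /=.
  have le1 := @rho_ge nu i j i; have le2 := @rho_ge nu' i j i.
  rewrite h leqnn ij in le1; rewrite h' leqnn ij in le2.
  by move/(congr1 val); rewrite /= !inordK // ltnS;
    [apply: leq_trans (le2 isT) _ | apply: leq_trans (le1 isT) _].
by rewrite /dim_classes in_fset_set.
Qed.

Lemma hall_set_finite al be lam : finite_set (hall_set k al be lam).
Proof. by apply: sub_finite_set (family_finite (@rep_of_bounded k lam)). Qed.

Lemma hallnum_dim al be lam : hallnum al be lam != 0%N ->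
  forall i, rho lam i 0 = (rho al i 0 + rho be i 0)%N.
Proof.
rewrite /hallnum; have [->|/set0P[W]] := eqVneq (hall_set k al be lam) set0.
  by rewrite (@fcard_def _ set0 0) ?eqxx // card_eq_sym II0.
rewrite hall_setE => -[_ _ _ r1 r2] _ i; rewrite -r1 -r2 -(rank_rep_of k lam).
have := dimvS (fam_leT W i); rewrite /rank /rk /= dimv0; lia.
Qed.

(** Both sides count flags x <= y of subrepresentations of M(lam) with x of class ga, y/x of class
    be and M(lam)/y of class al. The left side chooses x first, the right side y. *)
Lemma hallnum_assoc al be ga lam :
  (\sum_(mu <- dim_classes (fun i => rho al i 0 + rho be i 0))
     hallnum al be mu * hallnum mu ga lam =
   \sum_(nu <- dim_classes (fun i => rho be i 0 + rho ga i 0))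
     hallnum al nu lam * hallnum be ga nu)%N.
Proof.
have dtop al' be' i : (maxn (supp_bound al') (supp_bound be') <= i)%N ->
    (rho al' i 0 + rho be' i 0 = 0)%N.
  by rewrite geq_max => /andP[h h']; rewrite !rho_top ?addn0.
have out al' be' mu : mu \notin dim_classes (fun i => rho al' i 0 + rho be' i 0)%N ->
    hallnum al' be' mu = 0%N.
  move=> h; apply/eqP; apply: contraNT h => /hallnum_dim h.
  by rewrite (mem_dim_classes _ (@dtop al' be')); apply/asboolP.
pose M := rep_of k lam; have bM : bounded M _ := @rep_of_bounded k lam.
have finM : finite_set [set: {classic (family M)}] := family_finite bM.
pose s : {fset {classic (family M)}} := fset_set setT.
have sT (W : family M) : (W : {classic (family M)}) \in s by rewrite in_fset_set // in_setT.
have cardE (A : set (family M)) : fcard A = (\sum_(x <- s) `[< A x >])%N.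
  by apply: fcard_sum => x _; apply: sT.
pose cl (W1 W2 : family M) : isoclass :=
  xget zero_class [set c | forall i n, rk W1 W2 i n = rho c i n].
have clP (W1 W2 : family M) : fam_le W1 W2 -> is_subrep W1 -> is_subrep W2 ->
    forall i n, rk W1 W2 i n = rho (cl W1 W2) i n.
  move=> W12 W1s W2s.
  apply: (@xgetPex _ zero_class [set c | forall i n, rk W1 W2 i n = rho c i n]).
  apply: (rank_realized W12 W1s W2s (b := supp_bound lam)) => j jb.
  have M0 : \dim {: space M j} = 0%N by apply: bM.
  have W0 (W : family M) : W j = 0%VS.
    by apply/eqP; rewrite -dimv_eq0 -leqn0 -M0 dimvS ?subvf.
  by rewrite !W0.
have cl_eq (W1 W2 : family M) c : fam_le W1 W2 -> is_subrep W1 -> is_subrep W2 ->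
    cl W1 W2 = c <-> (forall i n, rk W1 W2 i n = rho c i n).
  move=> W12 W1s W2s; have h := clP W1 W2 W12 W1s W2s; split=> [<-//|h'].
  by apply: isoclass_inj => i n; rewrite -h h'.
have pres0 := @fam0_subrep _ M; have presT := @famT_subrep _ M.
pose A x := is_subrep x /\ (forall i n, rk (@fam0 _ M) x i n = rho ga i n).
pose A' y := is_subrep y /\ (forall i n, rk y (@famT _ M) i n = rho al i n).
have E1 mu : hallnum mu ga lam = (\sum_(x <- s) `[< A x /\ cl x (@famT _ M) = mu >])%N.
  rewrite /hallnum hall_setE cardE; apply: eq_bigr => x _; congr (nat_of_bool _).
  apply/asboolP/asboolP => [[xs _ _ r1 r2]|[[xs r1]]].
    by split; [|apply/cl_eq => //; apply: fam_leT].
  by move/cl_eq => r2; split=> //; [exact: fam_le0|exact: fam_leT|apply: r2 => //; exact: fam_leT].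
have E2 nu : hallnum al nu lam = (\sum_(y <- s) `[< A' y /\ cl (@fam0 _ M) y = nu >])%N.
  rewrite /hallnum hall_setE cardE; apply: eq_bigr => y _; congr (nat_of_bool _).
  apply/asboolP/asboolP => [[ys _ _ r1 r2]|[[ys r2]]].
    by split; [|apply/cl_eq => //; apply: fam_le0].
  by move/cl_eq => r1; split=> //; [exact: fam_le0|exact: fam_leT|apply: r1 => //; exact: fam_le0].
have F1 x : A x -> hallnum al be (cl x (@famT _ M)) =
    (\sum_(y <- s) `[< hallfam x (@famT _ M) al be y >])%N.
  case=> xs _; rewrite -cardE; apply/esym/fcard_eq; first exact: hall_set_finite.
  by apply: hallfam_pullback => //; [exact: fam_leT | apply: clP => //; exact: fam_leT].
have F2 y : A' y -> hallnum be ga (cl (@fam0 _ M) y) =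
    (\sum_(x <- s) `[< hallfam (@fam0 _ M) y be ga x >])%N.
  case=> ys _; rewrite -cardE; apply/esym/fcard_eq; first exact: hall_set_finite.
  by apply: hallfam_pullback => //; [exact: fam_le0 | apply: clP => //; exact: fam_le0].
under eq_bigr => mu _ do rewrite E1.
under [RHS]eq_bigr => nu _ do rewrite mulnC E2.
have o1 x : A x -> cl x (@famT _ M) \notin dim_classes (fun i => rho al i 0 + rho be i 0)%N ->
  hallnum al be (cl x (@famT _ M)) = 0%N by move=> _; apply: out.
have o2 x : A' x -> cl (@fam0 _ M) x \notin dim_classes (fun i => rho be i 0 + rho ga i 0)%N ->
  hallnum be ga (cl (@fam0 _ M) x) = 0%N by move=> _; apply: out.
rewrite (sum_fibers o1 F1) (sum_fibers o2 F2) exchange_big /=.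
apply: eq_bigr => y _; apply: eq_bigr => x _; congr (nat_of_bool _).
apply/asboolP/asboolP.
  by case=> [[xs r1]] [ys xy _ r2 r3]; split; split=> //; exact: fam_le0.
by case=> [[ys r1]] [xs _ xy r2 r3]; split; split=> //; exact: fam_leT.
Qed.

End HallNumbers.

Local Close Scope classical_set_scope.

(** * Hyperplanes of a vector space over a finite field *)

Local Open Scope classical_set_scope.

Section Hyperplanes.
Variables (k : finFieldType) (V : vectType k).
Import VectorInternalTheory.
Let q := #|k|.
Let n := dim V.

(** Row vectors stand for linear forms on V; [annih U] collects those that vanish on U. *)
Let phi (c : 'rV[k]_n) : 'Hom(V, 'rV[k]_1) := linfun (fun x : V => v2r x *m c^T).

Let phiE c x : phi c x = v2r x *m c^T.
Proof. by rewrite linfun_linear // => a u v; rewrite linearP mulmxDl scalemxAl. Qed.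

Let annih (U : {vspace V}) := kermx (vs2mx U)^T.

Let rank_annih U : \rank (annih U) = (n - \dim U)%N.
Proof. by rewrite mxrank_ker mxrank_tr. Qed.

Let memvK v (U : {vspace V}) : (v \in U) = (v2r v <= vs2mx U)%MS.
Proof. by rewrite -genmxE. Qed.

Let sub_lker U c : (U <= lker (phi c))%VS = (c <= annih U)%MS.
Proof.
apply/subvP/sub_kermxP => [h|h x].
  apply: trmx_inj; rewrite trmx_mul trmxK trmx0; apply/row_matrixP=> i.
  rewrite row_mul row0.
  have /h : @r2v _ V (row i (vs2mx U)) \in U by rewrite memvK r2vK row_sub.
  by rewrite memv_ker phiE r2vK => /eqP.
rewrite memv_ker phiE memvK => /submxP[y ->]; apply/eqP/trmx_inj.
by rewrite -mulmxA trmx_mul trmx_mul trmxK h mul0mx trmx0.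
Qed.

Let lker_dim c : c != 0 -> (\dim (lker (phi c))).+1 = n.
Proof.
move=> c0; have := limg_ker_dim (phi c) fullv; rewrite capfv dimvf -/n.
have : (\dim (limg (phi c)) <= 1)%N.
  by have := dimvS (subvf (limg (phi c))); rewrite dimvf dim_matrix.
have : \dim (limg (phi c)) != 0%N.
  rewrite dimv_eq0; apply: contraNneq c0 => img0; apply/eqP/trmx_inj; rewrite trmx0.
  apply/row_matrixP=> i; rewrite row0 rowE.
  have : phi c (@r2v _ V (delta_mx 0 i)) \in limg (phi c) by rewrite memv_img ?memvf.
  by rewrite img0 memv0 phiE r2vK => /eqP.
by lia.
Qed.

(** The nonzero forms with kernel H are the nonzero elements of the line [annih H]. *)
Let fiber (H : {vspace V}) : (\dim H).+1 = n ->
  #|[set c : 'rV[k]_n | (c != 0) && (lker (phi c) == H)]%SET| = (q - 1)%N.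
Proof.
move=> dH; have -> : [set c : 'rV[k]_n | (c != 0) && (lker (phi c) == H)]%SET =
    (mxabelem.rowg (annih H) :\ 0)%SET.
  apply/setP=> c; rewrite !inE; case: eqP => //= /eqP c0.
  rewrite -sub_lker eq_sym eqEdim andb_idr // => _.
  by rewrite -ltnS dH -(lker_dim c0).
have := cardsD1 0 (mxabelem.rowg (annih H)).
have -> : #|mxabelem.rowg (annih H)| = #|k|.
  have dH1 : (n - \dim H = 1)%N by rewrite -dH subSnn.
  by rewrite mxabelem.card_rowg rank_annih dH1 expn1.
rewrite mxabelem.mem_rowg sub0mx /q => e.
by rewrite e addKn.
Qed.

Definition hyperplanes U : set {vspace V} := [set H | (\dim H).+1 = n /\ (U <= H)%VS].

Let q_gt1 : (1 < q)%N. Proof. exact: card_finNzRing_gt1. Qed.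

Lemma hyperplanes_finite U : finite_set (hyperplanes U).
Proof.
apply: (@sub_finite_set _ _ ((fun c => lker (phi c)) @` setT)); last first.
  by apply: finite_image; apply: finite_finset.
move=> H [dH _]; have := fiber dH.
case: (set_0Vmem [set c | (c != 0) && (lker (phi c) == H)]%SET) => [->|[c]].
  by rewrite cards0; move: q_gt1; lia.
by rewrite inE => /andP[_ /eqP cH] _; exists c.
Qed.

(** The nonzero forms vanishing on U are sorted by their kernels, each hyperplane being the kernel
    of q - 1 of them. *)
Lemma hyperplanes_card U : (fcard (hyperplanes U) * (q - 1) = q ^ (n - \dim U) - 1)%N.
Proof.
pose D := fset_set (hyperplanes U).
have DE H : (H \in D) = ((\dim H).+1 == n) && (U <= H)%VS.
  rewrite in_fset_set; last exact: hyperplanes_finite.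
  by apply/idP/andP; rewrite in_setE /= => -[/eqP dH UH]; split.
rewrite -(card_fset_set (fcardP (hyperplanes_finite U))) -/D.
have -> : (q ^ (n - \dim U) - 1 = #|(mxabelem.rowg (annih U) :\ 0%R)%SET|)%N.
  have := cardsD1 0 (mxabelem.rowg (annih U)).
  by rewrite mxabelem.card_rowg rank_annih mxabelem.mem_rowg sub0mx /q => ->; rewrite addKn.
rewrite -sum1_card.
transitivity (\sum_(H <- D) \sum_(c in (mxabelem.rowg (annih U) :\ 0%R)%SET)
    (lker (phi c) == H))%N.
  rewrite -[#|` D|]sum1_size big_distrl big_seq [RHS]big_seq /=; apply: eq_bigr => H.
  rewrite DE => /andP[/eqP dH UH]; rewrite mul1n -(fiber dH) -sum1_card -big_mkcondr /=.
  apply: eq_bigl => c; rewrite !inE; case: eqP => //= _.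
  by case: eqP => [cH|]; rewrite ?andbF // -sub_lker cH UH.
rewrite exchange_big /=; apply: eq_bigr => c; rewrite !inE => /andP[c0 cU].
rewrite (big_fsetD1 (lker (phi c))) /=; last by rewrite DE (lker_dim c0) eqxx sub_lker.
rewrite eqxx big1_fset ?addn0 // => H; rewrite !inE => /andP[+ _] _.
by rewrite eq_sym => /negbTE->.
Qed.

End Hyperplanes.

Local Close Scope classical_set_scope.

(** * Hall numbers with a simple quotient *)

Local Open Scope classical_set_scope.

Definition simple_class i : isoclass := class_of_root (simple_root i).

Lemma rho_simple i a n : rho (simple_class i) a n = (a == i) && (n == 0)%N.
Proof.
rewrite /rho (@rootsum_sub _ [fset simple_root i]%fset); last first.
  by apply/fsubsetP=> b; rewrite mem_finsupp fsfunE; case: ifP.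
rewrite big_seq_fset1 fsfunE inE eqxx mul1n /=; congr nat_of_bool.
by lia.
Qed.

Lemma fcardD (T : Type) (A B : set T) : finite_set A -> B `<=` A ->
  fcard A = (fcard (A `\` B) + fcard B)%N.
Proof.
move=> Af BA; pose s : {fset {classic T}} := fset_set (A : set {classic T}).
have sA (x : T) : A x -> (x : {classic T}) \in s.
  by move=> Ax; rewrite /s in_fset_set // in_setE.
have sB (x : T) : B x -> (x : {classic T}) \in s by move=> /BA; apply: sA.
have sAB (x : T) : (A `\` B) x -> (x : {classic T}) \in s by case=> /sA.
rewrite (fcard_sum sA) (fcard_sum sB) (fcard_sum sAB) -big_split.
apply: eq_bigr => x _ /=.
case: asboolP => [Ax|nA]; case: asboolP => [[Ax' nB]|h]; case: asboolP => // Bx.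
- by case: h.
- by case: nA; apply: BA.
Qed.

Lemma sub_rker (k : fieldType) (M : rep k) (W : family M) n a : is_subrep W ->
  rker (@fam0 _ M) W n a = (W a :&: rker (@fam0 _ M) (@famT _ M) n a)%VS.
Proof.
move=> Ws; elim: n a => [|n IH] a /=; first by rewrite capv0.
apply/vspaceP=> x; rewrite !memv_cap -!memv_preim IH memv_cap.
by case xW: (x \in W a) => //=; rewrite (Ws _ _ xW) memvf.
Qed.

Definition prev_img (k : fieldType) (M : rep k) i : {vspace space M i} :=
  if i is j.+1 then limg (arrow M j) else 0%VS.

Section SimpleHallNumbers.
Variables (k : finFieldType) (i : nat) (be lam : isoclass).
Let M := rep_of k lam.
Let K n a := rker (@fam0 _ M) (@famT _ M) n a.
(** [U n] controls the class of a hyperplane H at vertex i that contains the image of the previous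
    vertex: passing to H lowers the rank of the map from i to i + n exactly when H contains [U n],
    and then by 1. Its codimension is [tops lam i n]. *)
Let U n := (prev_img M i + K n i)%VS.

Let rkE a n : rk (@fam0 _ M) (@famT _ M) a n = rho lam a n.
Proof. exact: rank_rep_of. Qed.

Let M0T : fam_le (@fam0 _ M) (@famT _ M). Proof. exact: fam_le0. Qed.

Let dimU n : (\dim {: space M i} - \dim (U n))%N = tops lam i n.
Proof.
rewrite /U /K; case: (i) => [|j] /=; first by rewrite add0v -rho0 -rkE.
have [_ _ h] := dim_jump M0T (@famT_subrep _ M) j n.
by rewrite -h /jump !rkE rhoS addKn.
Qed.

Let U_mono m n : (m <= n)%N -> (U m <= U n)%VS.
Proof.
move=> mn; apply: addvS; first exact: subvv.
exact: rker_mono M0T (@fam0_subrep _ M) _ _ _ mn.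
Qed.

(** A subrepresentation with quotient S_i differs from M at vertex i only, and there by one
    dimension. *)
Let hyp (H : {vspace space M i}) : family M := dfwith (@famT _ M) H.

Let hyp_subrep H : is_subrep (hyp H) <-> (prev_img M i <= H)%VS.
Proof.
split=> [|pH a x].
  move: H; rewrite /hyp /prev_img; case: (i) => [|j] H Hs; first exact: sub0v.
  apply/subvP=> _ /memv_imgP[x _ ->]; have := Hs j x.
  by rewrite dfwith_in dfwith_out ?memvf; [apply | lia].
move=> _; have [e|ne] := eqVneq i a.+1; last by rewrite /hyp dfwith_out ?memvf.
move: H pH; rewrite /hyp /prev_img e => H /subvP; rewrite dfwith_in; apply.
exact: memv_img (memvf _).
Qed.

Let good H := hyperplanes (prev_img M i) H /\
  forall a n, rho lam a n = (rho be a n + ((a == i) && (U n <= H)%VS))%N.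

Let rk_hyp H a n : hyperplanes (prev_img M i) H ->
  (rk (@fam0 _ M) (hyp H) a n + ((a == i) && (U n <= H)%VS) = rho lam a n)%N.
Proof.
move=> [dH pH]; rewrite -rkE /rk sub_rker; last exact/hyp_subrep.
have [e|ne] := eqVneq i a; last first.
  by rewrite /hyp dfwith_out // capfv addn0.
case: _ / e; rewrite /= /hyp dfwith_in.
rewrite /U subv_add pH /= -/(K n i) [\dim (famT M i)]dimvf.
have [KH|nKH] := boolP (K n i <= H)%VS.
  by rewrite (capv_idPr KH) addn1; have := dimvS KH; rewrite -dH; lia.
have := dimv_sum_cap H (K n i).
have : (\dim (H + K n i) <= dim (space M i))%N by rewrite -dimvf dimvS ?subvf.
have := dimv_leqif_eq (addvSl H (K n i)); case=> h1 h2.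
have : (\dim H == \dim (H + K n i)) = false.
  rewrite h2; apply: contraNF nKH => /eqP->; exact: addvSr.
rewrite addn0; have := dimvS (capvSr H (K n i)).
by move: h1; rewrite -dH; lia.
Qed.

Let hallfam_simple W : hallfam (@fam0 _ M) (@famT _ M) (simple_class i) be W <->
  exists2 H, good H & W = hyp H.
Proof.
split=> [[Ws _ _ r1 r2]|[H [hypH rhoE] ->]].
  have WE : W = hyp (W i).
    apply: famP => a; have [e|ne] := eqVneq i a.
      by case: _ / e; rewrite /hyp dfwith_in.
    rewrite /hyp dfwith_out //; apply/eqP; rewrite eqEdim subvf /=.
    by have := r2 a 0; rewrite rho_simple eq_sym (negbTE ne) /rk /=; lia.
  have hypH : hyperplanes (prev_img M i) (W i).
    split; last by apply/hyp_subrep; rewrite -WE.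
    have := r2 i 0; rewrite rho_simple !eqxx /rk /= /famT dimvf; have := dimvS (subvf (W i)).
    by rewrite dimvf => h1 h2; rewrite -(subnK h1) h2.
  by exists (W i) => //; split=> // a n; rewrite -(rk_hyp a n hypH) -WE r1.
have Hs : is_subrep (hyp H) by apply/hyp_subrep; case: hypH.
have HT := fam_leT (hyp H).
split=> //; first exact: fam_le0.
  by move=> a n; apply: (@addIn ((a == i) && (U n <= H)%VS)); rewrite rk_hyp // rhoE.
move=> a n.
rewrite rho_simple /rk.
have rk_full b m : i != b -> rker (hyp H) (@famT _ M) m b = fullv.
  move=> ib; apply/eqP; rewrite eqEsubv subvf /=.
  by have := rker_mono HT Hs b (leq0n m); rewrite /= {1}/hyp dfwith_out.
have [e|ne] := eqVneq i a; last by rewrite rk_full // subnn.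
case: _ / e; case: n => [|n].
  by rewrite /= /hyp dfwith_in /famT dimvf; case: hypH => <- _; rewrite subSnn.
rewrite /rker -/(rker _ _ _ _) rk_full ?(gtn_eqF (ltnSn i)) //; last by rewrite neq_ltn ltnSn.
apply/eqP; rewrite subn_eq0; apply: dimvS; apply/subvP=> x _.
by rewrite memv_cap -memv_preim !memvf.
Qed.

Lemma hallnum_simpleE : hallnum k (simple_class i) be lam = fcard good.
Proof.
rewrite /hallnum hall_setE.
have -> : hallfam (@fam0 _ M) (@famT _ M) (simple_class i) be = [set hyp H | H in good].
  apply/seteqP; split=> W; first by move/hallfam_simple=> [H gH ->]; exists H.
  by case=> H gH <-; apply/hallfam_simple; exists H.
apply: fcard_eq; first by apply: sub_finite_set (hyperplanes_finite (prev_img M i)) => H [].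
apply: inj_card_eq => H H' _ _ /(congr1 (fun W => W i)).
by rewrite /hyp !dfwith_in.
Qed.

(** The [U n] increase, start inside H and end as the whole space, so H contains exactly those with
    n <= m for some m. *)
Lemma hallnum_simple_neq0 : hallnum k (simple_class i) be lam != 0%N ->
  exists m, forall a n, rho lam a n = (rho be a n + ((a == i) && (n <= m)))%N.
Proof.
rewrite hallnum_simpleE; have [->|/set0P[H [[dH pH] rhoE]] _] := eqVneq good set0.
  by rewrite (@fcard_def _ set0 0) ?eqxx // card_eq_sym II0.
have UT n : tops lam i n = 0%N -> ~~ (U n <= H)%VS.
  rewrite -dimU dimvf -dH => /eqP; rewrite subn_eq0 => h.
  by apply/negP => /dimvS; rewrite leqNgt h.
have ex : exists n, ~~ (U n <= H)%VS.
  by exists (supp_bound lam); apply: UT; rewrite tops_top ?leq_addl.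
have U0 : (U 0 <= H)%VS by rewrite /U /K /= subv_add pH sub0v.
case: (ex_minnP ex) => -[|m]; first by rewrite U0.
move=> Um mmin; exists m => a n; rewrite rhoE; congr (_ + nat_of_bool (_ && _))%N.
apply/idP/idP => [Un|nm].
  by rewrite leqNgt; apply: contra Um => mn; apply: subv_trans (U_mono mn) Un.
by apply/negPn/negP=> /mmin; rewrite ltnNge nm.
Qed.

(** The hyperplanes counted contain [U m] but not [U (m + 1)]. With t = tops be i (m + 1) and b the
    multiplicity of (i, i + m) in be, their number is (q ^ (t + b + 1) - q ^ t) / (q - 1). *)
Lemma hallnum_simple m :
  (forall a n, rho lam a n = rho be a n + ((a == i) && (n <= m)))%N ->
  hallnum k (simple_class i) be lam =
  (#|k| ^ tops be i m.+1 * \sum_(j < (be (mkroot i (i + m))).+1) #|k| ^ j)%N.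
Proof.
move=> rhoE; rewrite hallnum_simpleE.
have -> : good = hyperplanes (U m) `\` hyperplanes (U m.+1).
  apply/seteqP; split=> H /=.
    case=> -[dH pH] goodH.
    have UH n : (U n <= H)%VS = (n <= m)%N.
      by have := goodH i n; rewrite rhoE eqxx /= => /addnI; case: (U n <= H)%VS; case: (n <= m)%N.
    by split; [split; rewrite ?UH | case; rewrite UH ltnn].
  case=> -[dH UmH] nU; have nU' : ~~ (U m.+1 <= H)%VS by apply/negP=> h; apply: nU.
  split; first by split=> //; apply: subv_trans UmH; apply: addvSl.
  move=> a n; rewrite rhoE; congr (_ + nat_of_bool (_ && _))%N.
  apply/idP/idP => [nm|]; first by apply: subv_trans UmH; apply: U_mono.
  by apply: contraLR; rewrite -ltnNge => mn; apply: contra nU'; apply: subv_trans; apply: U_mono.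
have sub : hyperplanes (U m.+1) `<=` hyperplanes (U m).
  by move=> H [dH UH]; split=> //; apply: subv_trans UH; apply: U_mono.
have q1 : (0 < #|k| - 1)%N by rewrite subn_gt0 card_finNzRing_gt1.
have topsE n : tops lam i n = (tops be i n + (n <= m))%N.
  move: rhoE; case: (i) => [|j] h; first by rewrite -!rho0 h.
  have := h j.+1 n; rewrite !rhoS h eqxx /= (ltn_eqF (ltnSn j)) /= addn0 -addnA.
  by move/addnI.
apply/eqP; rewrite -(eqn_pmul2r q1); apply/eqP.
have := fcardD (hyperplanes_finite (U m)) sub.
move/(congr1 (muln^~ (#|k| - 1)%N)); rewrite mulnDl !hyperplanes_card.
rewrite -!dimvf !dimU !topsE leqnn ltnn addn0 addn1.
rewrite (topsS be i m).
set t := tops be i m.+1; set b := be _; rewrite -mulnA.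
have -> : ((\sum_(j < b.+1) #|k| ^ j) * (#|k| - 1) = #|k| ^ b.+1 - 1)%N.
  by rewrite !subn1 predn_exp mulnC.
rewrite -addnS expnD mulnBr muln1.
have : (0 < #|k| ^ t)%N by rewrite expn_gt0 ltnW ?card_finNzRing_gt1.
have : (0 < #|k| ^ b.+1)%N by rewrite expn_gt0 ltnW ?card_finNzRing_gt1.
nia.
Qed.

End SimpleHallNumbers.

Local Close Scope classical_set_scope.

(** * The Euler form *)

Section DimensionModulo.
Variables (k : fieldType) (V : vectType k) (Z W : {vspace V}).
Hypothesis WZ : (W <= Z)%VS.

(** The condition of [has_dim], for the congruence modulo a subspace. *)
Definition basis_mod n (X : 'I_n -> V) := (forall j, X j \in Z) /\
  forall v, v \in Z -> exists! c : 'rV[k]_n, v - \sum_j c 0 j *: X j \in W.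

Lemma basis_mod_dim n (X : 'I_n -> V) : basis_mod X -> \dim Z = (n + \dim W)%N.
Proof.
move=> [XZ XP]; pose L : 'Hom('rV[k]_n, V) := linfun (fun c : 'rV[k]_n => \sum_j c 0 j *: X j).
have LE c : L c = \sum_j c 0 j *: X j.
  rewrite linfun_linear // => a u v; rewrite scaler_sumr -big_split; apply: eq_bigr => j _.
  by rewrite !mxE scalerDl scalerA.
have LZ c : L c \in Z by rewrite LE memv_suml // => j _; apply: memvZ.
have L0 c : L c \in W -> c = 0.
  move=> LW; have [c' [_ uniq]] := XP 0 (mem0v _).
  have <- : c' = c by apply: uniq; rewrite -LE sub0r memvN.
  by apply: uniq; rewrite -LE linear0 subr0 mem0v.
have imgL : \dim (limg L) = n.
  rewrite limg_dim_eq ?dimvf ?dim_matrix ?mul1r //; apply/eqP; rewrite -subv0.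
  by apply/subvP=> c; rewrite memv_cap memv_ker memv0 => /andP[_ /eqP Lc]; rewrite (L0 c) // Lc mem0v.
rewrite -imgL -dimv_disjoint_sum.
  congr (\dim _); apply/eqP; rewrite eqEsubv; apply/andP; split.
    apply/subvP=> v vZ; have [c [cW _]] := XP v vZ.
    by rewrite -(subrK (L c) v) addrC memv_add ?memv_img ?memvf // LE.
  by rewrite subv_add WZ andbT; apply/subvP=> _ /memv_imgP[c _ ->].
apply/eqP; rewrite -subv0; apply/subvP=> _ /memv_capP[/memv_imgP[c _ ->] /L0 ->].
by rewrite linear0 mem0v.
Qed.

Lemma basis_mod_exists : exists X : 'I_(\dim Z - \dim W) -> V, basis_mod X.
Proof.
pose C := (Z :\: W)%VS.
have dC : \dim C = (\dim Z - \dim W)%N.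
  by have := dimv_cap_compl Z W; rewrite (capv_idPr WZ) -/C; lia.
rewrite -dC; pose X j := tnth (vbasis C) j; exists X.
have XC j : X j \in C by apply: vbasis_mem; apply: mem_tnth.
have CZ : (C <= Z)%VS by apply: diffvSl.
split=> [j|v vZ]; first exact: (subvP CZ).
have XE (c : 'rV[k]_(\dim C)) : \sum_j c 0 j *: X j = \sum_j c 0 j *: (vbasis C)`_j.
  by apply: eq_bigr => j _; rewrite /X (tnth_nth 0).
have /memv_addP[u uC [w wW vE]] : v \in (C + W)%VS.
  by rewrite addv_diff; apply: subvP (addvSl _ _) _ vZ.
exists (\row_j coord (vbasis C) j u); split.
  rewrite XE; under eq_bigr do rewrite mxE.
  by rewrite -coord_vbasis // vE addrAC subrr add0r.
move=> c cW; apply/rowP=> j; rewrite mxE.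
have dW : u - \sum_j c 0 j *: X j \in W.
  by rewrite -(memvDr _ wW) addrAC -vE.
have dCC : u - \sum_j c 0 j *: X j \in C by rewrite memvB // memv_suml // => i _; apply: memvZ.
have : u - \sum_j c 0 j *: X j \in (C :&: W)%VS by rewrite memv_cap dCC.
rewrite capv_diff memv0 subr_eq0 => /eqP->; rewrite XE coord_sum_free //.
exact: basis_free (vbasisP C).
Qed.

End DimensionModulo.

Section FiniteFamilies.
Variables (k : fieldType) (V : nat -> vectType k).

(** [has_dim] speaks of families over all vertices, an infinite product. When the spaces vanish from
    vertex n on, [restr] identifies these families with vectors of [pvec n]. *)
Fixpoint pvec n : vectType k :=
  if n is m.+1 then ((pvec m * V m)%type : vectType k) else 'rV[k]_0.

Fixpoint restr n (z : forall i, V i) : pvec n :=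
  if n is m.+1 then (restr m z, z m) else 0 : 'rV[k]_0.

Fixpoint extn n : pvec n -> forall i, V i :=
  if n is m.+1 then fun x : pvec m.+1 => dfwith (extn x.1) x.2 else fun _ _ => 0.

Lemma restr_eq n z z' : (forall i, (i < n)%N -> z i = z' i) -> restr n z = restr n z'.
Proof.
elim: n => [//|n IH] h /=; rewrite (h n) // (IH _) // => i ni; apply: h.
exact: ltnW.
Qed.

Lemma extnK n (x : pvec n) : restr n (extn x) = x.
Proof.
elim: n x => [x|n IH [x y]] /=; first by apply/rowP => -[].
rewrite dfwith_in; congr pair; rewrite -[RHS]IH.
by apply: restr_eq => i ni; rewrite dfwith_out // gtn_eqF.
Qed.

Lemma extn_lt n z i : (i < n)%N -> extn (restr n z) i = z i.
Proof.
elim: n => [//|n IH] /=; rewrite ltnS leq_eqVlt; case: eqP => [->|/eqP ne] /= ni.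
  by rewrite dfwith_in.
by rewrite dfwith_out ?IH // eq_sym.
Qed.

Lemma restr_is_linear n a (z z' : forall i, V i) :
  restr n (fun i => a *: z i + z' i) = a *: restr n z + restr n z'.
Proof. by elim: n => [|n IH] /=; [rewrite scaler0 addr0 | rewrite IH]. Qed.

Lemma restr0 n : restr n (fun i => 0 : V i) = 0.
Proof. by elim: n => [|n IH] //=; rewrite IH. Qed.

Lemma restrB n (z z' : forall i, V i) :
  restr n (fun i => z i - z' i) = restr n z - restr n z'.
Proof. by elim: n => [|n IH] /=; [rewrite subr0 | rewrite IH]. Qed.

Lemma restr_sum n m (c : 'rV[k]_m) (z : 'I_m -> forall i, V i) :
  restr n (fun i => \sum_j c 0 j *: z j i) = \sum_j c 0 j *: restr n (z j).
Proof.
elim: n => [|n IH] /=; first by rewrite big1 // => j _; rewrite scaler0.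
rewrite IH; elim: (index_enum _) => [|j s IHs]; first by rewrite !big_nil.
by rewrite !big_cons -IHs.
Qed.

Lemma pvec_dim n : dim (pvec n) = (\sum_(i < n) dim (V i))%N.
Proof.
elim: n => [|n IH]; first by rewrite big_ord0.
by rewrite big_ord_recr /= -IH.
Qed.

Variable b : nat.
Hypothesis V0 : forall i, (b <= i)%N -> forall x : V i, x = 0.

Lemma restr_inj z z' : restr b z = restr b z' -> forall i, z i = z' i.
Proof.
move=> e i; have [ib|bi] := ltnP i b; last by rewrite (V0 bi (z i)) (V0 bi (z' i)).
by rewrite -(extn_lt z ib) e extn_lt.
Qed.

End FiniteFamilies.

Section HomExt.
Variables (k : fieldType) (M N : rep k) (b : nat).
Hypothesis bM : bounded M b.

Let H0 i : vectType k := 'Hom(space M i, space N i).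
Let H1 i : vectType k := 'Hom(space M i, space N i.+1).

Let M0 i : (b <= i)%N -> forall x : space M i, x = 0.
Proof.
move=> /bM/eqP; rewrite dimv_eq0 => /eqP M0 x.
by apply/eqP; rewrite -memv0 -M0 memvf.
Qed.

Let H00 i : (b <= i)%N -> forall x : H0 i, x = 0.
Proof. by move=> bi x; apply/lfunP => u; rewrite (M0 bi u) !linear0. Qed.

Let H10 i : (b <= i)%N -> forall x : H1 i, x = 0.
Proof. by move=> bi x; apply/lfunP => u; rewrite (M0 bi u) !linear0. Qed.

(** The differential of the standard two-term complex of a quiver: its kernel is Hom(M, N) and its
    cokernel Ext^1(M, N). *)
Let delta (h : forall i, H0 i) i : H1 i := (h i.+1 \o arrow M i)%VF - (arrow N i \o h i)%VF.

Let deltaE h i x : delta h i x = h i.+1 (arrow M i x) - arrow N i (h i x).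
Proof. by rewrite /delta add_lfunE opp_lfunE !comp_lfunE. Qed.

Let D : 'Hom(pvec H0 b, pvec H1 b) := linfun (fun x => restr b (delta (extn x))).

Let DE h : D (restr b h) = restr b (delta h).
Proof.
rewrite linfun_linear.
  apply: restr_eq => i _; apply/lfunP => x.
  by rewrite !deltaE !(restr_inj H00 (extnK (restr b h))).
move=> a u v; rewrite -restr_is_linear; apply: restr_eq => i _; apply/lfunP => x.
have e j : extn (a *: u + v) j = a *: extn u j + extn v j.
  apply: (restr_inj H00 (z' := fun j => a *: extn u j + extn v j)).
  by rewrite extnK restr_is_linear !extnK.
rewrite deltaE !e !add_lfunE !scale_lfunE !deltaE linearD linearZ /= scalerBr.
by rewrite /= opprD addrACA opp_lfunE !comp_lfunE.
Qed.

Let is_homE h : is_hom h <-> D (restr b h) = 0.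
Proof.
rewrite DE -(restr0 H1 b); split=> [hom|/(restr_inj H10) d0 i x].
  by apply: restr_eq => i _; apply/lfunP => x; rewrite deltaE hom subrr zero_lfunE.
by apply/eqP; rewrite -subr_eq0 -deltaE d0 zero_lfunE.
Qed.

Let ext_equivE (z z' : forall i, H1 i) :
  ext_equiv z z' <-> restr b z - restr b z' \in limg D.
Proof.
have arrE (z1 : forall i, H1 i) i (u : space (extrep z1) i) :
    arrow (extrep z1) i u = (arrow N i u.1 + z1 i u.2, arrow M i u.2).
  rewrite linfun_linear // => a [u1 u2] [v1 v2] /=.
  rewrite !linearP; apply: injective_projections => //=.
  by rewrite scalerDr addrACA.
split=> [[h [h_hom h_l h_r]]|].
  (* An equivalence is unitriangular for E_i = N_i + M_i, so its component g from M_i to N_i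
     determines it. *)
  pose g i : H0 i := linfun (fun x : space M i => (h i (0, x)).1).
  have gE i x : g i x = (h i (0, x)).1.
    rewrite linfun_linear // => a u v.
    have -> : (0, a *: u + v) = a *: (0, u) + (0, v) :> space N i * space M i.
      by apply: injective_projections => //=; rewrite scaler0 addr0.
    by rewrite linearP.
  have hE i y x : h i (y, x) = (y + g i x, x).
    have -> : (y, x) = (y, 0) + (0, x) :> space N i * space M i.
      by apply: injective_projections; rewrite /= ?addr0 ?add0r.
    rewrite linearD /= h_l [h i (0, x)]surjective_pairing -gE h_r.
    by apply: injective_projections; rewrite /= ?add0r.
  rewrite -memvN opprB; have -> : restr b z' - restr b z = D (restr b g).
    rewrite DE -restrB; apply: restr_eq => i _; apply/lfunP => x.
    rewrite deltaE add_lfunE opp_lfunE.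
    have := h_hom i (0, x); rewrite !arrE /= !hE /= linear0 !add0r => -[e].
    have -> : g i.+1 (arrow M i x) = arrow N i (g i x) + z' i x - z i x.
      by rewrite -e addrAC subrr add0r.
    by rewrite [RHS]addrAC (addrAC (arrow N i (g i x))) subrr add0r.
  by rewrite memv_img ?memvf.
move=> /memv_imgP[v _ e].
pose g i := extn v i.
have zE i : z i - z' i = delta g i.
  apply: (restr_inj H10 (z := fun i => z i - z' i)).
  by rewrite restrB e -DE /g extnK.
pose hf i (u : space N i * space M i) := (u.1 - g i u.2, u.2).
have hfE i u : linfun (hf i) u = hf i u.
  apply: linfun_linear => a u1 u2; rewrite /hf /= linearP.
  by apply: injective_projections => //=; rewrite scalerBr opprD addrACA.
exists (fun i => linfun (hf i)); split=> [i u|i y|i x].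
- rewrite !hfE !arrE /hf /=; congr pair; have := zE i.
  move/lfunP/(_ u.2); rewrite deltaE add_lfunE opp_lfunE linearB /= => /(canRL (subrK _)) ->.
  by rewrite -!addrA; congr (_ + _); rewrite addrC -!addrA addNr addr0.
- by rewrite hfE /hf /= linear0 subr0.
by rewrite hfE.
Qed.

Let hom_dimE n : hom_dim M N n <-> n = \dim (lker D).
Proof.
have key (z : forall i, H0 i) m (c : 'rV[k]_m) (X : 'I_m -> forall i, H0 i) :
    z = (fun i => \sum_j c 0 j *: X j i) <->
    restr b z - \sum_j c 0 j *: restr b (X j) \in 0%VS.
  rewrite memv0 subr_eq0 -restr_sum; split=> [->//|/eqP /(restr_inj H00) h].
  exact: functional_extensionality_dep.
split=> [[X [XZ XP]]|->].
  have := @basis_mod_dim _ _ (lker D) 0%VS (sub0v _) n (fun j => restr b (X j)).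
  rewrite dimv0 addn0 => -> //; split=> [j|v vD]; first by rewrite memv_ker; apply/eqP/is_homE.
  have /XP[c [cE cU]] : is_hom (extn v) by apply/is_homE/eqP; rewrite extnK -memv_ker.
  exists c; split=> [|c' c'E]; first by have /key := cE; rewrite extnK.
  by apply: cU; apply/key; rewrite extnK.
have := @basis_mod_exists _ _ (lker D) 0%VS (sub0v _).
rewrite dimv0 subn0 => -[X [XZ XP]]; exists (fun j => extn (X j)).
split=> [j|z /is_homE zD]; first by apply/is_homE/eqP; rewrite extnK -memv_ker.
have /XP[c [cE cU]] : restr b z \in lker D by rewrite memv_ker zD.
have sumE c' : \sum_j c' 0 j *: restr b (extn (X j)) = \sum_j c' 0 j *: X j.
  by apply: eq_bigr => j _; rewrite extnK.
exists c; split=> [|c' /key]; first by apply/key; rewrite sumE.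
by rewrite sumE => /cU.
Qed.

Let ext_dimE n : ext_dim M N n <-> (n + \dim (limg D) = dim (pvec H1 b))%N.
Proof.
have key (z : forall i, H1 i) m (c : 'rV[k]_m) (X : 'I_m -> forall i, H1 i) :
    ext_equiv z (fun i => \sum_j c 0 j *: X j i) <->
    restr b z - \sum_j c 0 j *: restr b (X j) \in limg D.
  by rewrite ext_equivE restr_sum.
rewrite -dimvf; split=> [[X [_ XP]]|].
  apply/esym; apply: (@basis_mod_dim _ _ fullv (limg D) (subvf _) n (fun j => restr b (X j))).
  split=> [j|v _]; first exact: memvf.
  have [c [cE cU]] := XP (extn v) I.
  exists c; split=> [|c' c'E]; first by have /key := cE; rewrite extnK.
  by apply: cU; apply/key; rewrite extnK.
have := @basis_mod_exists _ _ fullv (limg D) (subvf _).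
move=> + nE; rewrite -nE addnK => -[X [XZ XP]]; exists (fun j => extn (X j)).
split=> // z _; have [c [cE cU]] := XP (restr b z) (memvf _).
have sumE c' : \sum_j c' 0 j *: restr b (extn (X j)) = \sum_j c' 0 j *: X j.
  by apply: eq_bigr => j _; rewrite extnK.
exists c; split=> [|c' /key]; first by apply/key; rewrite sumE.
by rewrite sumE => /cU.
Qed.

(** Rank-nullity for [D], with terms arranged to avoid subtraction. *)
Lemma euler_char h e : hom_dim M N h -> ext_dim M N e ->
  (h + \sum_(i < b) dim (space M i) * dim (space N i.+1) =
   e + \sum_(i < b) dim (space M i) * dim (space N i))%N.
Proof.
have e0 : dim (pvec H0 b) = (\sum_(i < b) dim (space M i) * dim (space N i))%N.
  exact: pvec_dim.
have e1 : dim (pvec H1 b) = (\sum_(i < b) dim (space M i) * dim (space N i.+1))%N.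
  exact: pvec_dim.
move=> /hom_dimE-> /ext_dimE; rewrite -e1 -e0 => <-.
by rewrite -(dimvf (pvec H0 b)) -(limg_ker_dim D fullv) capfv addnCA.
Qed.

Lemma hom_ext_dim_exist : exists h e, hom_dim M N h /\ ext_dim M N e.
Proof.
exists (\dim (lker D)), (dim (pvec H1 b) - \dim (limg D))%N.
split; first exact/hom_dimE.
by apply/ext_dimE; rewrite subnK // -dimvf dimvS ?subvf.
Qed.

End HomExt.

Lemma euler_formE al be b : (supp_bound al <= b)%N ->
  euler_form al be =
  (\sum_(i < b) rho al i 0 * rho be i 0)%N%:Z - (\sum_(i < b) rho al i 0 * rho be i.+1 0)%N%:Z.
Proof.
move=> ab.
have bd (k : fieldType) lam : (supp_bound lam <= b)%N -> bounded (rep_of k lam) b.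
  by move=> lb j bj; apply: rep_of_bounded; apply: leq_trans bj.
have dE (k : fieldType) lam i : dim (space (rep_of k lam) i) = rho lam i 0.
  by rewrite -dimvf dim_space rank_rep_of.
have e0 (k : fieldType) : (\sum_(i < b) dim (space (rep_of k al) i) * dim (space (rep_of k be) i) =
    \sum_(i < b) rho al i 0 * rho be i 0)%N by apply: eq_bigr => i _; rewrite !dE.
have e1 (k : fieldType) : (\sum_(i < b) dim (space (rep_of k al) i) * dim (space (rep_of k be) i.+1) =
    \sum_(i < b) rho al i 0 * rho be i.+1 0)%N by apply: eq_bigr => i _; rewrite !dE.
set P := [set n : int | forall k : fieldType, exists h e : nat,
  [/\ hom_dim (rep_of k al) (rep_of k be) h,
      ext_dim (rep_of k al) (rep_of k be) e & n = h%:Z - e%:Z]]%classic.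
(* A member of the set is identified by looking at one field, the rationals; that the same value
   serves every field shows below that the set has a member. *)
have PE n : P n -> n = (\sum_(i < b) rho al i 0 * rho be i 0)%N%:Z -
    (\sum_(i < b) rho al i 0 * rho be i.+1 0)%N%:Z.
  move=> /(_ rat)[h [e [hh he ->]]].
  have := euler_char (bd rat al ab) hh he.
  by rewrite e0 e1; lia.
apply: PE; apply: (xgetPex 0 (P := P)).
exists ((\sum_(i < b) rho al i 0 * rho be i 0)%N%:Z -
    (\sum_(i < b) rho al i 0 * rho be i.+1 0)%N%:Z) => k.
have [h [e [hh he]]] := hom_ext_dim_exist (rep_of k be) (bd k al ab).
exists h, e; split=> //; have := euler_char (bd k al ab) hh he.
by rewrite e0 e1; lia.
Qed.

(** * Actions of free algebras *)

Section LinearExtension.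
Variables (R : comNzRingType) (X : choiceType) (V : lmodType R) (f : X -> V).

Definition lext (x : {malg R[X]}) : V := \sum_(k <- msupp x) x@_k *: f k.

Lemma lextE (x : {malg R[X]}) : lext x = \sum_(k <- msupp x) x@_k *: f k.
Proof. by []. Qed.

Lemma lext_sub (x : {malg R[X]}) (D : {fset X}) : (msupp x `<=` D)%fset ->
  lext x = \sum_(k <- D) x@_k *: f k.
Proof.
move=> sub; apply: big_fset_incl => // k _ /mcoeff_outdom ->; by rewrite scale0r.
Qed.

Lemma lext_is_linear : linear lext.
Proof.
move=> a x y; pose D := (msupp x `|` msupp y `|` msupp (a *: x + y))%fset.
rewrite !(@lext_sub _ D); try by apply/fsubsetP=> k; rewrite !inE => ->; rewrite ?orbT.
rewrite scaler_sumr -big_split; apply: eq_bigr => k _.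
by rewrite mcoeffD mcoeffZ scalerDl scalerA.
Qed.

HB.instance Definition _ := GRing.isLinear.Build R {malg R[X]} V _ lext lext_is_linear.

Lemma lextU k : lext << k >> = f k.
Proof. by rewrite /lext msuppU oner_eq0 big_seq_fset1 mcoeffUU scale1r. Qed.

End LinearExtension.

Lemma malgUZ (R : comNzRingType) (X : choiceType) (x : {malg R[X]}) :
  x = \sum_(k <- msupp x) x@_k *: << k >>.
Proof.
rewrite [LHS]monalgE; apply: eq_bigr => k _; apply/malgP=> l.
by rewrite mcoeffZ !mcoeffU mulr_natr.
Qed.

Lemma mcoeff_sum (R : comNzRingType) (X : choiceType) (J : Type) (r : seq J) (P : pred J)
    (F : J -> {malg R[X]}) k :
  (\sum_(j <- r | P j) F j)@_k = \sum_(j <- r | P j) (F j)@_k.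
Proof. exact: raddf_sum. Qed.

Lemma mcoeff_fset_sum (R : comNzRingType) (X : choiceType) (D : {fset X}) (c : X -> R) y :
  (forall x, x \notin D -> c x = 0) ->
  (\sum_(x <- D) c x *: (<< x >> : {malg R[X]}))@_y = c y.
Proof.
move=> c0; rewrite mcoeff_sum; have [yD|yD] := boolP (y \in D).
  rewrite (big_fsetD1 y) //= mcoeffZ mcoeffUU mulr1 big1_fset ?addr0 // => x.
  by rewrite !inE => /andP[/negbTE ne _] _; rewrite mcoeffZ mcoeffU ne mulr0.
rewrite c0 // big_seq big1 // => x xD; rewrite mcoeffZ mcoeffU.
by case: eqP => [e|_]; [move: yD; rewrite -e xD | rewrite mulr0].
Qed.

Lemma malg_ind (R : comNzRingType) (X : choiceType) (P : {malg R[X]} -> Prop) :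
  P 0 -> (forall k, P << k >>) -> (forall a x, P x -> P (a *: x)) ->
  (forall x y, P x -> P y -> P (x + y)) -> forall x, P x.
Proof.
move=> P0 PU PZ PD x; rewrite [x]malgUZ.
by elim/big_ind: _ => // k _; apply/PZ/PU.
Qed.

Lemma linear_malg_eq (R : comNzRingType) (X : choiceType) (V : lmodType R)
    (f g : {linear {malg R[X]} -> V}) :
  (forall k, f << k >> = g << k >>) -> f =1 g.
Proof.
move=> fg; apply: malg_ind => [|//|a x fgx|x y fgx fgy]; first by rewrite !linear0.
  by rewrite !linearZ fgx.
by rewrite !linearD fgx fgy.
Qed.

Section FreeAction.
Variables (R : comNzRingType) (I : choiceType) (V : lmodType R).
Variable op : I -> {linear V -> V}.

Definition word_act (w : seq I) (v : V) : V := foldr (fun i => op i) v w.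

Lemma word_act_is_linear w : linear (word_act w).
Proof. by elim: w => [|i w IH] a x y //=; rewrite IH linearP. Qed.

Definition act (t : falg R I) (v : V) : V := lext (fun m : {fmonom I} => word_act m v) t.

Lemma act_is_linear t : linear (act t).
Proof.
move=> a x y; rewrite /act /lext scaler_sumr -big_split; apply: eq_bigr => m _.
by rewrite word_act_is_linear scalerDr !scalerA mulrC.
Qed.

HB.instance Definition _ t := GRing.isLinear.Build R V V _ (act t) (act_is_linear t).

Lemma act_gen i v : act (falg_gen R i) v = op i v.
Proof. by rewrite /act lextU /= fmU. Qed.

Lemma act1 v : act 1 v = v.
Proof. by rewrite /act lextU /= fm1. Qed.

Lemma actZ a t v : act (a *: t) v = a *: act t v.
Proof. exact: linearZ. Qed.

Lemma actD t u v : act (t + u) v = act t v + act u v.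
Proof. exact: raddfD. Qed.

Lemma actB t u v : act (t - u) v = act t v - act u v.
Proof. exact: raddfB. Qed.

Lemma act0 v : act 0 v = 0.
Proof. exact: raddf0. Qed.

Lemma falg_word m : (<< m >> : falg R I) = \prod_(i <- (m : seq I)) falg_gen R i.
Proof.
case: m => w; elim: w => [|i w IH] /=; first by rewrite big_nil -fmoneE.
rewrite big_cons -IH malgM_def fgmulUU mulr1; congr << _ >>.
by rewrite /mmul /= fmmulE fmuE.
Qed.

Lemma falg_ind (P : falg R I -> Prop) :
  P 1 -> (forall i t, P t -> P (falg_gen R i * t)) -> (forall a t, P t -> P (a *: t)) ->
  (forall t u, P t -> P u -> P (t + u)) -> forall t, P t.
Proof.
move=> P1 PM PZ PD; apply: malg_ind => //; first by rewrite -(scale0r 1); apply: PZ.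
move=> m; rewrite falg_word; elim: (m : seq I) => [|i w IH]; first by rewrite big_nil.
by rewrite big_cons; apply: PM.
Qed.

Lemma act_genM i t v : act (falg_gen R i * t) v = op i (act t v).
Proof.
elim/malg_ind: t => [|m|a t IH|t u IHt IHu].
- by rewrite mulr0 !act0 linear0.
- have -> : falg_gen R i * << m >> = << mmul (fmu i) m >>.
    by rewrite malgM_def fgmulUU mulr1.
  by rewrite /act !lextU fmM fmU.
- by rewrite -scalerAr [LHS]actZ [in RHS]actZ linearZ; congr (_ *: _).
by rewrite mulrDr [LHS]actD [in RHS]actD linearD; congr (_ + _).
Qed.

Lemma actM t u v : act (t * u) v = act t (act u v).
Proof.
elim/falg_ind: t => [|i t IH|a t IH|t t' IH IH'].
- by rewrite mul1r act1.
- rewrite -mulrA [LHS]act_genM; transitivity (op i (act t (act u v))); first by congr (op i _).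
  exact/esym/act_genM.
- by rewrite -scalerAl [LHS]actZ [RHS]actZ; congr (_ *: _).
by rewrite mulrDl [LHS]actD [RHS]actD; congr (_ + _).
Qed.

Lemma act_commutator i t (a : R) v :
  act (falg_gen R i * t - a *: (t * falg_gen R i)) v = op i (act t v) - a *: act t (op i v).
Proof.
rewrite [LHS]actB; congr (_ - _); first exact: act_genM.
rewrite [LHS]actZ; congr (_ *: _); rewrite [LHS]actM; congr (act t _); exact: act_gen.
Qed.

End FreeAction.

(* Unification would otherwise compare actions by unfolding them. *)
#[global] Opaque act lext falg_gen fgmul fgscale fgadd fgopp fgzero fgone mkmalgU.

(** * Multiplication by simple classes *)

Lemma mkroot_eqE i j i' j' : (i <= j)%N -> (i' <= j')%N ->
  (mkroot i j == mkroot i' j') = (i == i') && (j == j').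
Proof. by move=> ij ij'; rewrite (mkroot_eq _ ij') (mkrootE ij) xpair_eqE. Qed.

Definition incr be (a : proot) : isoclass := [fsfun be with a |-> (be a).+1].
Definition decr be (a : proot) : isoclass := [fsfun be with a |-> (be a).-1].

Lemma incrE be a b : incr be a b = (be b + (b == a))%N.
Proof. by rewrite fsfun_withE; case: eqP => [->|]; rewrite ?addn1 ?addn0. Qed.

Lemma decrE be a b : decr be a b = (be b - (b == a))%N.
Proof. by rewrite fsfun_withE; case: eqP => [->|]; rewrite ?subn1 ?subn0. Qed.

Lemma decrK be a : (0 < be a)%N -> incr (decr be a) a = be.
Proof.
by move=> be0; apply/fsfunP=> b; rewrite incrE decrE; case: eqP => [->|]; rewrite ?subnK ?subn0 ?addn0.
Qed.

Lemma rootsum_incr be a phi :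
  rootsum (incr be a) phi = (rootsum be phi + phi (val a).1 (val a).2)%N.
Proof.
pose D := (a |` (finsupp be `|` finsupp (incr be a)))%fset.
have aD : a \in D by rewrite !inE eqxx.
rewrite !(@rootsum_sub _ D); try by apply/fsubsetP=> b; rewrite !inE => ->; rewrite !orbT.
under eq_bigr => b _ do rewrite incrE mulnDl.
rewrite big_split /=; congr (_ + _)%N.
rewrite (big_fsetD1 a) //= eqxx mul1n big1_fset ?addn0 // => b.
by rewrite !inE => /andP[/negbTE->].
Qed.

Lemma rho_incr be i j a n : (i <= j)%N ->
  rho (incr be (mkroot i j)) a n = (rho be a n + (i <= a) && (a + n <= j))%N.
Proof. by move=> ij; rewrite /rho rootsum_incr mkrootE. Qed.

Lemma rho_decr be i j a n : (i <= j)%N -> (0 < be (mkroot i j))%N ->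
  (rho (decr be (mkroot i j)) a n + (i <= a) && (a + n <= j) = rho be a n)%N.
Proof. by move=> ij be0; rewrite -rho_incr // decrK. Qed.

Lemma tops_incr be i j a n : (i <= j)%N ->
  tops (incr be (mkroot i j)) a n = (tops be a n + (i == a) && (a + n <= j))%N.
Proof. by move=> ij; rewrite /tops rootsum_incr mkrootE. Qed.

(* Growing a root at its left end: (i + 1, j) becomes (i, j), and for j = i the
   root (i, i) is added. *)
Definition raise (i j : nat) be :=
  if i == j then incr be (mkroot i i) else incr (decr be (mkroot i.+1 j)) (mkroot i j).

Definition raisable (i j : nat) be := (i == j) || (0 < be (mkroot i.+1 j))%N.

Lemma rho_raise i j be a n : (i <= j)%N -> raisable i j be ->
  rho (raise i j be) a n = (rho be a n + (a == i) && (a + n <= j))%N.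
Proof.
rewrite /raise /raisable; case: eqVneq => [<- _ _|ij ij' be0].
  by rewrite rho_incr //; congr (_ + nat_of_bool _)%N; lia.
have := @rho_decr be i.+1 j a n; rewrite rho_incr // => <- //; last by lia.
lia.
Qed.

Lemma raiseE i j be b : (i <= j)%N -> b != mkroot i j ->
  ((i < j)%N -> b != mkroot i.+1 j) -> raise i j be b = be b.
Proof.
move=> ij /negbTE b1 b2; rewrite /raise; case: eqVneq => [e|ne].
  by move: b1; rewrite -e incrE => ->; rewrite addn0.
by rewrite incrE decrE b1 (negbTE (b2 _)) ?addn0 ?subn0 // ltn_neqAle ne.
Qed.

Lemma raise_next i j be : (i < j)%N ->
  raise i j be (mkroot i.+1 j) = (be (mkroot i.+1 j)).-1.
Proof.
move=> ij; rewrite /raise ltn_eqF // incrE decrE eqxx subn1 mkroot_eqE //; last exact: ltnW.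
by rewrite gtn_eqF // addn0.
Qed.

Definition ends_le (n : nat) be := forall b, (n < (val b).2)%N -> be b = 0%N.

Lemma ends_le_rho n be a m : ends_le n be -> (n < a + m)%N -> rho be a m = 0%N.
Proof.
move=> ben nam; apply: big1 => b _; case: leqP => //= _; last by rewrite muln0.
case: leqP; rewrite ?muln0 // => amb; rewrite ben //; apply: leq_trans amb; exact: nam.
Qed.

Lemma ends_le_tops n be a m : ends_le n be -> (n < a + m)%N -> tops be a m = 0%N.
Proof.
move=> ben nam; apply: big1 => b _; case: eqP => //= _; last by rewrite muln0.
case: leqP; rewrite ?muln0 // => amb; rewrite ben //; apply: leq_trans amb; exact: nam.
Qed.

Lemma ends_le_incr n be i j : (i <= j <= n)%N -> ends_le n be -> ends_le n (incr be (mkroot i j)).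
Proof.
move=> /andP[ij jn] ben b nb; rewrite incrE ben // mkroot_eq //.
by case: eqP nb => // ->; rewrite ltnNge jn.
Qed.

Lemma ends_le_raise n be i j : (i <= j <= n)%N -> ends_le n be -> ends_le n (raise i j be).
Proof.
move=> ijn ben; rewrite /raise; case: eqP => [e|_].
  by apply: ends_le_incr => //; move: ijn; rewrite -e; lia.
by apply: ends_le_incr => // b nb; rewrite decrE ben.
Qed.

Lemma supp_bound_ends_le be : ends_le (supp_bound be).-1 be.
Proof.
move=> b nb; apply/eqP; apply: contraTT nb => /supp_boundP; rewrite -leqNgt.
by case: (supp_bound be).
Qed.

(* The multiplicities of the roots (i', i + d) with i < i'. *)
Fixpoint colsum i d be : nat :=
  if d is d'.+1 then (be (mkroot i.+1 (i + d)) + colsum i.+1 d' be)%N else 0%N.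

Lemma eq_colsum i d be be' :
  (forall i', (i < i' <= i + d)%N -> be (mkroot i' (i + d)) = be' (mkroot i' (i + d))) ->
  colsum i d be = colsum i d be'.
Proof.
elim: d i => [//|d IH] i h /=; rewrite h; last by lia.
congr (_ + _)%N; apply: IH => i' hi'; rewrite addSnnS; apply: h.
by move: hi'; lia.
Qed.

(* The quantum root vector of the root (i, i + d). *)
Fixpoint rootv (R : comNzRingType) (A : algType R) (s : R) (e : nat -> A) i d : A :=
  if d is d'.+1 then e i * rootv s e i.+1 d' - s *: (rootv s e i.+1 d' * e i) else e i.

Section Fock.
Variables (R : comUnitRingType) (q s : R).

Definition qnum n : R := \sum_(j < n) q ^+ j.

Definition pairing (i : nat) be : int := (rho be i 0)%:Z - (rho be i.+1 0)%:Z.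

(* The middle terms of the extensions of S_i by M(be) are the classes [raise i j be],
   with j = i for the split one. *)
Definition lcoef (i j : nat) be : R :=
  s ^ (- pairing i be) * q ^+ tops be i (j - i).+1 * qnum (be (mkroot i j)).+1.

Definition lterm (i j : nat) be : {malg R[isoclass]} :=
  if (i <= j)%N && raisable i j be then lcoef i j be *: << raise i j be >> else 0.

(** The range covers i and all end points of roots of be; beyond it [lterm] vanishes, as [lop_basis]
    uses. *)
Definition lmul_simple (i : nat) be := \sum_(0 <= j < (maxn i (supp_bound be)).+1) lterm i j be.

Definition lop (i : nat) : {linear {malg R[isoclass]} -> {malg R[isoclass]}} :=
  GRing.Linear.clone _ _ _ _ _ (lext (lmul_simple i)).

(* The value [rcoef] of the recursion: on classes without roots ending beyond the
   last vertex of the root vector, the terms of the two products that do not involve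
   the last vertex cancel. *)
Definition rcoef (i d : nat) be : R :=
  s ^ (d%:Z - (rho be i 0)%:Z) * q ^+ colsum i d be * qnum (be (mkroot i (i + d))).+1.

Lemma lop_basis i n be : (i <= n)%N -> ends_le n be ->
  lop i << be >> = \sum_(0 <= j < n.+1) lterm i j be.
Proof.
move=> ik ben; rewrite /lop /= lextU /lmul_simple.
have tail m m' : (i < m)%N -> (m <= m')%N -> (forall j, (m <= j)%N -> be (mkroot i.+1 j) = 0%N) ->
    \sum_(0 <= j < m') lterm i j be = \sum_(0 <= j < m) lterm i j be.
  move=> im mm' h; rewrite (@big_cat_nat _ _ _ m) //= [X in _ + X]big1_seq ?addr0 //.
  move=> j /andP[_]; rewrite mem_index_iota => /andP[mj _].
  by rewrite /lterm /raisable h // ltn_eqF ?andbF ?(leq_trans im).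
have tailn j : (n.+1 <= j)%N -> be (mkroot i.+1 j) = 0%N.
  by move=> nj; apply: ben; rewrite mkrootE //; lia.
have tailb j : ((maxn i (supp_bound be)).+1 <= j)%N -> be (mkroot i.+1 j) = 0%N.
  rewrite gtn_max => /andP[ij /(leq_ltn_trans (leq_pred _)) bj].
  by apply: (@supp_bound_ends_le be); rewrite mkrootE.
have [h|h] := leqP n.+1 (maxn i (supp_bound be)).+1.
  by rewrite (tail n.+1).
by apply/esym/tail => //; lia.
Qed.

Lemma qnumS n : qnum n.+1 = qnum n + q ^+ n.
Proof. by rewrite /qnum big_ord_recr. Qed.

Lemma raise_incr i j n be : (i <= j < n)%N -> raisable i j be ->
  raise i j (incr be (mkroot i.+1 n)) = incr (raise i j be) (mkroot i.+1 n).
Proof.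
move=> /andP[ij jn] be_ij; have ni : (i.+1 <= n)%N by apply: leq_ltn_trans jn.
have r' : raisable i j (incr be (mkroot i.+1 n)).
  by move: be_ij; rewrite /raisable => /orP[->//|]; rewrite incrE => h; lia.
by apply: isoclass_inj => a m; rewrite rho_raise // !rho_incr // rho_raise // addnAC.
Qed.

Hypothesis s_unit : s \is a GRing.unit.

(** The cancellation of the terms j < n in [act_rootv]: adding (i + 1, n) lowers [pairing i] by 1,
    which brings out the factor s of the bracket, while raising a root that ends before n leaves
    [rcoef i.+1 d] unchanged. *)
Lemma lterm_incr i j n d be : (j < n)%N -> n = (i.+1 + d)%N ->
  let a := mkroot i.+1 n in
  rcoef i.+1 d be *: lterm i j (incr be a) =
  if (i <= j)%N && raisable i j be
  then (s * lcoef i j be * rcoef i.+1 d (raise i j be)) *: << incr (raise i j be) a >> else 0.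
Proof.
move=> jn nE a; rewrite /lterm; have [ij|] := leqP i j; last by rewrite scaler0.
have ni : (i.+1 <= n)%N by apply: leq_ltn_trans jn.
have aE i' j' : (i' <= j')%N -> (j' < n)%N -> (mkroot i' j' == a) = false.
  by move=> ij' jn'; rewrite mkroot_eqE // (ltn_eqF jn') andbF.
have -> : raisable i j (incr be a) = raisable i j be.
  rewrite /raisable; case: eqVneq => //= ne; rewrite incrE aE ?addn0 //.
  by rewrite ltn_neqAle ne.
case: ifP => be_ij; last by rewrite scaler0.
have ijn : (i <= j < n)%N by rewrite ij.
rewrite /a raise_incr // scalerA; congr (_ *: _).
have -> : lcoef i j (incr be a) = s * lcoef i j be.
  rewrite /lcoef incrE aE // addn0 tops_incr // gtn_eqF // addn0.
  have -> : pairing i (incr be a) = pairing i be - 1.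
    by rewrite /pairing !rho_incr // ltnn leqnn !addn0 ni /=; lia.
  rewrite opprB addrC exprzDr // expr1z.
  by move: (s ^ _) (q ^+ _) (qnum _) => x y z; ring.
suff -> : rcoef i.+1 d (raise i j be) = rcoef i.+1 d be.
  by move: (rcoef _ _ _) (lcoef _ _ _) => x y; ring.
rewrite /rcoef rho_raise // (gtn_eqF (ltnSn i)) /= addn0 -nE.
have rE i' : (i < i' <= n)%N -> raise i j be (mkroot i' n) = be (mkroot i' n).
  move=> /andP[ii' i'n]; apply: raiseE => // [|ltij].
    by rewrite mkroot_eqE // (gtn_eqF jn) andbF.
  by rewrite mkroot_eqE // (gtn_eqF jn) andbF.
rewrite rE; last by rewrite ltnSn.
rewrite (@eq_colsum i.+1 d (raise i j be) be) // => i' hi'.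
by rewrite -nE; apply: rE; move: hi'; rewrite -nE; lia.
Qed.

(* The terms with j < n cancel; those with j = n leave qnum x.+1 - qnum x = q ^ x. *)
Lemma act_rootv i d be : ends_le (i + d) be ->
  act lop (rootv s (@falg_gen R nat) i d) << be >> =
  rcoef i d be *: << incr be (mkroot i (i + d)) >>.
Proof.
elim: d i be => [|d IH] i be ben.
  rewrite addn0 in ben *; rewrite /= act_gen (lop_basis (leqnn i) ben).
  rewrite big_nat_recr //= big1_seq ?add0r; last first.
    by move=> j /andP[_]; rewrite mem_index_iota => /andP[_ ji]; rewrite /lterm leqNgt ji.
  rewrite /lterm leqnn /raisable eqxx /= /raise eqxx; congr (_ *: _).
  rewrite /lcoef /rcoef /pairing (ends_le_tops ben) ?(ends_le_rho ben (a := i.+1)); try lia.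
  by rewrite subr0 sub0r addn0.
have [n n_def] : exists n, n = (i + d.+1)%N by exists (i + d.+1)%N.
rewrite -n_def in ben *; have nE : n = (i.+1 + d)%N by rewrite n_def addSnnS.
have ni : (i < n)%N by rewrite nE leq_addr.
have ben' : ends_le (i.+1 + d) be by rewrite -nE.
set a := mkroot i.+1 n.
have bea : ends_le n (incr be a) by apply: ends_le_incr => //; rewrite ni leqnn.
have [t tdef] : exists t : falg R nat, t = rootv s (@falg_gen R nat) i.+1 d.
  by exists (rootv s (@falg_gen R nat) i.+1 d).
have IHt m : ends_le n m -> act lop t << m >> = rcoef i.+1 d m *: << incr m a >>.
  by rewrite tdef /a nE => mn; apply: IH.
rewrite /rootv -/(rootv _ _ _ _) -tdef [LHS]act_commutator IHt // linearZ /=.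
rewrite (lop_basis (ltnW ni) bea) (lop_basis (ltnW ni) ben).
have recr (F : nat -> {malg R[isoclass]}) : \sum_(0 <= j < n.+1) F j = \sum_(0 <= j < n) F j + F n.
  exact: big_nat_recr.
rewrite [in X in X - _]recr [in X in _ - X]recr.
rewrite [act lop t _]linearD /= [act lop t (\sum_(_ <= _ < _) _)]linear_sum /=.
rewrite [rcoef _ _ _ *: (_ + _)]scalerDr [s *: (_ + _)]scalerDr.
rewrite [rcoef _ _ _ *: \sum_(_ <= _ < _) _]scaler_sumr [s *: \sum_(_ <= _ < _) _]scaler_sumr.
set c := rcoef i.+1 d be.
rewrite (_ : \sum_(0 <= j < n) c *: lterm i j (incr be a) =
    \sum_(0 <= j < n) s *: act lop t (lterm i j be)); last first.
  rewrite big_nat [RHS]big_nat; apply: eq_bigr => j /andP[_ jn].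
  rewrite (lterm_incr be jn nE) /lterm; case: ifP => [/andP[ij be_ij]|_].
    have rj : ends_le n (raise i j be) by apply: ends_le_raise => //; rewrite ij ltnW.
    by rewrite linearZ /= IHt // !scalerA.
  by rewrite linear0 scaler0.
rewrite opprD addrACA subrr add0r.
have a_n : mkroot i n != a by rewrite mkroot_eqE ?(ltnW ni) // ltn_eqF.
have rbea : raisable i n (incr be a) by rewrite /raisable incrE eqxx addn1 orbT.
have raise_bea : raise i n (incr be a) = incr be (mkroot i n).
  apply: isoclass_inj => b m; rewrite rho_raise ?(ltnW ni) // !rho_incr ?(ltnW ni) //.
  by rewrite -addnA; congr (_ + _)%N; lia.
rewrite /lterm (ltnW ni) rbea raise_bea /=; set x := be a; set y := be (mkroot i n).
have cE : c = s ^ (d%:Z - (rho be i.+1 0)%:Z) * q ^+ colsum i.+1 d be * qnum x.+1.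
  by rewrite /c /rcoef -nE.
have tE m : ends_le n m -> tops m i (n - i).+1 = 0%N.
  by move=> mn; apply: (ends_le_tops mn); lia.
have l1 : lcoef i n (incr be a) = s * s ^ (- pairing i be) * qnum y.+1.
  rewrite /lcoef tE // mulr1 incrE (negbTE a_n) addn0.
  have -> : pairing i (incr be a) = pairing i be - 1.
    by rewrite /pairing !rho_incr // ltnn leqnn !addn0 ni /=; lia.
  by rewrite opprB addrC exprzDr // expr1z [s * _]mulrC.
have sE : s ^ (d.+1%:Z - (rho be i 0)%:Z) =
    s * s ^ (- pairing i be) * s ^ (d%:Z - (rho be i.+1 0)%:Z).
  by rewrite -{2}(expr1z s) -!exprzDr //; congr (s ^ _); rewrite /pairing; lia.
have rE : rcoef i d.+1 be = s * s ^ (- pairing i be) * s ^ (d%:Z - (rho be i.+1 0)%:Z) *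
    (q ^+ x * q ^+ colsum i.+1 d be) * qnum y.+1.
  by rewrite /rcoef sE /= -n_def -exprD.
rewrite scalerA cE l1 rE /raisable (ltn_eqF ni) /= -/x.
(* If be has no root (i + 1, n), the second product has no term with j = n; the formula still holds
   because qnum 1 = 1 = q ^ 0. *)
have [x0|x0] := posnP x.
  rewrite linear0 scaler0 subr0; congr (_ *: _); rewrite x0 /qnum big_ord1.
  by move: (s ^ _) (s ^ _) (q ^+ _) (\sum_(j < _) _) => u v w z; ring.
have rb : raisable i n be by rewrite /raisable -/a -/x x0 orbT.
have rn : ends_le n (raise i n be) by apply: ends_le_raise => //; rewrite leqnn ltnW.
rewrite [act lop t (_ *: _)]linearZ /= IHt // [s *: _]scalerA [_ *: (_ *: _)]scalerA.
have -> : incr (raise i n be) a = incr be (mkroot i n).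
  apply: isoclass_inj => b m; rewrite !rho_incr ?(ltnW ni) // rho_raise ?(ltnW ni) //.
  by rewrite -addnA; congr (_ + _)%N; lia.
rewrite -scalerBl; congr (_ *: _).
have -> : rcoef i.+1 d (raise i n be) =
    s ^ (d%:Z - (rho be i.+1 0)%:Z) * q ^+ colsum i.+1 d be * qnum x.
  rewrite /rcoef rho_raise ?(ltnW ni) // (gtn_eqF (ltnSn i)) /= addn0 -nE -/a.
  rewrite raise_next // -/a -/x prednK //; congr (_ * q ^+ _ * _).
  apply: eq_colsum => i' /andP[ii' i'n]; rewrite -nE in i'n *; apply: raiseE.
  - exact: ltnW.
  - by rewrite mkroot_eqE ?(ltnW ni) // gtn_eqF // ltnW.
  by move=> _; rewrite mkroot_eqE // gtn_eqF.
have -> : lcoef i n be = s ^ (- pairing i be) * qnum y.+1.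
  by rewrite /lcoef tE // mulr1.
rewrite qnumS.
by move: (s ^ _) (s ^ _) (q ^+ _) (q ^+ _) (qnum x) (qnum _) => u v w z X Y; ring.
Qed.

End Fock.

Import Order.TTheory Num.Theory.

Lemma rho_zero a n : rho zero_class a n = 0%N.
Proof. by rewrite /rho (@rootsum_sub _ fset0) ?big_seq_fset0 // finsupp0. Qed.

(** For m > 0, comparing [tops] at vertex i + 1 shows that be has one root (i + 1, i + m) more than
    lam, so there is one to grow. *)
Lemma raise_of_rho i m be lam :
  (forall a n, rho lam a n = (rho be a n + (a == i) && (n <= m))%N) ->
  raisable i (i + m) be /\ lam = raise i (i + m) be.
Proof.
move=> h; have be_im : raisable i (i + m) be.
  rewrite /raisable; case: m h => [|m] h; first by rewrite addn0 eqxx.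
  apply/orP; right; have tE n : (tops lam i.+1 n + (n < m.+1) = tops be i.+1 n)%N.
    have := h i.+1 n; rewrite !rhoS h eqxx (gtn_eqF (ltnSn i)) /= addn0; lia.
  have := tE m; have := tE m.+1; rewrite ltnn ltnSn addn0 (topsS lam i.+1 m) (topsS be i.+1 m).
  by rewrite addSnnS; lia.
split=> //; apply: isoclass_inj => a n; rewrite h rho_raise ?leq_addr //.
by case: eqP => //= ->; rewrite leq_add2l.
Qed.

Lemma raise_inj i j j' be : (i <= j)%N -> (i <= j')%N -> raisable i j be -> raisable i j' be ->
  raise i j be = raise i j' be -> j = j'.
Proof.
move=> ij ij' r r' e.
have h n : (i + n <= j)%N = (i + n <= j')%N.
  have := congr1 (fun x => rho x i n) e; rewrite !rho_raise // eqxx /= => /addnI.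
  by case: (_ <= _)%N; case: (_ <= _)%N.
have := h (j - i)%N; have := h (j' - i)%N; rewrite !subnKC // !leqnn => h1 h2.
by apply/eqP; rewrite eqn_leq -h2 h1.
Qed.

Section SimpleCoefficients.
Variables (R : comUnitRingType) (q s : R).
Notation lop := (lop q s).

Lemma lop_basis_raise i j be : (i <= j)%N -> raisable i j be ->
  (lop i << be >>)@_(raise i j be) = lcoef q s i j be.
Proof.
move=> ij be_ij; pose n := maxn j (supp_bound be).
have ben : ends_le n be.
  move=> b nb; apply: supp_bound_ends_le; apply: leq_ltn_trans nb.
  exact: leq_trans (leq_pred _) (leq_maxr _ _).
have jn : (j <= n)%N by apply: leq_maxl.
rewrite (lop_basis q s (leq_trans ij jn) ben) big_mkord raddf_sum /=.
rewrite (bigD1 (Ordinal (jn : (j < n.+1)%N))) //= /lterm ij be_ij /= mcoeffZ mcoeffUU mulr1.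
rewrite big1 ?addr0 // => j' ne; case: ifP => [/andP[ij' r']|_]; last by rewrite mcoeff0.
rewrite mcoeffZ mcoeffU; case: eqP => [e|_]; last by rewrite mulr0.
by case/eqP: ne; apply/val_inj/(raise_inj ij' ij r' be_ij).
Qed.

Lemma lop_basis_out i be lam :
  (forall j, (i <= j)%N -> raisable i j be -> lam <> raise i j be) -> (lop i << be >>)@_lam = 0.
Proof.
move=> h; pose n := maxn i (supp_bound be).
have ben : ends_le n be.
  move=> b nb; apply: supp_bound_ends_le; apply: leq_ltn_trans nb.
  exact: leq_trans (leq_pred _) (leq_maxr _ _).
rewrite (lop_basis q s (leq_maxl _ _ : (i <= n)%N) ben) raddf_sum /=; apply: big1 => j _.
rewrite /lterm; case: ifP => [/andP[ij r]|_]; last exact: mcoeff0.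
by rewrite mcoeffZ mcoeffU; case: eqP => [e|_]; [case: (h j ij r) | rewrite mulr0].
Qed.

End SimpleCoefficients.

(** This ties the formal operators to counting: at s = 1 and q the order of a field, [lop] is left
    multiplication by S_i in the untwisted Hall algebra. *)
Lemma lop_hallnum (k : finFieldType) i be lam :
  (lop (#|k|%:R : int) 1 i << be >>)@_lam = (hallnum k (simple_class i) be lam)%:R.
Proof.
have [[j [ij r ->]]|h] := pselect (exists j, [/\ (i <= j)%N, raisable i j be & lam = raise i j be]).
  rewrite lop_basis_raise // /lcoef exp1rz mul1r (@hallnum_simple _ _ _ _ (j - i)); last first.
    by move=> a n; rewrite rho_raise //; case: eqP => //= ->; rewrite leq_subRL.
  by rewrite subnKC // natrM natrX natr_sum; congr (_ * _); apply: eq_bigr => t _; rewrite natrX.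
rewrite lop_basis_out; last by move=> j ij r e; apply: h; exists j.
have [->//|] := eqVneq (hallnum k (simple_class i) be lam) 0%N.
move=> /hallnum_simple_neq0[m /raise_of_rho[r e]].
by case: h; exists (i + m)%N; rewrite leq_addr.
Qed.

Definition dsum al be := dim_classes (fun i => rho al i 0 + rho be i 0)%N.

Lemma mem_dsum al be mu :
  (mu \in dsum al be) = `[< forall i, rho mu i 0 = (rho al i 0 + rho be i 0)%N >].
Proof.
apply: (@mem_dim_classes _ (maxn (supp_bound al) (supp_bound be))) => i.
by rewrite geq_max => /andP[h h']; rewrite !rho_top ?addn0.
Qed.

Lemma hallnum_out k al be mu : mu \notin dsum al be -> hallnum k al be mu = 0%N.
Proof.
move=> h; apply/eqP; apply: contraNT h => /hallnum_dim h.
by rewrite mem_dsum; apply/asboolP.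
Qed.

Lemma hallnum_zero (k : finFieldType) ga lam : hallnum k zero_class ga lam = (lam == ga).
Proof.
rewrite /hallnum hall_setE; set T := famT (rep_of k lam).
have WT W : hallfam (@fam0 _ _) T zero_class ga W -> W = T.
  case=> _ _ _ _ r; apply: famP => i; apply/eqP; rewrite eqEdim subvf /=.
  by have := r i 0; rewrite rho_zero /rk /=; lia.
have [e|ne] := eqVneq lam ga; last first.
  apply: fcard_def; rewrite card_eq_sym II0.
  suff -> : hallfam (@fam0 _ _) T zero_class ga = set0 by [].
  apply/seteqP; split=> // W hW; case/eqP: ne; apply: isoclass_inj => i n.
  have := WT W hW; case: hW => _ _ _ r _ WE; rewrite -r WE.
  by rewrite -(rank_rep_of k).
rewrite (@fcard_sum _ [fset (T : {classic _})]%fset); last by move=> W /WT ->; rewrite inE.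
rewrite big_seq_fset1; case: asboolP => // -[]; split.
- exact: famT_subrep.
- exact: fam_le0.
- exact: fam_leT.
- by move=> i n; rewrite -e -(rank_rep_of k).
move=> i n; rewrite rho_zero /rk; apply/eqP; rewrite subn_eq0.
have := rker_mono (fam_leT T) (@famT_subrep _ _) i (leq0n n).
exact: dimvS.
Qed.

Section NumericalProduct.
Variable k : finFieldType.
Let q : int := #|k|%:R.

Definition hallprod al be : {malg int[isoclass]} :=
  \sum_(lam <- dsum al be) (hallnum k al be lam)%:R *: << lam >>.

Lemma hallprodE al be lam : (hallprod al be)@_lam = (hallnum k al be lam)%:R.
Proof.
by apply: mcoeff_fset_sum => mu muD; rewrite hallnum_out.
Qed.

Lemma lop_hallprod i be : lop q 1 i << be >> = hallprod (simple_class i) be.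
Proof. by apply/malgP=> lam; rewrite lop_hallnum hallprodE. Qed.

Lemma hallprod_assoc i be ga :
  lop q 1 i (hallprod be ga) = lext (hallprod^~ ga) (lop q 1 i << be >>).
Proof.
have lext_sum (f : isoclass -> {malg int[isoclass]}) al' be' : lext f (hallprod al' be') =
    \sum_(nu <- dsum al' be') (hallnum k al' be' nu)%:R *: f nu.
  by rewrite /hallprod linear_sum; apply: eq_bigr => nu _; rewrite linearZ /= lextU.
have lop_sum : lop q 1 i (hallprod be ga) =
    \sum_(nu <- dsum be ga) (hallnum k be ga nu)%:R *: lop q 1 i << nu >>.
  by rewrite /hallprod linear_sum; apply: eq_bigr => nu _; rewrite linearZ.
rewrite lop_hallprod lop_sum lext_sum; apply/malgP=> lam.
rewrite [LHS]mcoeff_sum [RHS]mcoeff_sum.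
under eq_bigr => nu _ do rewrite mcoeffZ lop_hallnum -natrM mulnC.
under [RHS]eq_bigr => mu _ do rewrite mcoeffZ hallprodE -natrM.
by rewrite -!natr_sum hallnum_assoc.
Qed.

Lemma act_hallprod (t : falg int nat) be ga :
  act (lop q 1) t (hallprod be ga) = lext (hallprod^~ ga) (act (lop q 1) t << be >>).
Proof.
elim/falg_ind: t => [|i t IH|a t IH|t u IHt IHu].
- by rewrite !act1 lextU.
- rewrite [LHS]act_genM IH act_genM.
  apply: (linear_malg_eq (f := lop q 1 i \o lext (hallprod^~ ga))
    (g := lext (hallprod^~ ga) \o lop q 1 i)) => mu /=.
  by rewrite lextU; exact: hallprod_assoc.
- by rewrite [LHS]actZ IH actZ linearZ.
by rewrite [LHS]actD IHt IHu actD linearD.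
Qed.

Lemma hallprod_zero ga : hallprod zero_class ga = << ga >>.
Proof.
by apply/malgP=> lam; rewrite hallprodE hallnum_zero mcoeffU eq_sym.
Qed.

(** Through this, any t that sends u_0 to a multiple of u_al computes the products of u_al with all
    u_ga. *)
Lemma act_basis (t : falg int nat) ga :
  act (lop q 1) t << ga >> = lext (hallprod^~ ga) (act (lop q 1) t << zero_class >>).
Proof. by rewrite -act_hallprod hallprod_zero. Qed.

End NumericalProduct.

(* The pair (i, d) stands for the root (i, i + d); lists of roots are sorted by
   decreasing end point, then by decreasing starting point. *)
Definition root_ge (p p' : nat * nat) : bool :=
  (p'.1 + p'.2 < p.1 + p.2)%N || ((p'.1 + p'.2 == p.1 + p.2)%N && (p'.1 <= p.1)%N).

Lemma root_ge_total : total root_ge.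
Proof. by move=> p p'; rewrite /root_ge; lia. Qed.

Lemma root_ge_trans : transitive root_ge.
Proof. by move=> p p' p''; rewrite /root_ge; lia. Qed.

Lemma root_ge_anti : antisymmetric root_ge.
Proof. by move=> [i d] [i' d']; rewrite /root_ge /= => h; congr pair; lia. Qed.

Definition list_class (L : seq (nat * nat)) : isoclass :=
  foldr (fun p be => incr be (mkroot p.1 (p.1 + p.2)%N)) zero_class L.

Lemma mkroot_pair_eq (p p' : nat * nat) :
  (mkroot p.1 (p.1 + p.2)%N == mkroot p'.1 (p'.1 + p'.2)%N) = (p == p').
Proof.
rewrite mkroot_eqE ?leq_addr // [p]surjective_pairing [p']surjective_pairing xpair_eqE /=.
by case: eqP => //= ->; rewrite eqn_add2l.
Qed.

Lemma list_class_count L p : list_class L (mkroot p.1 (p.1 + p.2)%N) = count_mem p L.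
Proof.
elim: L => [|p' L IH] /=; first by rewrite fsfunE.
by rewrite incrE IH mkroot_pair_eq addnC eq_sym.
Qed.

Lemma list_class_perm L L' : (list_class L = list_class L') <-> perm_eq L L'.
Proof.
split=> [e|/permP e]; first by apply/allP=> p _ /=; rewrite -!list_class_count e.
apply/fsfunP=> b; rewrite -(mkrootK b) -(subnKC (valP b)).
by rewrite (list_class_count L (_, _)) (list_class_count L' (_, _)) e.
Qed.

Lemma list_class_inj L L' : sorted root_ge L -> sorted root_ge L' ->
  list_class L = list_class L' -> L = L'.
Proof.
move=> Ls L's /list_class_perm e; apply: (sorted_eq root_ge_trans root_ge_anti Ls L's e).
Qed.

Lemma list_class_exists al : exists2 L, sorted root_ge L & list_class L = al.
Proof.
suff [L LE] : exists L, list_class L = al.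
  exists (sort root_ge L); first exact: sort_sorted root_ge_total _.
  rewrite -LE; apply/list_class_perm; rewrite perm_sort; exact: perm_refl.
have [n] : exists n, (rootsum al (fun _ _ => 1) <= n)%N by eexists; exact: leqnn.
elim: n al => [|n IH] al.
  have [[b b0]|h] := pselect (exists b, (0 < al b)%N).
    by rewrite -(decrK b0) rootsum_incr addn1.
  move=> _; exists [::]; apply/fsfunP=> b; rewrite fsfunE; apply/esym/eqP.
  by rewrite -leqn0 leqNgt; apply/negP => b0; apply: h; exists b.
have [[b b0]|h] := pselect (exists b, (0 < al b)%N).
  rewrite -(decrK b0) rootsum_incr addn1 ltnS => /IH[L LE].
  exists (((val b).1, (val b).2 - (val b).1)%N :: L).
  by rewrite /= LE subnKC ?(valP b) // mkrootK.
move=> _; exists [::]; apply/fsfunP=> b; rewrite fsfunE; apply/esym/eqP.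
by rewrite -leqn0 leqNgt; apply/negP => b0; apply: h; exists b.
Qed.

Lemma list_class_ends L n : all (fun p => p.1 + p.2 <= n)%N L -> ends_le n (list_class L).
Proof.
elim: L => [|p L IH] /=; first by move=> _ b _; rewrite fsfunE.
by move=> /andP[pn /IH h]; apply: ends_le_incr; rewrite ?leq_addr.
Qed.

Section Monomials.
Variables (R : comUnitRingType) (q s : R).
Hypothesis s_unit : s \is a GRing.unit.

Definition monomial (A : algType R) (e : nat -> A) L : A := \prod_(p <- L) rootv s e p.1 p.2.

Fixpoint mon_coef L : R :=
  if L is p :: L' then mon_coef L' * rcoef q s p.1 p.2 (list_class L') else 1.

(** The last factor acts first and end points decrease along the list, so each root vector meets a
    class without roots ending beyond its own end, as [act_rootv] requires. *)
Lemma act_monomial L : sorted root_ge L ->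
  act (lop q s) (monomial (@falg_gen R nat) L) << zero_class >> = mon_coef L *: << list_class L >>.
Proof.
elim: L => [|p L IH] Ls; first by rewrite /monomial big_nil act1 scale1r.
rewrite /monomial big_cons [LHS]actM -/(monomial _ _) IH ?(path_sorted Ls) //.
rewrite linearZ /= act_rootv ?scalerA //; apply: list_class_ends.
apply: sub_all (order_path_min root_ge_trans Ls) => p' /=.
by rewrite /root_ge; lia.
Qed.

End Monomials.

(** * Hall polynomials *)

Section BaseChange.
Variables (R R' : comUnitRingType) (phi : {rmorphism R -> R'}) (q s : R).
Hypothesis s_unit : s \is a GRing.unit.

(** Change of coefficients: computations over Z[x] are specialized at the order of each finite field
    and at r/s. *)
Definition mapm (x : {malg R[isoclass]}) : {malg R'[isoclass]} :=
  [malg k in msupp x => phi (x@_k)].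

Lemma mapmE x k : (mapm x)@_k = phi (x@_k).
Proof. by rewrite mcoeffE; case: msuppP => // _; rewrite rmorph0. Qed.

Lemma mapmB x y : mapm (x - y) = mapm x - mapm y.
Proof. by apply/malgP=> k; rewrite mcoeffB !mapmE mcoeffB rmorphB. Qed.

Lemma mapmZ a x : mapm (a *: x) = phi a *: mapm x.
Proof. by apply/malgP=> k; rewrite mcoeffZ !mapmE mcoeffZ rmorphM. Qed.

Lemma mapmU k : mapm << k >> = << k >>.
Proof. by apply/malgP=> l; rewrite mapmE !mcoeffU; case: eqP; rewrite ?rmorph1 ?rmorph0. Qed.

Lemma phi_qnum n : phi (qnum q n) = qnum (phi q) n.
Proof. by rewrite rmorph_sum; apply: eq_bigr => j _; rewrite rmorphXn. Qed.

Lemma phi_lcoef i j be : phi (lcoef q s i j be) = lcoef (phi q) (phi s) i j be.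
Proof. by rewrite /lcoef !rmorphM rmorphXn phi_qnum /= rmorphXz. Qed.

Lemma phi_rcoef i d be : phi (rcoef q s i d be) = rcoef (phi q) (phi s) i d be.
Proof. by rewrite /rcoef !rmorphM rmorphXn phi_qnum /= rmorphXz. Qed.

Lemma mapm_lop i x : mapm (lop q s i x) = lop (phi q) (phi s) i (mapm x).
Proof.
apply/malgP=> k; rewrite mapmE /lop /= [in RHS](@lext_sub _ _ _ _ _ (msupp x)); last first.
  apply/fsubsetP=> l; rewrite -!mcoeff_neq0 mapmE; apply: contra => /eqP->.
  by rewrite rmorph0.
rewrite lextE !mcoeff_sum rmorph_sum; apply: eq_bigr => b _.
rewrite !mcoeffZ rmorphM mapmE; congr (_ * _).
rewrite /lmul_simple !mcoeff_sum rmorph_sum; apply: eq_bigr => j _.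
rewrite /lterm; case: ifP => _; last by rewrite !mcoeff0 rmorph0.
rewrite !mcoeffZ rmorphM /= phi_lcoef !mcoeffU; case: eqP => _.
  by rewrite rmorph1.
by rewrite rmorph0.
Qed.

Lemma mapm_rootv i d x :
  mapm (act (lop q s) (rootv s (@falg_gen R nat) i d) x) =
  act (lop (phi q) (phi s)) (rootv (phi s) (@falg_gen R' nat) i d) (mapm x).
Proof.
elim: d i x => [|d IH] i x; first by rewrite !act_gen mapm_lop.
rewrite /rootv -!/(rootv _ _ _ _) [in LHS]act_commutator [RHS]act_commutator.
by rewrite mapmB mapmZ mapm_lop !IH mapm_lop.
Qed.

Lemma mapm_monomial L x :
  mapm (act (lop q s) (monomial s (@falg_gen R nat) L) x) =
  act (lop (phi q) (phi s)) (monomial (phi s) (@falg_gen R' nat) L) (mapm x).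
Proof.
elim: L x => [|p L IH] x; first by rewrite /monomial !big_nil !act1.
rewrite /monomial !big_cons -!/(monomial _ _ _) [in LHS]actM [RHS]actM.
by rewrite mapm_rootv IH.
Qed.

Lemma phi_mon_coef L : phi (mon_coef q s L) = mon_coef (phi q) (phi s) L.
Proof. by elim: L => [|p L IH] /=; rewrite ?rmorph1 // rmorphM /= IH phi_rcoef. Qed.

End BaseChange.

Lemma qnum_monic n : qnum ('X : {poly int}) n.+1 \is monic.
Proof.
have e : ('X - 1%:P) * qnum ('X : {poly int}) n.+1 = 'X ^+ n.+1 - 1%:P by rewrite -subrX1.
by rewrite -(monicMl _ (monicXsubC 1)) e monicXnsubC.
Qed.

Lemma mon_coef_monic L : mon_coef ('X : {poly int}) 1 L \is monic.
Proof.
elim: L => [|p L IH] /=; first exact: monic1.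
by rewrite monicMr // /rcoef exp1rz mul1r monicMr ?qnum_monic // monicXn.
Qed.

Lemma mon_coef_gt0 (q : int) L : 0 < q -> 0 < mon_coef q 1 L.
Proof.
move=> q0; elim: L => [|p L IH] //=; rewrite mulr_gt0 // /rcoef exp1rz mul1r.
rewrite mulr_gt0 ?exprn_gt0 // qnumS; apply: ltr_wpDl; last exact: exprn_gt0.
by apply: sumr_ge0 => j _; rewrite exprn_ge0 // ltW.
Qed.

Lemma horner_bound (p : {poly int}) m (x : int) : (size p <= m.+1)%N -> 1 <= x ->
  `|p.[x]| <= (\sum_(i < m.+1) `|p`_i|) * x ^+ m.
Proof.
move=> pm x1; rewrite (horner_coef_wide _ pm) mulr_suml.
apply: le_trans (ler_norm_sum _ _ _) _; apply: ler_sum => i _.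
rewrite normrM ler_wpM2l // normrX ger0_norm ?(le_trans ler01) //.
by rewrite ler_weXn2l // -ltnS.
Qed.

Definition prime_seq (B n : nat) : nat := iter n (fun m => s2val (prime_above m)) B.

(** Every prime is the order of a field. The bound B discards the small primes, at which the size
    estimate of [dvd_of_values] may fail. *)
Lemma poly_eq0_primes (p : {poly int}) B :
  (forall l : nat, prime l -> (B < l)%N -> p.[l%:R] = 0) -> p = 0.
Proof.
move=> p0; apply/eqP/negPn/negP => pn0.
pose f n := prime_seq B n.+1.
have fS n : (f n < f n.+1)%N by rewrite /f /prime_seq [X in (_ < X)%N]iterS; case: prime_above.
have fB n : (B < f n)%N.
  elim: n => [|n IH]; first by rewrite /f /prime_seq /=; case: prime_above.
  exact: ltn_trans IH (fS n).
have fp n : prime (f n) by rewrite /f /prime_seq iterS; case: prime_above.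
have f_mono : {homo f : m n / (m < n)%N} by apply: homo_ltn fS; apply: ltn_trans.
have := max_poly_roots pn0 (rs := [seq (f i)%:R | i <- iota 0 (size p)]).
rewrite size_map size_iota ltnn => H; suff : false by [].
apply: H; first by apply/allP=> _ /mapP[i _ ->]; rewrite /root p0.
rewrite map_inj_uniq ?iota_uniq // => m n /eqP; rewrite eqr_nat => /eqP fmn.
by case: (ltngtP m n) => // /f_mono; rewrite fmn ltnn.
Qed.

(* The remainder M of N by C is such that C(q) divides M(q) at all prime powers q, but
   |M(q)| < C(q) for large q. *)
Lemma dvd_of_values (N C : {poly int}) (h : finFieldType -> nat) : C \is monic ->
  (forall x : int, 0 < x -> 0 < C.[x]) ->
  (forall k : finFieldType, N.[#|k|%:R] = C.[#|k|%:R] * (h k)%:R) ->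
  exists P : {poly int}, forall k : finFieldType, P.[#|k|%:R] = (h k)%:R.
Proof.
move=> Cm C0 NE; pose P : {poly int} := Pdiv.Ring.rdivp N C.
pose M : {poly int} := Pdiv.Ring.rmodp N C.
have NPM : N = P * C + M by apply: Pdiv.RingMonic.rdivp_eq.
have sM : (size M < size C)%N by rewrite Pdiv.Ring.ltn_rmodp monic_neq0.
have ME (k : finFieldType) : M.[#|k|%:R] = C.[#|k|%:R] * ((h k)%:R - P.[#|k|%:R]).
  by rewrite mulrBr -NE NPM hornerD hornerM [P.[_] * _]mulrC addrAC subrr add0r.
have M0 : M = 0.
  case sC : (size C) sM => [//|[|n]]; first by rewrite ltnS leqn0 size_poly_eq0 => /eqP.
  rewrite ltnS => sM; pose C' := C - 'X^(n.+1).
  have sC' : (size C' <= n.+1)%N.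
    apply/leq_sizeP => j nj; rewrite coefB coefXn; have [->|ne] := eqVneq j n.+1.
      by have := monicP Cm; rewrite lead_coefE sC /= => ->; rewrite subrr.
    by rewrite nth_default ?subr0 // sC ltn_neqAle eq_sym ne.
  pose cM := \sum_(i < n.+1) `|M`_i|; pose cC := \sum_(i < n.+1) `|C'`_i|.
  (* For such x the leading term x ^ (n + 1) exceeds the bounds cM * x ^ n of M and cC * x ^ n of C'
     together by at least x ^ n. *)
  have big (x : int) : 1 + cM + cC <= x -> `|M.[x]| < C.[x].
    have cM0 : 0 <= cM by apply: sumr_ge0 => i _; apply: normr_ge0.
    have cC0 : 0 <= cC by apply: sumr_ge0 => i _; apply: normr_ge0.
    move=> Bx; have x1 : 1 <= x by lia.
    have xn : 0 < x ^+ n by rewrite exprn_gt0 //; lia.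
    apply: le_lt_trans (horner_bound sM x1) _; rewrite -/cM.
    have -> : C.[x] = C'.[x] + x * x ^+ n.
      by rewrite /C' hornerD hornerN hornerXn exprS subrK.
    have := horner_bound sC' x1; rewrite -/cC ler_norml => /andP[+ _].
    move: (C'.[x]) (x ^+ n) xn => u v v0 hu.
    have : (1 + cM + cC) * v <= x * v by rewrite ler_wpM2r // ltW.
    by rewrite !mulrDl mul1r; lia.
  pose B : int := 1 + cM + cC.
  apply: (@poly_eq0_primes M `|B|%N) => l lp Bl.
  have Ml : `|M.[l%:R]| < C.[l%:R] by apply: big; rewrite -/B natz; lia.
  have := ME 'F_l; rewrite card_Fp // => e.
  move: Ml; rewrite e normrM gtr0_norm ?C0 ?ltr0n ?prime_gt0 //; last first.
  rewrite -[X in _ < X]mulr1 ltr_pM2l ?C0 ?ltr0n ?prime_gt0 //.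
  by move=> small; have -> : (h 'F_l)%:R - P.[l%:R] = 0; [lia | rewrite mulr0].
exists P => k; apply/eqP; rewrite eq_sym -subr_eq0.
have := ME k; rewrite M0 horner0 => /esym/eqP; rewrite mulf_eq0 gt_eqF ?C0 //.
by rewrite ltr0n; apply/card_gt0P; exists 0.
Qed.

#[global] Opaque lop.

(* The ordered product of root vectors attached to al is a multiple of u_al by a monic
   polynomial in q, so the Hall number is a quotient of two polynomials in q. *)
Lemma hall_poly_exists al be lam : exists p : {poly int}, forall k : finFieldType,
  p.[#|k|%:R] = (hallnum k al be lam)%:R.
Proof.
have [L Ls LE] := list_class_exists al.
pose X : {poly int} := 'X.
pose N := (act (lop X 1) (monomial 1 (@falg_gen {poly int} nat) L) << be >>)@_lam.
have u1 : (1 : {poly int}) \is a GRing.unit by apply: unitr1.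
have evalX (x : int) : horner_eval x X = x by rewrite /horner_eval hornerX.
have eval1 (x : int) : horner_eval x (1 : {poly int}) = 1 by rewrite /horner_eval hornerC.
have coefE (x : int) : (mon_coef X 1 L).[x] = mon_coef x 1 L.
  have h : horner_eval x (mon_coef X 1 L) = mon_coef (horner_eval x X) (horner_eval x 1) L.
    exact: (phi_mon_coef (horner_eval x) X u1).
  by rewrite evalX eval1 in h.
apply: (@dvd_of_values N (mon_coef X 1 L)) => [|x x0|k].
- exact: mon_coef_monic.
- by rewrite coefE mon_coef_gt0.
set q : int := #|k|%:R; rewrite coefE.
have -> : N.[q] = (act (lop q 1) (monomial 1 (@falg_gen int nat) L) << be >>)@_lam.
  have h : mapm (horner_eval q) (act (lop X 1) (monomial 1 (@falg_gen {poly int} nat) L) << be >>) =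
      act (lop (horner_eval q X) (horner_eval q 1))
        (monomial (horner_eval q 1) (@falg_gen int nat) L) (mapm (horner_eval q) << be >>).
    exact: (mapm_monomial (horner_eval q) X u1).
  by rewrite evalX eval1 mapmU in h; rewrite -h mapmE.
rewrite act_basis act_monomial ?unitr1 // LE linearZ /= lextU mcoeffZ hallprodE.
by [].
Qed.

Lemma hall_polyP (k : finFieldType) al be lam :
  (hall_poly al be lam).[#|k|%:R] = (hallnum k al be lam)%:R.
Proof.
have [p pE] := hall_poly_exists al be lam.
have /(_ k)[n hn ->] : forall k : finFieldType, exists2 n : nat,
    (hall_set k al be lam #= `I_n)%card & (hall_poly al be lam).[#|k|%:R] = n%:R.
  apply: (xgetPex (0 : {poly int}) (P := [set p : {poly int} | forall k : finFieldType, exists2 n : nat,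
    (hall_set k al be lam #= `I_n)%card & p.[#|k|%:R] = n%:R]%classic)).
  exists p => k'; exists (hallnum k' al be lam) => //.
  exact: fcardP (hall_set_finite _ _ _ _).
by rewrite /hallnum (fcard_def hn).
Qed.

Lemma hall_poly_unique (p p' : {poly int}) :
  (forall k : finFieldType, p.[#|k|%:R] = p'.[#|k|%:R]) -> p = p'.
Proof.
move=> pE; apply/eqP; rewrite -subr_eq0; apply/eqP/(@poly_eq0_primes _ 0) => l lp _.
by have := pE 'F_l; rewrite card_Fp // hornerD hornerN => ->; rewrite subrr.
Qed.

Lemma hall_poly_out al be lam : lam \notin dsum al be -> hall_poly al be lam = 0.
Proof.
by move=> lD; apply: hall_poly_unique => k; rewrite hall_polyP hallnum_out // horner0.
Qed.

Lemma hall_poly_simple i be lam :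
  hall_poly (simple_class i) be lam = (lop ('X : {poly int}) 1 i << be >>)@_lam.
Proof.
apply: hall_poly_unique => k; rewrite hall_polyP -lop_hallnum.
set q : int := #|k|%:R.
have h : mapm (horner_eval q) (lop ('X : {poly int}) 1 i << be >>) =
    lop (horner_eval q 'X) (horner_eval q 1) i (mapm (horner_eval q) << be >>).
  exact: (mapm_lop (horner_eval q) ('X : {poly int}) (unitr1 _)).
have eX : horner_eval q ('X : {poly int}) = q by rewrite /horner_eval hornerX.
have e1 : horner_eval q (1 : {poly int}) = 1 by rewrite /horner_eval hornerC.
by rewrite eX e1 mapmU in h; rewrite -h mapmE.
Qed.

Lemma hall_poly_assoc al be ga lam :
  \sum_(mu <- dsum al be) hall_poly al be mu * hall_poly mu ga lam =
  \sum_(nu <- dsum be ga) hall_poly al nu lam * hall_poly be ga nu.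
Proof.
apply: hall_poly_unique => k; rewrite !horner_sum.
under eq_bigr => mu _ do rewrite hornerM !hall_polyP -natrM.
under [RHS]eq_bigr => nu _ do rewrite hornerM !hall_polyP -natrM.
by rewrite -!natr_sum hallnum_assoc.
Qed.

(** * The twisted Hall product *)

Definition euler al be : int := euler_form al be.

Lemma euler_simple i be : euler (simple_class i) be = pairing i be.
Proof.
pose b := maxn i.+1 (supp_bound (simple_class i)).
have ib : (i < b)%N by apply: leq_maxl.
rewrite /euler (euler_formE _ (leq_maxr _ _ : (_ <= b)%N)) /pairing.
have E (f : nat -> nat) : (\sum_(j < b) rho (simple_class i) j 0 * f j)%N = f i.
  rewrite (bigD1 (Ordinal ib)) //= rho_simple !eqxx mul1n big1 ?addn0 // => j ne.
  by rewrite rho_simple -val_eqE /= in ne *; rewrite (negbTE ne).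
by rewrite (E (fun j => rho be j 0)) (E (fun j => rho be j.+1 0)).
Qed.

Lemma euler_dsuml al be mu ga : mu \in dsum al be -> euler mu ga = euler al ga + euler be ga.
Proof.
rewrite mem_dsum => /asboolP muE.
pose b := maxn (supp_bound mu) (maxn (supp_bound al) (supp_bound be)).
have h1 : (supp_bound mu <= b)%N by apply: leq_maxl.
have h2 : (supp_bound al <= b)%N by rewrite leq_max leq_max leqnn orbT.
have h3 : (supp_bound be <= b)%N by rewrite leq_max leq_max leqnn !orbT.
rewrite /euler (euler_formE _ h1) (euler_formE _ h2) (euler_formE _ h3).
have E (f : nat -> nat) : (\sum_(i < b) rho mu i 0 * f i =
    \sum_(i < b) rho al i 0 * f i + \sum_(i < b) rho be i 0 * f i)%N.
  by rewrite -big_split; apply: eq_bigr => i _ /=; rewrite muE mulnDl.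
by rewrite (E (fun i => rho ga i 0)) (E (fun i => rho ga i.+1 0)); lia.
Qed.

Lemma euler_dsumr al be ga nu : nu \in dsum be ga -> euler al nu = euler al be + euler al ga.
Proof.
rewrite mem_dsum => /asboolP nuE; rewrite /euler !(euler_formE _ (leqnn (supp_bound al))).
have E (sh : nat -> nat) : (\sum_(i < supp_bound al) rho al i 0 * rho nu (sh i) 0 =
    \sum_(i < supp_bound al) rho al i 0 * rho be (sh i) 0 +
    \sum_(i < supp_bound al) rho al i 0 * rho ga (sh i) 0)%N.
  by rewrite -big_split; apply: eq_bigr => i _ /=; rewrite nuE mulnDr.
by have := E S; have := E id; rewrite /=; lia.
Qed.

(** The power of s in [lcoef] is the same for all terms, and by [euler_simple] it is the twist of
    the Hall product. *)
Lemma lop_twist (R : comUnitRingType) (q s : R) i be lam :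
  (lop q s i << be >>)@_lam = s ^ (- pairing i be) * (lop q 1 i << be >>)@_lam.
Proof.
have [[j [ij rj ->]]|h] := pselect (exists j, [/\ (i <= j)%N, raisable i j be & lam = raise i j be]).
  have e := lop_basis_raise q s ij rj; have e1 := lop_basis_raise q 1 ij rj.
  apply: (etrans e); apply: (etrans _ (esym (congr1 _ e1))).
  by rewrite /lcoef exp1rz mul1r mulrA.
have h' j : (i <= j)%N -> raisable i j be -> lam <> raise i j be.
  by move=> ij rj e; apply: h; exists j.
have e := lop_basis_out q s h'; have e1 := lop_basis_out q 1 h'.
by apply: (etrans e); apply: (etrans _ (esym (congr1 _ e1))); rewrite mulr0.
Qed.

Section TwistedProduct.
Variables (K : fieldType) (r s : K).
Hypothesis s0 : s != 0.
Let q : K := r / s.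

Definition ev (p : {poly int}) : K := (map_poly intr p).[q].

Lemma ev_is_zmod_morphism : zmod_morphism ev.
Proof. by move=> x y; rewrite /ev rmorphB hornerD hornerN. Qed.

Lemma ev_is_monoid_morphism : monoid_morphism ev.
Proof. by split=> [|x y]; rewrite /ev ?rmorph1 ?hornerC // rmorphM hornerM. Qed.

HB.instance Definition _ := GRing.isZmodMorphism.Build _ _ ev ev_is_zmod_morphism.
HB.instance Definition _ := GRing.isMonoidMorphism.Build _ _ ev ev_is_monoid_morphism.

Lemma hall_mul_basis_sum al be : hall_mul_basis r s al be =
  \sum_(lam <- dsum al be) (s ^ (- euler al be) * ev (hall_poly al be lam)) *: << lam >>.
Proof.
rewrite /hall_mul_basis (@fsbigE _ _ _ _ _ (dsum al be : seq _)) //; last first.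
  by move=> mu _ muD; rewrite hall_poly_out // rmorph0 horner0 mulr0 scale0r.
by apply: eq_bigl => mu; rewrite in_setT.
Qed.

Lemma hall_mul_basis_coef al be lam :
  (hall_mul_basis r s al be)@_lam = s ^ (- euler al be) * ev (hall_poly al be lam).
Proof.
rewrite hall_mul_basis_sum.
rewrite (mcoeff_fset_sum (c := fun mu => s ^ (- euler al be) * ev (hall_poly al be mu))) //.
by move=> mu muD; rewrite hall_poly_out // rmorph0 mulr0.
Qed.

Lemma hall_mul_simple i be : hall_mul_basis r s (simple_class i) be = lop q s i << be >>.
Proof.
apply/malgP=> lam; rewrite hall_mul_basis_coef euler_simple lop_twist; congr (_ * _).
rewrite hall_poly_simple.
have h : mapm ev (lop ('X : {poly int}) 1 i << be >>) = lop (ev 'X) (ev 1) i (mapm ev << be >>).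
  exact: (mapm_lop ev ('X : {poly int}) (unitr1 _)).
have eX : ev 'X = q by rewrite /ev map_polyX hornerX.
by rewrite eX rmorph1 mapmU in h; rewrite -h mapmE.
Qed.

(** The Euler form is additive in dimension vectors, so both sides carry the same power s ^ (- e),
    and [hall_poly_assoc] remains. *)
Lemma hall_mul_basis_assoc i be ga :
  lop q s i (hall_mul_basis r s be ga) = lext (hall_mul_basis r s ^~ ga) (lop q s i << be >>).
Proof.
have lop_sum : lop q s i (hall_mul_basis r s be ga) = \sum_(nu <- dsum be ga)
    (s ^ (- euler be ga) * ev (hall_poly be ga nu)) *: lop q s i << nu >>.
  by rewrite hall_mul_basis_sum linear_sum; apply: eq_bigr => nu _; rewrite linearZ.
have lext_sum : lext (hall_mul_basis r s ^~ ga) (lop q s i << be >>) =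
    \sum_(mu <- dsum (simple_class i) be)
      (s ^ (- euler (simple_class i) be) * ev (hall_poly (simple_class i) be mu)) *:
        hall_mul_basis r s mu ga.
  rewrite -hall_mul_simple hall_mul_basis_sum linear_sum; apply: eq_bigr => nu _.
  by rewrite linearZ /= lextU.
rewrite lop_sum lext_sum; apply/malgP=> lam; rewrite [LHS]mcoeff_sum [RHS]mcoeff_sum.
pose e := euler (simple_class i) be + euler (simple_class i) ga + euler be ga.
transitivity (\sum_(nu <- dsum be ga)
    s ^ (- e) * ev (hall_poly (simple_class i) nu lam * hall_poly be ga nu)).
  rewrite big_seq [RHS]big_seq; apply: eq_bigr => nu nuD.
  rewrite mcoeffZ -hall_mul_simple hall_mul_basis_coef (euler_dsumr _ nuD) rmorphM /=.
  have -> : - e = - euler be ga - (euler (simple_class i) be + euler (simple_class i) ga).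
    by rewrite /e addrC opprD.
  rewrite expfzDr //; move: (s ^ _) (s ^ _) (ev _) (ev _) => u v w z; ring.
transitivity (\sum_(mu <- dsum (simple_class i) be)
    s ^ (- e) * ev (hall_poly (simple_class i) be mu * hall_poly mu ga lam)).
  by rewrite -!mulr_sumr -!rmorph_sum hall_poly_assoc.
rewrite big_seq [RHS]big_seq; apply: eq_bigr => mu muD.
rewrite mcoeffZ hall_mul_basis_coef (euler_dsuml _ muD) rmorphM /=.
have -> : - e = - euler (simple_class i) be - (euler (simple_class i) ga + euler be ga).
  by rewrite /e -opprD addrA.
rewrite expfzDr //; move: (s ^ _) (s ^ _) (ev _) (ev _) => u v w z; ring.
Qed.

Lemma hall_mulE x y : hall_mul r s x y = lext (fun al => lext (hall_mul_basis r s al) y) x.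
Proof.
rewrite /hall_mul lextE; apply: eq_bigr => al _; rewrite lextE scaler_sumr.
by apply: eq_bigr => be _; rewrite scalerA.
Qed.

Lemma hall_mul_linearr x : linear (hall_mul r s x).
Proof.
move=> a y z; rewrite !hall_mulE !(lextE _ x) scaler_sumr -big_split; apply: eq_bigr => al _.
by rewrite linearP /= scalerDr !scalerA [a * _]mulrC.
Qed.

HB.instance Definition _ x := GRing.isLinear.Build K (Hall K) (Hall K) _ (hall_mul r s x)
  (hall_mul_linearr x).

Lemma hall_mulZl a x y : hall_mul r s (a *: x) y = a *: hall_mul r s x y.
Proof. by rewrite !hall_mulE linearZ. Qed.

Lemma hall_mulDl x z y : hall_mul r s (x + z) y = hall_mul r s x y + hall_mul r s z y.
Proof. by rewrite !hall_mulE linearD. Qed.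

Lemma hall_mulU al y : hall_mul r s << al >> y = lext (hall_mul_basis r s al) y.
Proof. by rewrite hall_mulE lextU. Qed.

Lemma lop_hall_mul i x y : lop q s i (hall_mul r s x y) = hall_mul r s (lop q s i x) y.
Proof.
elim/malg_ind: x => [|be|a x IH|x z IHx IHz].
- by rewrite linear0 !hall_mulE !linear0.
- rewrite hall_mulU.
  apply: (linear_malg_eq (f := lop q s i \o lext (hall_mul_basis r s be))
    (g := hall_mul r s (lop q s i << be >>))) => ga /=.
  rewrite lextU; apply: (etrans (hall_mul_basis_assoc i be ga)).
  by rewrite hall_mulE; congr lext; apply: funext => al; rewrite lextU.
- rewrite (hall_mulZl a x) [LHS]linearZ /= IH.
  by rewrite -hall_mulZl; congr (hall_mul r s _ y); exact/esym/linearZ.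
rewrite (hall_mulDl x z) [LHS]linearD /= IHx IHz.
by rewrite -hall_mulDl; congr (hall_mul r s _ y); exact/esym/linearD.
Qed.

Lemma euler_zero al : euler zero_class al = 0.
Proof.
rewrite /euler (euler_formE _ (leqnn _)) !big1 ?subrr // => i _; rewrite rho_zero mul0n //.
Qed.

Lemma hall_mul_zerol y : hall_mul r s << zero_class >> y = y.
Proof.
apply: (linear_malg_eq (f := hall_mul r s << zero_class >>) (g := idfun)) => ga /=.
rewrite hall_mulU lextU; apply/malgP=> lam.
rewrite hall_mul_basis_coef euler_zero oppr0 expr0z mul1r mcoeffU.
have -> : hall_poly zero_class ga lam = (lam == ga)%:R.
  apply: hall_poly_unique => k; rewrite hall_polyP hallnum_zero.
  by case: (lam == ga); rewrite ?hornerC ?horner0.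
by rewrite rmorph_nat eq_sym.
Qed.

Lemma act_hall_mul (t : falg K nat) x y :
  act (lop q s) t (hall_mul r s x y) = hall_mul r s (act (lop q s) t x) y.
Proof.
elim/falg_ind: t => [|i t IH|a t IH|t u IHt IHu].
- by rewrite !act1.
- by rewrite [LHS]act_genM IH act_genM; exact: lop_hall_mul.
- by rewrite [LHS]actZ IH actZ hall_mulZl.
by rewrite [LHS]actD IHt IHu actD hall_mulDl.
Qed.

End TwistedProduct.

(** * Serre elements on the Hall algebra *)

Section SerreRelations.
Variables (K : fieldType) (r s : K) (A : algType K) (e : nat -> A).

Inductive serre : A -> A -> Prop :=
| Serre_ee i j : (i.+1 < j)%N || (j.+1 < i)%N -> serre (e i * e j - e j * e i) 0
| Serre_eeS i :
    serre (e i ^+ 2 * e i.+1 - (r + s) *: (e i * e i.+1 * e i)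
          + (r * s) *: (e i.+1 * e i ^+ 2)) 0
| Serre_eSS i :
    serre (e i * e i.+1 ^+ 2 - (r + s) *: (e i.+1 * e i * e i.+1)
          + (r * s) *: (e i.+1 ^+ 2 * e i)) 0.

(** r and s are the roots of x ^ 2 - (r + s) x + r s, so a cubic Serre element is an r-bracket of an
    s-bracket, the latter being a root vector. *)
Let serre_split (a b c : A) :
  a - (r + s) *: b + (r * s) *: c = a - s *: b - r *: (b - s *: c).
Proof.
by rewrite scalerDl scalerBr scalerA opprB opprD [- (r *: b) - _]addrC !addrA [RHS]addrAC.
Qed.

Lemma serre_eeS_rootv i :
  e i ^+ 2 * e i.+1 - (r + s) *: (e i * e i.+1 * e i) + (r * s) *: (e i.+1 * e i ^+ 2) =
  e i * rootv s e i 1 - r *: (rootv s e i 1 * e i).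
Proof. by rewrite serre_split /= mulrBr mulrBl !expr2 -scalerAr -scalerAl !mulrA. Qed.

Lemma serre_eSS_rootv i :
  e i * e i.+1 ^+ 2 - (r + s) *: (e i.+1 * e i * e i.+1) + (r * s) *: (e i.+1 ^+ 2 * e i) =
  rootv s e i 1 * e i.+1 - r *: (e i.+1 * rootv s e i 1).
Proof. by rewrite serre_split /= mulrBr mulrBl !expr2 -scalerAr -scalerAl !mulrA. Qed.

End SerreRelations.

Section ActCommutatorZero.
Variables (R : comNzRingType) (I : choiceType) (V : lmodType R) (op : I -> {linear V -> V}).
Variables (i : I) (d : falg R I) (a c1 c2 c3 : R) (u0 u1 u2 u3 : V).
Hypotheses (iu0 : op i u0 = u1) (du1 : act op d u1 = c1 *: u3).
Hypotheses (du0 : act op d u0 = c2 *: u2) (iu2 : op i u2 = c3 *: u3).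

(** The two orders lead from u0 to multiples of the same u3, one through u1 and the other through
    u2; only the coefficients have to be compared. *)
Lemma act_commutator_eq0 : c2 * c3 = a * c1 ->
  act op (falg_gen R i * d - a *: (d * falg_gen R i)) u0 = 0.
Proof.
move=> cE; apply: (etrans (act_commutator _ _ _ _ _)).
by rewrite iu0 du1 du0 linearZ /= iu2 !scalerA cE subrr.
Qed.

Lemma act_commutator_eq0r : c1 = a * (c2 * c3) ->
  act op (d * falg_gen R i - a *: (falg_gen R i * d)) u0 = 0.
Proof.
move=> cE; apply: (etrans (actB _ _ _ _)).
have h1 : act op (d * falg_gen R i) u0 = act op d (act op (falg_gen R i) u0) by exact: actM.
have h2 : act op (falg_gen R i * d) u0 = op i (act op d u0) by exact: act_genM.
by rewrite h1 act_gen actZ h2 iu0 du1 du0 [op i _]linearZ /= iu2 !scalerA -mulrA -cE subrr.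
Qed.

End ActCommutatorZero.

Section SerreHall.
Variables (K : fieldType) (q s : K).
Hypothesis s0 : s != 0.

Lemma zero_classE a : zero_class a = 0%N.
Proof. by rewrite fsfun0E. Qed.

Lemma tops_zero i n : tops zero_class i n = 0%N.
Proof. by apply: big1 => b _; rewrite zero_classE. Qed.

Lemma ends_le_zero n : ends_le n zero_class.
Proof. by move=> b _; rewrite zero_classE. Qed.

(** Without roots starting at i + 1 nothing can be grown to the left, and only the split extension
    by S_i remains. *)
Lemma lop_isolated i be : (forall j, (i < j)%N -> be (mkroot i.+1 j) = 0%N) ->
  lop q s i << be >> =
  (s ^ (- pairing i be) * q ^+ tops be i 1 * qnum q (be (mkroot i i)).+1) *:
    << incr be (mkroot i i) >>.
Proof.
move=> h; apply/malgP=> lam; rewrite mcoeffZ mcoeffU.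
have rij j : (i <= j)%N -> raisable i j be -> j = i.
  rewrite leq_eqVlt /raisable => /orP[/eqP->//|ij]; by rewrite h // orbF => /eqP.
have [e|ne] := eqVneq (incr be (mkroot i i)) lam.
  have ri : raisable i i be by rewrite /raisable eqxx.
  have := lop_basis_raise q s (leqnn i) ri.
  by rewrite {1}/raise eqxx e mulr1 /lcoef subnn.
rewrite mulr0; apply: lop_basis_out => j ij /(rij _ ij) ->.
by rewrite /raise eqxx => e; case/eqP: ne.
Qed.

Notation act := (act (lop q s)).
Notation e := (@falg_gen K nat).
Let u0 : {malg K[isoclass]} := << zero_class >>.

Lemma lop_zero i : lop q s i u0 = << incr zero_class (mkroot i i) >>.
Proof.
apply: (etrans (lop_isolated _)) => [j _|]; first exact: zero_classE.
rewrite /pairing !rho_zero subrr oppr0 expr0z tops_zero expr0 zero_classE /qnum big_ord1.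
by rewrite !mul1r expr0 scale1r.
Qed.

Lemma act_simple_zero i : act (e i) u0 = << incr zero_class (mkroot i i) >>.
Proof. exact: (etrans (act_gen _ _ _) (lop_zero i)). Qed.

(** Here r is q * s. The cubic elements are r-brackets with the root vector of (i, i + 1), whose
    action [act_rootv] gives, and all classes involved are isolated in the sense of
    [lop_isolated]. *)
Lemma serre_act_zero t t' : serre (q * s) s e t t' -> act (t - t') u0 = 0.
Proof.
have su : s \is a GRing.unit by rewrite unitfE.
have D be i : ends_le i.+1 be -> act (rootv s e i 1) << be >> =
    rcoef q s i 1 be *: << incr be (mkroot i i.+1) >>.
  have := @act_rootv K q s su i 1 be; rewrite addn1; exact.
have incrC be a b : incr (incr be a) b = incr (incr be b) a.
  by apply/fsfunP=> c; rewrite !incrE addnAC.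
have pairing0 i j l : (i <= j)%N -> pairing l (incr zero_class (mkroot i j)) =
    ((i <= l <= j)%N : int) - ((i <= l.+1 <= j)%N : int).
  by move=> ij; rewrite /pairing !rho_incr // !rho_zero !addn0.
case=> {t t'} [i j ij|i|i].
- have E l m : (l.+1 < m)%N -> act (e l * e m) u0 = act (e m * e l) u0.
    move=> lm; have lm' : (l < m)%N by apply: ltnW.
    apply: (etrans (act_genM _ _ _ _)); apply: (etrans _ (esym (act_genM _ _ _ _))).
    rewrite (act_simple_zero l) (act_simple_zero m).
    rewrite (lop_isolated (i := l)) => [|j' lj']; last first.
      by rewrite incrE zero_classE mkroot_eqE // (ltn_eqF lm).
    rewrite (lop_isolated (i := m)) => [|j' lj']; last first.
      by rewrite incrE zero_classE mkroot_eqE // gtn_eqF // ltnW // ltnW.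
    rewrite incrC; congr (_ *: _).
    rewrite !incrE !zero_classE !mkroot_eqE // (ltn_eqF lm') (gtn_eqF lm') /=.
    rewrite !tops_incr // !tops_zero (ltn_eqF lm') (gtn_eqF lm') /=.
    have -> : pairing l (incr zero_class (mkroot m m)) = 0 by rewrite pairing0 //; lia.
    by have -> : pairing m (incr zero_class (mkroot l l)) = 0 by rewrite pairing0 //; lia.
  rewrite subr0; apply: (etrans (actB _ _ _ _)); apply/eqP; rewrite subr_eq0; apply/eqP.
  by case/orP: ij => h; [apply: E | apply/esym/E].
- rewrite subr0 serre_eeS_rootv; have iiS : (i <= i.+1)%N by apply: leqnSn.
  have E2 : ends_le i.+1 (incr zero_class (mkroot i i)).
    by apply: ends_le_incr; [lia | exact: ends_le_zero].
  have E3 j : (i < j)%N -> incr zero_class (mkroot i i.+1) (mkroot i.+1 j) = 0%N.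
    by move=> ij; rewrite incrE zero_classE mkroot_eqE // gtn_eqF.
  have L := lop_isolated E3; rewrite incrC in L.
  apply: (act_commutator_eq0 (lop_zero i) (D _ _ E2) (D _ _ (@ends_le_zero _)) L).
  have -> : pairing i (incr zero_class (mkroot i i.+1)) = 0 by rewrite pairing0 //; lia.
  have -> : tops (incr zero_class (mkroot i i.+1)) i 1 = 1%N.
    by rewrite tops_incr // tops_zero addn1 eqxx leqnn.
  rewrite /rcoef /= rho_zero rho_incr // rho_zero !incrE !zero_classE !addn0 leqnn addn1.
  rewrite !mkroot_eqE // eqxx (ltn_eqF (ltnSn i)) (gtn_eqF (ltnSn i)) /= /qnum !big_ord1.
  rewrite subrr subr0 oppr0 !expr0z !expr0 !expr1z expr1 !mul1r !mulr1.
  by rewrite mulrC.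
rewrite subr0 serre_eSS_rootv; have iiS : (i <= i.+1)%N by apply: leqnSn.
have E2 : ends_le i.+1 (incr zero_class (mkroot i.+1 i.+1)).
  by apply: ends_le_incr; [lia | exact: ends_le_zero].
have E3 j : (i.+1 < j)%N -> incr zero_class (mkroot i i.+1) (mkroot i.+2 j) = 0%N.
  by move=> ij; rewrite incrE zero_classE mkroot_eqE // gtn_eqF // ltnW.
have L := lop_isolated E3; rewrite incrC in L.
apply: (act_commutator_eq0r (lop_zero i.+1) (D _ _ E2) (D _ _ (@ends_le_zero _)) L).
have -> : pairing i.+1 (incr zero_class (mkroot i i.+1)) = 1 by rewrite pairing0 //; lia.
have -> : tops (incr zero_class (mkroot i i.+1)) i.+1 1 = 0%N.
  by rewrite tops_incr // tops_zero (ltn_eqF (ltnSn i)).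
rewrite /rcoef /= rho_zero rho_incr // rho_zero !incrE !zero_classE ltnn addn1 !addn0.
rewrite !mkroot_eqE // !eqxx (ltn_eqF (ltnSn i)) (gtn_eqF (ltnSn i)) /= /qnum !big_ord1.
rewrite subr0 !expr0 !expr1z expr1 ?mul1r !mulr1.
by rewrite -invr_expz expr1z mulfV // mulr1 mulrC.
Qed.

(** Every v is the product of u_0 and v, and the action commutes with right multiplication by v, so
    annihilating u_0 is enough. *)
Lemma serre_act_eq0 t x : ideal_gen (serre (q * s) s e) t -> act t x = 0.
Proof.
elim=> [a b y z yz||y z _ IHy _ IHz]; [|exact: act0|].
  have h1 : act (a * (y - z) * b) x = act a (act (y - z) (act b x)).
    by apply: (etrans (actM _ _ _ _)); exact: actM.
  have qE : (q * s) / s = q by rewrite mulfK.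
  have h2 v : act (y - z) v = 0.
    rewrite -[v](hall_mul_zerol (q * s) s).
    have := @act_hall_mul K (q * s) s s0 (y - z) << zero_class >> v.
    rewrite qE => h3; apply: (etrans h3).
    by rewrite (serre_act_zero yz) !hall_mulE linear0.
  by rewrite h1 h2 linear0.
by apply: (etrans (actD _ _ _ _)); rewrite IHy IHz addr0.
Qed.

End SerreHall.

(** * Root vectors and the Serre relations *)

Section RootVectors.
Variables (K : fieldType) (r s : K) (A : algType K) (e : nat -> A).
Hypotheses (r0 : r != 0) (rs0 : r + s != 0).
Hypothesis serreE : forall x y, serre r s e x y -> x = y.
Notation R := (rootv s e).

Definition qcomm (x : A) (c : K) (y : A) := x * y = c *: (y * x).

Lemma qcomm_bracket x a b c d : qcomm x c a -> qcomm x d b ->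
  qcomm x (c * d) (a * b - s *: (b * a)).
Proof.
rewrite /qcomm => xa xb.
have xab : x * (a * b) = (c * d) *: (a * b * x).
  by rewrite [LHS]mulrA xa -scalerAl -[a * x * b]mulrA xb -scalerAr scalerA !mulrA.
have xba : x * (b * a) = (c * d) *: (b * a * x).
  by rewrite [LHS]mulrA xb -scalerAl -[b * x * a]mulrA xa -scalerAr scalerA [d * c]mulrC !mulrA.
by rewrite mulrBr mulrBl -scalerAr -scalerAl scalerBr xab xba !scalerA [s * _]mulrC.
Qed.

Lemma qcommV x y : qcomm x r y -> qcomm y r^-1 x.
Proof. by rewrite /qcomm => ->; rewrite scalerA mulVf // scale1r. Qed.

Lemma qcomm_sym x y : qcomm x 1 y -> qcomm y 1 x.
Proof. by rewrite /qcomm !scale1r. Qed.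

Lemma qcomm_rootv x i d : (forall l, (i <= l <= i + d)%N -> qcomm x 1 (e l)) -> qcomm x 1 (R i d).
Proof.
elim: d i => [|d IH] i h; first by apply: h; rewrite addn0 leqnn.
have -> : 1 = 1 * 1 :> K by rewrite mul1r.
apply: qcomm_bracket; first by apply: h; rewrite leqnn leq_addr.
by apply: IH => l /andP[il ld]; apply: h; rewrite (ltnW il) -addSnnS.
Qed.

Lemma qcomm_far i j : (i.+1 < j)%N || (j.+1 < i)%N -> qcomm (e i) 1 (e j).
Proof.
by move=> ij; apply/eqP; rewrite scale1r -subr_eq0; apply/eqP/serreE/Serre_ee.
Qed.

Lemma qcomm_eR1 i : qcomm (e i) r (R i 1).
Proof.
apply/eqP; rewrite -subr_eq0 -serre_eeS_rootv; apply/eqP; exact/serreE/Serre_eeS.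
Qed.

Lemma qcomm_R1e i : qcomm (R i 1) r (e i.+1).
Proof.
apply/eqP; rewrite -subr_eq0 -serre_eSS_rootv; apply/eqP; exact/serreE/Serre_eSS.
Qed.

(** The brackets can be reassociated because e_i commutes with the root vector of (i + 2, i + 2 +
    d). *)
Lemma rootv_split i d : R i d.+2 = R i 1 * R i.+2 d - s *: (R i.+2 d * R i 1).
Proof.
have : qcomm (e i) 1 (R i.+2 d) by apply: qcomm_rootv => l ?; apply: qcomm_far; lia.
rewrite /qcomm /= scale1r; move: (R _ _) (e i) (e i.+1) => y a b ay.
have aX : a * (b * y - s *: (y * b)) = a * b * y - s *: (y * (a * b)).
  by rewrite mulrBr -scalerAr !mulrA ay.
have Xa : (b * y - s *: (y * b)) * a = b * a * y - s *: (y * (b * a)).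
  by rewrite mulrBl -scalerAl -!mulrA ay.
rewrite aX Xa mulrBl mulrBr -scalerAl -scalerAr !scalerBr !opprB !scalerA.
by rewrite [X in _ + X]addrC addrACA [X in _ + X]addrC.
Qed.

Lemma qcomm_eR i d : qcomm (e i) r (R i d.+1).
Proof.
case: d => [|d]; first exact: qcomm_eR1.
rewrite rootv_split -[r]mulr1; apply: qcomm_bracket; first exact: qcomm_eR1.
by apply: qcomm_rootv => l ?; apply: qcomm_far; lia.
Qed.

Let subr_swap (V : lmodType K) (c a : K) (p q u v : V) :
  (p - c *: q) - (a *: u - c *: (a *: v)) = (p - a *: u) - c *: (q - a *: v).
Proof.
rewrite scalerBr opprB opprB [c *: _ - a *: u]addrC [c *: _ - c *: q]addrC.
by rewrite [RHS]addrACA.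
Qed.

Lemma qcomm_inner_next i d : qcomm (e i.+1) 1 (R i d.+2).
Proof.
have aX := qcomm_eR i.+1 d; have Db := qcomm_R1e i; have E2 := rootv_split i d.
pose x := R i.+1 d.+1; pose y := R i.+2 d; pose D := R i 1; pose E := R i d.+2.
pose a := e i; pose b := e i.+1; rewrite /qcomm -/E -/b scale1r; apply/eqP; rewrite -subr_eq0.
have xE : x = b * y - s *: (y * b) by [].
have DE : D = a * b - s *: (b * a) by [].
have {aX} bx : b * x = r *: (x * b) by exact: aX.
have {}Db : D * b = r *: (b * D) by exact: Db.
have EE : E = a * x - s *: (x * a) by [].
have {}E2 : E = D * y - s *: (y * D) by exact: E2.
clearbody x y D E a b.
(* E is a bracket in two ways, of a and x and of D and y, and the two expressions give
   r E b - s b E and r b E - s E b the same value. *)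
have C1 : r *: (E * b) - s *: (b * E) = D * x - (r * s) *: (x * D).
  have h1 : r *: (E * b) = a * (b * x) - (r * s) *: (x * (a * b)).
    by rewrite EE mulrBl -scalerAl scalerBr -mulrA scalerAr -bx scalerA -mulrA.
  have h2 : s *: (b * E) = s *: (b * a * x) - (r * s) *: (s *: (x * (b * a))).
    rewrite EE mulrBr -scalerAr scalerBr mulrA [b * (x * a)]mulrA bx -scalerAl -mulrA.
    by rewrite !scalerA !mulrA; congr (_ - _ *: _); ring.
  by rewrite h1 h2 subr_swap DE mulrBl mulrBr -scalerAl -scalerAr !mulrA.
have C2 : r *: (b * E) - s *: (E * b) = D * x - (r * s) *: (x * D).
  have h1 : r *: (b * E) = D * (b * y) - (r * s) *: (b * y * D).
    by rewrite E2 mulrBr -scalerAr scalerBr mulrA scalerAl -Db !mulrA scalerA.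
  have h2 : s *: (E * b) = s *: (D * (y * b)) - (r * s) *: (s *: (y * b * D)).
    rewrite E2 mulrBl -scalerAl scalerBr -mulrA -[y * D * b]mulrA Db -scalerAr mulrA.
    by rewrite !scalerA !mulrA; congr (_ - _ *: _); ring.
  by rewrite h1 h2 subr_swap xE mulrBl mulrBr -scalerAl -scalerAr.
have : (r + s) *: (b * E - E * b) = 0.
  have h : (r *: (b * E) - s *: (E * b)) - (r *: (E * b) - s *: (b * E)) = 0.
    by rewrite C1 C2 subrr.
  by rewrite -h scalerBr !scalerDl [in RHS]opprB [RHS]addrACA -opprD [s *: _ + _]addrC.
by move/eqP; rewrite scaler_eq0 (negbTE rs0).
Qed.

(** Vertices are peeled off from the left, their e commuting with e_j, until j is the second vertex
    of the root. *)
Lemma qcomm_inner i d j : (i < j < i + d)%N -> qcomm (e j) 1 (R i d).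
Proof.
elim: d i => [|d IH] i /andP[ij jd]; first by lia.
have [je|jne] := eqVneq j i.+1.
  by rewrite je; case: d IH jd => [|d] IH jd; [lia | exact: qcomm_inner_next].
have -> : 1 = 1 * 1 :> K by rewrite mul1r.
by apply: qcomm_bracket; [apply: qcomm_far; lia | apply: IH; lia].
Qed.

Lemma qcomm_lastV i d : qcomm (e (i + d.+1)%N) r^-1 (R i d.+1).
Proof.
elim: d i => [|d IH] i; first by rewrite addn1; apply/qcommV/qcomm_R1e.
rewrite -[r^-1]mul1r; apply: qcomm_bracket; first by apply: qcomm_far; lia.
by rewrite -addSnnS; apply: IH.
Qed.

Lemma qcomm_last i d : qcomm (R i d.+1) r (e (i + d.+1)%N).
Proof. by have := qcomm_lastV i d; rewrite /qcomm => ->; rewrite scalerA divff // scale1r. Qed.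

(** The shorter root vector is built from its right end: the last e contributes r, and the others
    lie inside the longer root and commute with its root vector. *)
Lemma qcomm_RR i d i' d' : (i < i')%N -> (i + d = i' + d')%N -> qcomm (R i d) r (R i' d').
Proof.
elim: d' i' => [|d' IH] i' ii' E.
  have -> : i' = (i + d.-1.+1)%N by lia.
  have -> : d = d.-1.+1 by lia.
  exact: qcomm_last.
rewrite -[r]mul1r; apply: qcomm_bracket; last by apply: IH; lia.
by apply/qcomm_sym/qcomm_inner; lia.
Qed.

End RootVectors.

(** * Spanning by ordered products of root vectors *)

Section Spanning.
Variables (K : fieldType) (r s : K) (A : algType K) (e : nat -> A).
Hypotheses (r0 : r != 0) (rs0 : r + s != 0).
Hypothesis serreE : forall x y, serre r s e x y -> x = y.
Notation R := (rootv s e).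
Notation M := (monomial s e).

Inductive pbw_span (n : nat) : A -> Prop :=
| PbwMonomial L : sorted root_ge L -> all (fun p => p.1 + p.2 < n)%N L -> pbw_span n (M L)
| PbwScale a x : pbw_span n x -> pbw_span n (a *: x)
| PbwAdd x y : pbw_span n x -> pbw_span n y -> pbw_span n (x + y).

Lemma pbw_span_mull n y :
  (forall L, sorted root_ge L -> all (fun p => p.1 + p.2 < n)%N L -> pbw_span n (y * M L)) ->
  forall x, pbw_span n x -> pbw_span n (y * x).
Proof.
move=> h x; elim=> [L Ls Ln|a z _ IH|z t _ IHz _ IHt]; first exact: h.
  by rewrite -scalerAr; apply: PbwScale.
by rewrite mulrDr; apply: PbwAdd.
Qed.

Lemma pbw_span_le n m x : (n <= m)%N -> pbw_span n x -> pbw_span m x.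
Proof.
move=> nm; elim=> [L Ls Ln|a z _ IH|z t _ IHz _ IHt].
- by apply: PbwMonomial => //; apply: sub_all Ln => p /leq_trans; apply.
- exact: PbwScale.
exact: PbwAdd.
Qed.

Lemma monomial_cons p L : M (p :: L) = R p.1 p.2 * M L.
Proof. by rewrite /monomial big_cons. Qed.

(** The only inversions to undo are between roots with the same end point, where [qcomm_RR] costs a
    scalar; hence a single monomial results. *)
Lemma rootv_insert (p : nat * nat) L : sorted root_ge L ->
    all (fun p' => p'.1 + p'.2 <= p.1 + p.2)%N L ->
  exists a, exists2 L', sorted root_ge L' /\ perm_eq L' (p :: L) & R p.1 p.2 * M L = a *: M L'.
Proof.
elim: L => [|h L IH] Ls.
  by exists 1, [:: p]; [split | rewrite scale1r monomial_cons].
move=> /= /andP[hp Lp]; have [ph|] := boolP (root_ge p h).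
  exists 1, (p :: h :: L); last by rewrite scale1r [RHS]monomial_cons.
  by split; [rewrite /= ph; exact: Ls | exact: perm_refl].
rewrite /root_ge => nph.
have [a [L' [L's L'p] E]] := IH (path_sorted Ls) Lp.
have q : qcomm (R p.1 p.2) r (R h.1 h.2) by apply: qcomm_RR => //; lia.
exists (r * a), (h :: L'); last first.
  by rewrite !monomial_cons mulrA q -scalerAl -mulrA E -scalerAr scalerA.
split; last first.
  by rewrite -(perm_cons h) in L'p; apply: perm_trans L'p _; rewrite (perm_catCA [:: h] [:: p] L).
rewrite /= path_min_sorted // (perm_all _ L'p) /= (order_path_min root_ge_trans Ls) andbT.
by rewrite /root_ge; lia.
Qed.

Lemma pbw_span_rootv n (p : nat * nat) x : (p.1 + p.2 = n)%N ->
  pbw_span n.+1 x -> pbw_span n.+1 (R p.1 p.2 * x).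
Proof.
move=> pn; apply: pbw_span_mull => L Ls Ln.
have [|a [L' [L's L'p] ->]] := @rootv_insert p L Ls; first by rewrite pn.
apply/PbwScale/PbwMonomial => //.
by rewrite (perm_all _ L'p) /= pn ltnSn.
Qed.

(** Induction on the bound on end points. If j is the last allowed vertex, e_j is a root vector to
    be inserted. Otherwise e_j moves past the leading root vectors that end at the last vertex: a
    scalar appears unless the root starts at j + 1, where the bracket yields the root vector
    starting at j with the same end. Behind them the induction hypothesis applies. *)
Lemma pbw_span_gen n j x : (j < n)%N -> pbw_span n x -> pbw_span n (e j * x).
Proof.
elim: n j x => [//|n IHn] j x jn.
have [->|jne] := eqVneq j n; first by apply: (@pbw_span_rootv n (n, 0%N)); rewrite addn0.
have {jne}jn : (j < n)%N by lia.
apply: pbw_span_mull => L; elim: L => [|[i d] L IH] Ls Ln.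
  rewrite /monomial big_nil mulr1; have := @PbwMonomial n.+1 [:: (j, 0%N)] isT.
  by rewrite /monomial big_seq1 /=; apply; rewrite addn0 ltnS ltnW.
move: (Ln) => /= /andP[idn Ln'].
have {}IH := IH (path_sorted Ls) Ln'.
have [idE|idne] := eqVneq (i + d)%N n; last first.
  apply: (@pbw_span_le n) => //; apply: IHn => //; apply: PbwMonomial => //.
  have idn' : (i + d < n)%N by lia.
  rewrite /= idn'; apply: sub_all (order_path_min root_ge_trans Ls) => p' /=.
  by rewrite /root_ge /=; lia.
have IHi : pbw_span n.+1 (R i d * (e j * M L)) by apply: (@pbw_span_rootv n (i, d)).
have scal c : qcomm (e j) c (R i d) -> pbw_span n.+1 (e j * M ((i, d) :: L)).
  move=> qc; rewrite monomial_cons mulrA qc -scalerAl -mulrA; exact: PbwScale.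
have [ij|ij|ijE] := ltngtP i j.
- by apply/(scal 1)/(qcomm_inner (r := r)) => //; rewrite ij idE.
- have [jE|jne] := eqVneq i j.+1.
    have -> : e j * M ((i, d) :: L) = R j d.+1 * M L + s *: (R i d * (e j * M L)).
      by rewrite monomial_cons /= -jE mulrBl -scalerAl !mulrA subrK.
    apply: PbwAdd; last exact: PbwScale.
    apply: (@pbw_span_rootv n (j, d.+1)); first by rewrite /=; lia.
    exact: PbwMonomial (path_sorted Ls) Ln'.
  by apply/(scal 1)/qcomm_rootv => l ?; apply: (qcomm_far serreE); lia.
have dE : d = d.-1.+1 by lia.
by apply: (scal r); rewrite dE -ijE; exact: (qcomm_eR r0 rs0 serreE).
Qed.

Lemma subalg_pbw_span x : subalg_gen (fun y => exists i, y = e i) x -> exists n, pbw_span n x.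
Proof.
pose P x := exists n, pbw_span n x.
have PD y z : P y -> P z -> P (y + z).
  move=> [n yn] [m zm]; exists (maxn n m); apply: PbwAdd.
    by apply: pbw_span_le yn; apply: leq_maxl.
  by apply: pbw_span_le zm; apply: leq_maxr.
(* Stability under left multiplication is the form that passes through products. *)
suff h : subalg_gen (fun y => exists i, y = e i) x -> forall y, P y -> P (x * y).
  move=> /h hx; rewrite -[x]mulr1; apply: hx; exists 0%N.
  by have := @PbwMonomial 0 [::] isT isT; rewrite /monomial big_nil.
elim=> {x} [x [i ->]|y yP|c x _ IH y yP|x z _ IHx _ IHz y yP|x z _ IHx _ IHz y yP].
- move=> y [n yn]; exists (maxn n i.+1); apply: pbw_span_gen; first exact: leq_maxr.
  by apply: pbw_span_le yn; apply: leq_maxl.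
- by rewrite mul1r.
- by have [n h] := IH y yP; exists n; rewrite -scalerAl; apply: PbwScale.
- by rewrite mulrDl; apply: PD; [apply: IHx | apply: IHz].
by rewrite -mulrA; apply/IHx/IHz.
Qed.

Lemma pbw_span_sum n x : pbw_span n x ->
  exists2 z : {malg K[seq (nat * nat)]}, {in msupp z, forall L, sorted root_ge L} &
    x = lext (monomial s e) z.
Proof.
elim=> [L Ls _|a y _ [z zs ->]|y y' _ [z zs ->] _ [z' zs' ->]].
- by exists << L >>; rewrite ?lextU // => L'; rewrite msuppU oner_eq0 inE => /eqP->.
- exists (a *: z); last by rewrite linearZ.
  by move=> L /(fsubsetP (msuppZ_le _ _)); apply: zs.
exists (z + z'); last by rewrite linearD.
by move=> L /(fsubsetP (msuppD_le _ _)); rewrite inE => /orP[/zs|/zs'].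
Qed.

End Spanning.

(** * Verma modules *)

Section LinearCombinations.
Variables (K : comNzRingType) (V : lmodType K).

(** Reified linear combinations: [eq_leval] turns an identity in a module into one scalar identity
    per vector, within reach of [ring] and [field]. *)
Inductive lexpr :=
  LAtom of nat | LAdd of lexpr & lexpr | LOpp of lexpr | LScale of K & lexpr | LZero.

Fixpoint leval (v : seq V) (x : lexpr) : V :=
  match x with
  | LAtom i => v`_i | LAdd x y => leval v x + leval v y | LOpp x => - leval v x
  | LScale c x => c *: leval v x | LZero => 0
  end.

Fixpoint lcoeff (x : lexpr) (i : nat) : K :=
  match x with
  | LAtom j => (j == i)%:R | LAdd x y => lcoeff x i + lcoeff y i | LOpp x => - lcoeff x i
  | LScale c x => c * lcoeff x i | LZero => 0
  end.

Fixpoint eq_lcoeff (x y : lexpr) (n : nat) : Prop :=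
  if n is m.+1 then eq_lcoeff x y m /\ lcoeff x m = lcoeff y m else True.

Lemma levalE v x : leval v x = \sum_(i < size v) lcoeff x i *: v`_i.
Proof.
elim: x => [j|x IHx y IHy|x IH|c x IH|] /=.
- have [jv|vj] := ltnP j (size v).
    rewrite (bigD1 (Ordinal jv)) //= eqxx scale1r big1 ?addr0 // => i ne.
    by rewrite -val_eqE /= eq_sym in ne; rewrite (negbTE ne) scale0r.
  rewrite nth_default // big1 // => i _; have := leq_trans (ltn_ord i) vj.
  by rewrite ltn_neqAle eq_sym => /andP[/negbTE-> _]; rewrite scale0r.
- by rewrite IHx IHy -big_split; apply: eq_bigr => i _; rewrite scalerDl.
- by rewrite IH -sumrN; apply: eq_bigr => i _; rewrite scaleNr.
- by rewrite IH scaler_sumr; apply: eq_bigr => i _; rewrite scalerA.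
by rewrite big1 // => i _; rewrite scale0r.
Qed.

Lemma eq_leval v x y : eq_lcoeff x y (size v) -> leval v x = leval v y.
Proof.
move=> h; rewrite !levalE; apply: eq_bigr => i _; congr (_ *: _).
elim: (size v) h (i : nat) (ltn_ord i) => [//|n IH] /= [/IH h e] j.
by rewrite ltnS leq_eqVlt => /orP[/eqP->|/h].
Qed.

End LinearCombinations.

Ltac atom_index v t :=
  match v with
  | ?x :: ?v' =>
    match goal with
    | _ => let _ := match goal with _ => unify x t end in constr:(0%N)
    | _ => let i := atom_index v' t in constr:(i.+1)
    end
  end.

Ltac reify_comb K v t :=
  match t with
  | @GRing.add _ ?x ?y =>
    let x' := reify_comb K v x in let y' := reify_comb K v y in constr:(LAdd x' y')
  | @GRing.opp _ ?x => let x' := reify_comb K v x in constr:(LOpp x')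
  | @GRing.scale _ _ ?c ?x => let x' := reify_comb K v x in constr:(@LScale K c x')
  | @GRing.zero _ => constr:(@LZero K)
  | _ => let i := atom_index v t in constr:(@LAtom K i)
  end.

(* Leaves one scalar identity for each vector of the list v. *)
Ltac comb K v :=
  match goal with
  | |- ?x = ?y =>
    let x' := reify_comb K v x in let y' := reify_comb K v y in
    change (@leval K _ v x' = leval v y'); apply: eq_leval; rewrite /= ?eqxx; repeat split; rewrite /=
  end.

Section SerreOperators.
Variables (K : fieldType) (r s k : K) (V : lmodType K).
Variables (a b y W W' : {linear V -> V}).
Hypotheses (r0 : r != 0) (s0 : s != 0).

(** The Serre elements as operators in a and b. An operator y that commutes with one of a and b, and
    whose commutator with the other is a multiple of W - W', commutes with both operators. This
    serves twice: with a, b from the e_i and y = f_j, and with the roles exchanged and r, s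
    inverted. *)
Definition serre1 t := a (a (b t)) - (r + s) *: a (b (a t)) + (r * s) *: b (a (a t)).
Definition serre2 t := a (b (b t)) - (r + s) *: b (a (b t)) + (r * s) *: b (b (a t)).

Lemma serre1_linear : linear serre1.
Proof.
move=> c u v; rewrite /serre1 !(linearD, linearZ) /=.
comb K [:: a (a (b u)); a (b (a u)); b (a (a u)); a (a (b v)); a (b (a v)); b (a (a v))].
all: by ring.
Qed.

Lemma serre2_linear : linear serre2.
Proof.
move=> c u v; rewrite /serre2 !(linearD, linearZ) /=.
comb K [:: a (b (b u)); b (a (b u)); b (b (a u)); a (b (b v)); b (a (b v)); b (b (a v))].
all: by ring.
Qed.

HB.instance Definition _ := GRing.isLinear.Build K V V _ serre1 serre1_linear.
HB.instance Definition _ := GRing.isLinear.Build K V V _ serre2 serre2_linear.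

Let d t := k *: (W t - W' t).

Section LowerA.
Hypotheses (ya : forall t, y (a t) = a (y t) + d t) (yb : forall t, y (b t) = b (y t)).
Hypotheses (Wa : forall t, W (a t) = (r / s) *: a (W t)) (Wb : forall t, W (b t) = s *: b (W t)).
Hypotheses (W'a : forall t, W' (a t) = (s / r) *: a (W' t)).
Hypotheses (W'b : forall t, W' (b t) = r *: b (W' t)).

Lemma serre1_lowerA t : y (serre1 t) = serre1 (y t).
Proof.
rewrite /serre1 !linearD !linearN !linearZ /= !(ya, yb) /d !(Wa, Wb, W'a, W'b).
rewrite !(linearD, linearN, linearZ) /=.
comb K [:: a (a (b (y t))); a (b (a (y t))); b (a (a (y t)));
  a (b (W t)); a (b (W' t)); b (a (W t)); b (a (W' t))].
all: by field; rewrite ?r0 ?s0.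
Qed.

Lemma serre2_lowerA t : y (serre2 t) = serre2 (y t).
Proof.
rewrite /serre2 !linearD !linearN !linearZ /= !(ya, yb) /d !(Wa, Wb, W'a, W'b).
rewrite !(linearD, linearN, linearZ) /=.
comb K [:: a (b (b (y t))); b (a (b (y t))); b (b (a (y t)));
  b (b (W t)); b (b (W' t))].
all: by field; rewrite ?r0 ?s0.
Qed.

End LowerA.

Section LowerB.
Hypotheses (ya : forall t, y (a t) = a (y t)) (yb : forall t, y (b t) = b (y t) + d t).
Hypotheses (Wa : forall t, W (a t) = r^-1 *: a (W t)).
Hypotheses (Wb : forall t, W (b t) = (r / s) *: b (W t)).
Hypotheses (W'a : forall t, W' (a t) = s^-1 *: a (W' t)).
Hypotheses (W'b : forall t, W' (b t) = (s / r) *: b (W' t)).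

Lemma serre1_lowerB t : y (serre1 t) = serre1 (y t).
Proof.
rewrite /serre1 !linearD !linearN !linearZ /= !(ya, yb) /d !(Wa, Wb, W'a, W'b).
rewrite !(linearD, linearN, linearZ) /=.
comb K [:: a (a (b (y t))); a (b (a (y t))); b (a (a (y t)));
  a (a (W t)); a (a (W' t))].
all: by field; rewrite ?r0 ?s0.
Qed.

Lemma serre2_lowerB t : y (serre2 t) = serre2 (y t).
Proof.
rewrite /serre2 !linearD !linearN !linearZ /= !(ya, yb) /d !(Wa, Wb, W'a, W'b).
rewrite !(linearD, linearN, linearZ) /=.
comb K [:: a (b (b (y t))); b (a (b (y t))); b (b (a (y t)));
  a (b (W t)); a (b (W' t)); b (a (W t)); b (a (W' t))].
all: by field; rewrite ?r0 ?s0.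
Qed.

End LowerB.
End SerreOperators.

(* Products of elements of the free algebra are slow to compare by conversion, so the
   free algebra enters below only through its induction principle. *)
Definition gen_ind (R : comNzRingType) (I : Type) (T : algType R) (gen : I -> T) :=
  forall P : T -> Prop, P 1 -> (forall i t, P t -> P (gen i * t)) ->
  (forall a t, P t -> P (a *: t)) -> (forall t u, P t -> P u -> P (t + u)) -> forall t, P t.

Section ModuleAction.
Variables (R : comNzRingType) (B : algType R) (V : lmodType R) (ac : B -> V -> V).
Hypotheses (acM : forall x y v, ac (x * y) v = ac x (ac y v)).
Hypotheses (acD : forall x y v, ac (x + y) v = ac x v + ac y v).
Hypotheses (acZ : forall a x v, ac (a *: x) v = a *: ac x v).

Lemma ac_sub x y v : ac (x - y) v = ac x v - ac y v.
Proof. by rewrite acD -[- y]scaleN1r acZ scaleN1r. Qed.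

Lemma ac_commutator x y v : ac (x * y - y * x) v = ac x (ac y v) - ac y (ac x v).
Proof. by rewrite ac_sub !acM. Qed.

Lemma ac_serre1 x y c d v :
  ac (x ^+ 2 * y - c *: (x * y * x) + d *: (y * x ^+ 2)) v =
  ac x (ac x (ac y v)) - c *: ac x (ac y (ac x v)) + d *: ac y (ac x (ac x v)).
Proof. by rewrite !expr2 acD ac_sub !acZ !acM. Qed.

Lemma ac_serre2 x y c d v :
  ac (x * y ^+ 2 - c *: (y * x * y) + d *: (y ^+ 2 * x)) v =
  ac x (ac y (ac y v)) - c *: ac y (ac x (ac y v)) + d *: ac y (ac y (ac x v)).
Proof. by rewrite !expr2 acD ac_sub !acZ !acM. Qed.

End ModuleAction.

Section LeftMultiplication.
Variables (R : comNzRingType) (A : algType R).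

Definition lmul (x t : A) : A := x * t.

Lemma lmul_is_linear x : linear (lmul x).
Proof. by move=> a t u; rewrite /lmul mulrDr scalerAr. Qed.

HB.instance Definition _ x := GRing.isLinear.Build R A A _ (lmul x) (lmul_is_linear x).

End LeftMultiplication.

Section Verma.
Variables (K : fieldType) (r s : K).
Hypotheses (r0 : r != 0) (s0 : s != 0).

(** The scalar in the relation that moves w_i past e_j. Since w_i is to fix the vacuum, it acts on
    the Verma module as [diag (wchar i)]; likewise w'_i as [diag (wchar' i)]. *)
Definition wchar i j : K := r ^ simple_form j i * s ^ (- simple_form i j).
Definition wchar' i j : K := r ^ (- simple_form i j) * s ^ simple_form j i.
Definition lcst (i j : nat) : K := if i == j then (r - s)^-1 else 0.

Lemma wchar_neq0 i j : wchar i j != 0.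
Proof. by rewrite mulf_neq0 ?expfz_neq0. Qed.

Lemma wchar'_neq0 i j : wchar' i j != 0.
Proof. by rewrite mulf_neq0 ?expfz_neq0. Qed.

Variables (T : algType K) (gen : nat -> T).
Hypothesis Tind : gen_ind gen.
Variables (diag : (nat -> K) -> {linear T -> T}) (lower : nat -> {linear T -> T}).
Hypothesis diag1 : forall h, diag h 1 = 1.
Hypothesis diag_genM : forall h i t, diag h (gen i * t) = h i *: (gen i * diag h t).
Hypothesis lower1 : forall j, lower j 1 = 0.
Hypothesis lower_genM : forall j i t, lower j (gen i * t) =
  gen i * lower j t - lcst i j *: (diag (wchar j) t - diag (wchar' j) t).

Lemma diagM h t u : diag h (t * u) = diag h t * diag h u.
Proof.
elim/Tind: t => [|i t IH|a t IH|t t' IH IH'].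
- by rewrite diag1 !mul1r.
- by rewrite -mulrA !diag_genM IH mulrA scalerAl.
- by rewrite -scalerAl !linearZ /= IH scalerAl.
by rewrite mulrDl !linearD /= IH IH' mulrDl.
Qed.

Lemma diag_gen h i : diag h (gen i) = h i *: gen i.
Proof. by rewrite -[gen i]mulr1 diag_genM diag1. Qed.

Lemma diagC h h' t : diag h (diag h' t) = diag h' (diag h t).
Proof.
elim/Tind: t => [|i t IH|a t IH|t u IHt IHu].
- by rewrite !diag1.
- by rewrite !diag_genM !linearZ /= !diag_genM IH !scalerA mulrC.
- by rewrite !linearZ /= IH.
by rewrite !linearD /= IHt IHu.
Qed.

Lemma diagK h h' t : (forall i, h i * h' i = 1) -> diag h (diag h' t) = t.
Proof.
move=> hh'; elim/Tind: t => [|i t IH|a t IH|t u IHt IHu].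
- by rewrite !diag1.
- by rewrite !diag_genM !linearZ /= !diag_genM IH !scalerA mulrC hh' scale1r.
- by rewrite !linearZ /= IH.
by rewrite !linearD /= IHt IHu.
Qed.

Lemma diag_lower h j t : h j != 0 -> diag h (lower j t) = (h j)^-1 *: lower j (diag h t).
Proof.
move=> hj; elim/Tind: t => [|i t IH|a t IH|t u IHt IHu].
- by rewrite diag1 lower1 linear0 scaler0.
- rewrite lower_genM diag_genM linearB /= diag_genM !linearZ /= lower_genM IH.
  rewrite linearB /= ![diag h (diag _ _)]diagC.
  rewrite -scalerAr; move: (gen i * _) (_ - _) => u v.
  rewrite !scalerA ?[_^-1 * h i]mulrC scalerBr scalerA scalerN; congr (_ - _ *: _).
  by rewrite /lcst; case: eqP => [->|]; rewrite ?mulfV ?mul1r ?mulr0.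
- by rewrite !linearZ /= IH !scalerA mulrC.
by rewrite !linearD /= IHt IHu.
Qed.

Lemma serre1E i t :
  (gen i ^+ 2 * gen i.+1 - (r + s) *: (gen i * gen i.+1 * gen i)
    + (r * s) *: (gen i.+1 * gen i ^+ 2)) * t = serre1 r s (lmul (gen i)) (lmul (gen i.+1)) t.
Proof. 
exact: (ac_serre1 (ac := fun x => lmul x) (fun x y v => esym (mulrA x y v)) (fun x y v => mulrDl x y v)
  (fun a x v => esym (scalerAl a x v))).
Qed.

Lemma serre2E i t :
  (gen i * gen i.+1 ^+ 2 - (r + s) *: (gen i.+1 * gen i * gen i.+1)
    + (r * s) *: (gen i.+1 ^+ 2 * gen i)) * t = serre2 r s (lmul (gen i)) (lmul (gen i.+1)) t.
Proof. 
exact: (ac_serre2 (ac := fun x => lmul x) (fun x y v => esym (mulrA x y v)) (fun x y v => mulrDl x y v)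
  (fun a x v => esym (scalerAl a x v))).
Qed.

Lemma wchar_id i : wchar i i = r / s.
Proof. by rewrite /wchar /simple_form eqxx expr1z. Qed.

Lemma wchar_next i : wchar i i.+1 = s.
Proof.
rewrite /wchar /simple_form eqxx (gtn_eqF (ltnSn i)) (ltn_eqF (ltnSn i)) opprK ltn_eqF //.
by rewrite expr0z expr1z mul1r.
Qed.

Lemma wchar_prev i : wchar i.+1 i = r^-1.
Proof.
rewrite /wchar /simple_form eqxx (gtn_eqF (ltnSn i)) (ltn_eqF (ltnSn i)) ltn_eqF //.
by rewrite oppr0 expr0z mulr1.
Qed.

Lemma wchar_far i j : (i.+1 < j)%N || (j.+1 < i)%N -> wchar i j = 1.
Proof.
move=> ij; rewrite /wchar /simple_form.
have [-> -> -> ->] : [/\ (i == j) = false, (j == i) = false, (j == i.+1) = false & (i == j.+1) = false].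
  by split; apply/eqP; lia.
by rewrite oppr0 !expr0z mulr1.
Qed.

Lemma wchar'E i j : wchar' i j = (wchar j i)^-1.
Proof. by rewrite /wchar /wchar' invfM !invr_expz opprK. Qed.

Let H j t := diag (wchar j) t - diag (wchar' j) t.

Let H_far j i l t : (i.+1 < l)%N || (l.+1 < i)%N ->
  lcst i j *: H j (gen l * t) = lcst i j *: (gen l * H j t).
Proof.
move=> il; rewrite /lcst; case: eqP => [<-|]; last by rewrite !scale0r.
rewrite /H !diag_genM wchar'E !wchar_far //; last by rewrite orbC.
by rewrite invr1 !scale1r mulrBr.
Qed.

Let lower_lmul j i t :
  lower j (lmul (gen i) t) = lmul (gen i) (lower j t) + - lcst i j *: H j t.
Proof. by rewrite scaleNr -lower_genM. Qed.

Let lower_lmul0 j i t : i != j -> lower j (lmul (gen i) t) = lmul (gen i) (lower j t).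
Proof. by move=> ij; rewrite lower_lmul /lcst (negbTE ij) oppr0 scale0r addr0. Qed.

Let diag_id i t : diag (wchar i) (lmul (gen i) t) = (r / s) *: lmul (gen i) (diag (wchar i) t).
Proof. by rewrite /lmul diag_genM wchar_id. Qed.

Let diag_id' i t : diag (wchar' i) (lmul (gen i) t) = (s / r) *: lmul (gen i) (diag (wchar' i) t).
Proof. by rewrite /lmul diag_genM wchar'E wchar_id invf_div. Qed.

Let diag_next i t : diag (wchar i) (lmul (gen i.+1) t) = s *: lmul (gen i.+1) (diag (wchar i) t).
Proof. by rewrite /lmul diag_genM wchar_next. Qed.

Let diag_next' i t :
  diag (wchar' i) (lmul (gen i.+1) t) = r *: lmul (gen i.+1) (diag (wchar' i) t).
Proof. by rewrite /lmul diag_genM wchar'E wchar_prev invrK. Qed.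

Let diag_prev i t :
  diag (wchar i.+1) (lmul (gen i) t) = r^-1 *: lmul (gen i) (diag (wchar i.+1) t).
Proof. by rewrite /lmul diag_genM wchar_prev. Qed.

Let diag_prev' i t :
  diag (wchar' i.+1) (lmul (gen i) t) = s^-1 *: lmul (gen i) (diag (wchar' i.+1) t).
Proof. by rewrite /lmul diag_genM wchar'E wchar_next. Qed.

(** The Serre elements are singular vectors, and more: f_j commutes with left multiplication by
    them. For distant indices the terms in w_j and w'_j cancel, these commuting with the other
    generator. *)
Lemma lower_serre j x y t : serre r s gen x y -> lower j ((x - y) * t) = (x - y) * lower j t.
Proof.
case=> {x y} [i l il|i|i]; rewrite subr0.
- have E m m' : (m.+1 < m')%N || (m'.+1 < m)%N -> lower j (gen m * (gen m' * t)) =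
      gen m * (gen m' * lower j t) - (lcst m' j *: (gen m * H j t) + lcst m j *: (gen m' * H j t)).
    move=> mm'; rewrite lower_genM lower_genM -/(H j _) -/(H j _) H_far // mulrBr -scalerAr.
    by rewrite opprD addrA.
  have li : (l.+1 < i)%N || (i.+1 < l)%N by rewrite orbC.
  rewrite !mulrBl -!mulrA linearB /= E // E // opprB [lcst i j *: _ + _]addrC.
  by rewrite addrA subrK.
- rewrite serre1E [RHS]serre1E; have [->|ji] := eqVneq j i.+1.
    apply: (serre1_lowerB (k := - lcst i.+1 i.+1) (W := diag (wchar i.+1))
      (W' := diag (wchar' i.+1))) => //.
    + by move=> u; rewrite lower_lmul0 // ltn_eqF.
    + exact: lower_lmul.
    + exact: diag_prev.
    exact: diag_prev'.
  apply: (serre1_lowerA (k := - lcst i j) (W := diag (wchar i)) (W' := diag (wchar' i))) => //.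
  + move=> u; rewrite lower_lmul /lcst; case: eqP => [->//|_].
    by rewrite oppr0 !scale0r.
  + by move=> u; rewrite lower_lmul0 // eq_sym.
  + exact: diag_id.
  + exact: diag_next.
  + exact: diag_id'.
  exact: diag_next'.
- rewrite serre2E [RHS]serre2E; have [->|ji] := eqVneq j i.+1.
    apply: (serre2_lowerB (k := - lcst i.+1 i.+1) (W := diag (wchar i.+1))
      (W' := diag (wchar' i.+1))) => //.
    + by move=> u; rewrite lower_lmul0 // ltn_eqF.
    + exact: lower_lmul.
    + exact: diag_prev.
    + exact: diag_id.
    + exact: diag_prev'.
    exact: diag_id'.
  apply: (serre2_lowerA (k := - lcst i j) (W := diag (wchar i)) (W' := diag (wchar' i))) => //.
  + move=> u; rewrite lower_lmul /lcst; case: eqP => [->//|_].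
    by rewrite oppr0 !scale0r.
  + by move=> u; rewrite lower_lmul0 // eq_sym.
  + exact: diag_next.
  exact: diag_next'.
Qed.

Lemma lower_ff i j t : (i.+1 < j)%N || (j.+1 < i)%N ->
  lower i (lower j t) = lower j (lower i t).
Proof.
move=> ij; have ji : (j.+1 < i)%N || (i.+1 < j)%N by rewrite orbC.
have HL m m' u : (m.+1 < m')%N || (m'.+1 < m)%N -> H m (lower m' u) = lower m' (H m u).
  move=> mm'; have m'm : (m'.+1 < m)%N || (m.+1 < m')%N by rewrite orbC.
  rewrite /H !diag_lower ?wchar_neq0 ?wchar'_neq0 // wchar'E !wchar_far // !invr1 !scale1r.
  by rewrite linearB.
elim/Tind: t => [|l t IH|a t IH|t u IHt IHu].
- by rewrite !lower1 !linear0.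
- have E m m' : (m.+1 < m')%N || (m'.+1 < m)%N -> lower m (lower m' (gen l * t)) =
      gen l * lower m (lower m' t) - (lcst l m *: lower m' (H m t) + lcst l m' *: lower m (H m' t)).
    move=> mm'; rewrite lower_genM -/(H _ _) linearB linearZ /= lower_genM -/(H _ _) HL //.
    by rewrite opprD addrA.
  by rewrite E // E // IH [_ + lcst l i *: _]addrC.
- by rewrite !linearZ /= IH.
by rewrite !linearD /= IHt IHu.
Qed.

Let rV0 : r^-1 != 0. Proof. by rewrite invr_neq0. Qed.
Let sV0 : s^-1 != 0. Proof. by rewrite invr_neq0. Qed.

Let lower_id i t : diag (wchar i) (lower i t) = (r^-1 / s^-1) *: lower i (diag (wchar i) t).
Proof. by rewrite diag_lower ?wchar_neq0 // wchar_id invf_div invrK mulrC. Qed.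

Let lower_id' i t : diag (wchar' i) (lower i t) = (s^-1 / r^-1) *: lower i (diag (wchar' i) t).
Proof. by rewrite diag_lower ?wchar'_neq0 // wchar'E wchar_id invrK invrK mulrC. Qed.

Let lower_next i t : diag (wchar i) (lower i.+1 t) = s^-1 *: lower i.+1 (diag (wchar i) t).
Proof. by rewrite diag_lower ?wchar_neq0 // wchar_next. Qed.

Let lower_next' i t : diag (wchar' i) (lower i.+1 t) = r^-1 *: lower i.+1 (diag (wchar' i) t).
Proof. by rewrite diag_lower ?wchar'_neq0 // wchar'E wchar_prev invrK. Qed.

Let lower_prev i t :
  diag (wchar i.+1) (lower i t) = r^-1^-1 *: lower i (diag (wchar i.+1) t).
Proof. by rewrite diag_lower ?wchar_neq0 // wchar_prev. Qed.

Let lower_prev' i t :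
  diag (wchar' i.+1) (lower i t) = s^-1^-1 *: lower i (diag (wchar' i.+1) t).
Proof. by rewrite diag_lower ?wchar'_neq0 // wchar'E wchar_next. Qed.

Let gen_lower l j t :
  lmul (gen l) (lower j t) = lower j (lmul (gen l) t) + lcst l j *: (diag (wchar j) t - diag (wchar' j) t).
Proof. by rewrite /lmul lower_genM subrK. Qed.

Let gen_lower0 l j t : l != j -> lmul (gen l) (lower j t) = lower j (lmul (gen l) t).
Proof. by move=> lj; rewrite gen_lower /lcst (negbTE lj) scale0r addr0. Qed.

(* The operators f_i satisfy the commutation rules of the e_i with r and s replaced by
   their inverses, so the Serre elements in the f_i commute with the e_l; and they kill 1. *)
Lemma lower_serre1 i t : serre1 r^-1 s^-1 (lower i) (lower i.+1) t = 0.
Proof.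
elim/Tind: t => [|l t IH|a t IH|t u IHt IHu].
- by rewrite /serre1 !(lower1, linear0) ?scaler0 ?addr0 ?subr0.
- rewrite -/(lmul (gen l) t) -[RHS](linear0 (lmul (gen l))) -IH; apply: esym.
  have [->|li] := eqVneq l i.+1.
    apply: (serre1_lowerB (k := lcst i.+1 i.+1) (W := diag (wchar i.+1))
      (W' := diag (wchar' i.+1))) => //.
    + by move=> u; rewrite /= gen_lower0 // gtn_eqF.
    exact: gen_lower.
  apply: (serre1_lowerA (k := lcst l i) (W := diag (wchar i)) (W' := diag (wchar' i))) => //.
  + exact: gen_lower.
  by move=> u; rewrite /= gen_lower0.
- by rewrite linearZ /= IH scaler0.
by rewrite linearD /= IHt IHu addr0.
Qed.

Lemma lower_serre2 i t : serre2 r^-1 s^-1 (lower i) (lower i.+1) t = 0.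
Proof.
elim/Tind: t => [|l t IH|a t IH|t u IHt IHu].
- by rewrite /serre2 !(lower1, linear0) ?scaler0 ?addr0 ?subr0.
- rewrite -/(lmul (gen l) t) -[RHS](linear0 (lmul (gen l))) -IH; apply: esym.
  have [->|li] := eqVneq l i.+1.
    apply: (serre2_lowerB (k := lcst i.+1 i.+1) (W := diag (wchar i.+1))
      (W' := diag (wchar' i.+1))) => //.
    + by move=> u; rewrite /= gen_lower0 // gtn_eqF.
    exact: gen_lower.
  apply: (serre2_lowerA (k := lcst l i) (W := diag (wchar i)) (W' := diag (wchar' i))) => //.
  + exact: gen_lower.
  by move=> u; rewrite /= gen_lower0.
- by rewrite linearZ /= IH scaler0.
by rewrite linearD /= IHt IHu addr0.
Qed.

Notation serre_ideal := (ideal_gen (serre r s gen)).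

Lemma serre_idealZ c t : serre_ideal t -> serre_ideal (c *: t).
Proof. by rewrite -[t in c *: t]mul1r scalerAl; apply: ideal_genMl. Qed.

Lemma diag_serre h x y : serre r s gen x y -> exists c, diag h (x - y) = c *: (x - y).
Proof.
case=> {x y} [i j _|i|i]; rewrite subr0.
- exists (h i * h j); rewrite linearB /= !diagM !diag_gen -!scalerAl -!scalerAr !scalerA.
  by rewrite [h j * h i]mulrC scalerBr.
- exists (h i ^+ 2 * h i.+1); rewrite !expr2 linearD linearB !linearZ /= !diagM !diag_gen.
  rewrite !(=^~ scalerAl, =^~ scalerAr, scalerA) !mulrA.
  comb K [:: gen i * gen i * gen i.+1; gen i * gen i.+1 * gen i; gen i.+1 * gen i * gen i]; ring.
exists (h i * h i.+1 ^+ 2); rewrite !expr2 linearD linearB !linearZ /= !diagM !diag_gen.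
rewrite !(=^~ scalerAl, =^~ scalerAr, scalerA) !mulrA.
comb K [:: gen i * gen i.+1 * gen i.+1; gen i.+1 * gen i * gen i.+1; gen i.+1 * gen i.+1 * gen i]; ring.
Qed.

Lemma diag_serre_ideal h t : serre_ideal t -> serre_ideal (diag h t).
Proof.
elim=> [a b x y xy||u v _ IHu _ IHv]; last 2 first.
- by rewrite linear0; apply: Ideal0.
- by rewrite linearD; apply: IdealD.
have [c E] := diag_serre h xy; rewrite !diagM E -scalerAr -scalerAl.
exact/serre_idealZ/IdealRel.
Qed.

(** Moving f_j through the left factor leaves terms in [diag], which preserves the ideal because
    Serre elements are weight vectors; at the Serre element itself f_j passes on to the right factor
    by [lower_serre]. *)
Lemma lower_serre_ideal j t : serre_ideal t -> serre_ideal (lower j t).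
Proof.
elim=> [a b x y xy||u v _ IHu _ IHv]; last 2 first.
- by rewrite linear0; apply: Ideal0.
- by rewrite linearD; apply: IdealD.
elim/Tind: a => [|l a IH|c a IH|a a' IH IH'].
- by rewrite mul1r (lower_serre _ _ xy) -[x - y]mul1r; apply: IdealRel.
- have I : serre_ideal (a * (x - y) * b) by apply: IdealRel.
  rewrite -!mulrA lower_genM; apply: IdealD.
    by apply: ideal_genMl; rewrite mulrA.
  rewrite -scaleNr; apply: serre_idealZ; apply: IdealD.
    by rewrite mulrA; apply: diag_serre_ideal.
  by rewrite -scaleN1r; apply: serre_idealZ; rewrite mulrA; apply: diag_serre_ideal.
- by rewrite -!scalerAl linearZ; apply: serre_idealZ.
by rewrite !mulrDl linearD; apply: IdealD.
Qed.

Definition verma_op (g : ugen) : {linear T -> T} :=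
  match g with
  | Ue i => lmul (gen i)
  | Uf i => lower i
  | Uw i => diag (wchar i)
  | Uwinv i => diag (fun j => (wchar i j)^-1)
  | Uv i => diag (wchar' i)
  | Uvinv i => diag (fun j => (wchar' i j)^-1)
  end.

Lemma verma_op_ideal g t : serre_ideal t -> serre_ideal (verma_op g t).
Proof.
case: g => i; try exact: diag_serre_ideal; last exact: lower_serre_ideal.
exact: ideal_genMl.
Qed.

Variables (B : algType K) (G : ugen -> B) (ac : B -> T -> T).
Hypothesis Bind : gen_ind G.
Hypotheses (ac1 : forall t, ac 1 t = t) (acM : forall x y t, ac (x * y) t = ac x (ac y t)).
Hypotheses (acD : forall x y t, ac (x + y) t = ac x t + ac y t).
Hypotheses (acZ : forall a x t, ac (a *: x) t = a *: ac x t).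
Hypothesis acG : forall g t, ac (G g) t = verma_op g t.

Lemma ac_serre_ideal x t : serre_ideal t -> serre_ideal (ac x t).
Proof.
move=> It; elim/Bind: x => [|g x IH|a x IH|x y IHx IHy].
- by rewrite ac1.
- by rewrite acM acG; apply: verma_op_ideal.
- by rewrite acZ; apply: serre_idealZ.
by rewrite acD; apply: IdealD.
Qed.

Let acB := ac_sub acD acZ.

Let ac0 t : ac 0 t = 0.
Proof. by have := acZ 0 0 t; rewrite !scale0r. Qed.

Let serre_idealP x t : serre r s gen x 0 -> serre_ideal (x * t).
Proof. by move=> xI; have := IdealRel 1 t xI; rewrite subr0 mul1r. Qed.

(** All relations other than the Serre relations of the e_i hold exactly on the free algebra; those
    act as left multiplication by elements of the ideal. *)
Lemma urel_act x y t : urel r s G x y -> serre_ideal (ac (x - y) t).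
Proof.
have I0 u : u = 0 -> serre_ideal u by move->; apply: Ideal0.
case=> {x y} [x y xt yt|i|i|i|i|i j|i j|i j|i j|i j|i j ij|i j ij|i|i|i|i].
- apply: I0; rewrite ac_commutator // !acG; apply/eqP; rewrite subr_eq0; apply/eqP.
  by case: x xt => // i _; case: y yt => // j _; apply: diagC.
- by apply: I0; rewrite acB acM !acG ac1 /= diagK ?subrr // => j; rewrite mulfV ?wchar_neq0.
- by apply: I0; rewrite acB acM !acG ac1 /= diagK ?subrr // => j; rewrite mulVf ?wchar_neq0.
- by apply: I0; rewrite acB acM !acG ac1 /= diagK ?subrr // => j; rewrite mulfV ?wchar'_neq0.
- by apply: I0; rewrite acB acM !acG ac1 /= diagK ?subrr // => j; rewrite mulVf ?wchar'_neq0.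
- by apply: I0; rewrite acB acZ !acM !acG /= /lmul diag_genM subrr.
- by apply: I0; rewrite acB acZ !acM !acG /= /lmul diag_genM subrr.
- apply: I0; rewrite acB acZ !acM !acG /= diag_lower ?wchar_neq0 //.
  by rewrite /wchar invfM !invr_expz opprK subrr.
- apply: I0; rewrite acB acZ !acM !acG /= diag_lower ?wchar'_neq0 //.
  by rewrite /wchar' invfM !invr_expz opprK subrr.
- apply: I0; rewrite acB ac_commutator // !acG /= /lmul lower_genM opprB addrCA subrr addr0.
  rewrite /lcst; case: eqP => [->|_].
    by rewrite acZ acB !acG subrr.
  by rewrite ac0 scale0r subrr.
- by rewrite subr0 ac_commutator // !acG /= /lmul !mulrA -mulrBl; apply/serre_idealP/Serre_ee.
- by apply: I0; rewrite subr0 ac_commutator // !acG /= lower_ff // subrr.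
- rewrite subr0 ac_serre1 // !acG -/(serre1 r s (lmul (gen i)) (lmul (gen i.+1)) t) -serre1E.
  exact/serre_idealP/Serre_eeS.
- rewrite subr0 ac_serre2 // !acG -/(serre2 r s (lmul (gen i)) (lmul (gen i.+1)) t) -serre2E.
  exact/serre_idealP/Serre_eSS.
- by apply: I0; rewrite subr0 ac_serre1 // !acG /= invfM; apply: lower_serre1.
by apply: I0; rewrite subr0 ac_serre2 // !acG /= invfM; apply: lower_serre2.
Qed.

Lemma verma_ideal x t : ideal_gen (urel r s G) x -> serre_ideal (ac x t).
Proof.
elim=> [a b y z yz||y z _ IHy _ IHz]; last 2 first.
- by rewrite ac0; apply: Ideal0.
- by rewrite acD; apply: IdealD.
by rewrite !acM; apply/ac_serre_ideal/urel_act.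
Qed.

End Verma.

(** * Evaluation of the free algebra on the e_i *)

Section Evaluation.
Variables (R : comUnitRingType) (T A : algType R) (gen : nat -> T) (e : nat -> A) (phi : T -> A).
Hypothesis Tind : gen_ind gen.
Hypotheses (phi1 : phi 1 = 1) (phi_genM : forall i t, phi (gen i * t) = e i * phi t).
Hypotheses (phiZ : forall a t, phi (a *: t) = a *: phi t).
Hypotheses (phiD : forall t u, phi (t + u) = phi t + phi u).

Lemma phiM t u : phi (t * u) = phi t * phi u.
Proof.
elim/Tind: t => [|i t IH|a t IH|t t' IH IH'].
- by rewrite phi1 !mul1r.
- by rewrite -mulrA !phi_genM IH mulrA.
- by rewrite -scalerAl !phiZ IH scalerAl.
by rewrite mulrDl !phiD IH IH' mulrDl.
Qed.

Lemma phi_gen i : phi (gen i) = e i.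
Proof. by rewrite -[gen i]mulr1 phi_genM phi1 mulr1. Qed.

Lemma phi_monomial s L : phi (monomial s gen L) = monomial s e L.
Proof.
have phi_rootv i d : phi (rootv s gen i d) = rootv s e i d.
  elim: d i => [|d IH] i /=; first exact: phi_gen.
  by rewrite -scaleNr phiD phiZ !phiM IH phi_gen scaleNr.
elim: L => [|p L IH]; first by rewrite /monomial !big_nil.
by rewrite /monomial !big_cons phiM phi_rootv -/(monomial s gen L) IH.
Qed.

Lemma phi_subalg t : subalg_gen (fun x => exists i, x = e i) (phi t).
Proof.
elim/Tind: t => [|i t IH|a t IH|t u IHt IHu].
- by rewrite phi1; apply: Subalg1.
- by rewrite phi_genM; apply: SubalgM IH; apply: SubalgGen; exists i.
- by rewrite phiZ; apply: SubalgZ.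
by rewrite phiD; apply: SubalgD.
Qed.

Variables (V : lmodType R) (ac : A -> V -> V) (v : V) (psi : T -> V).
Hypothesis ac1 : ac 1 v = psi 1.
Hypothesis psi_genM : forall i x t, ac x v = psi t -> ac (e i * x) v = psi (gen i * t).
Hypotheses (acZ : forall a x, ac (a *: x) v = a *: ac x v).
Hypotheses (acD : forall x y, ac (x + y) v = ac x v + ac y v).
Hypotheses (psiZ : forall a x, psi (a *: x) = a *: psi x).
Hypotheses (psiD : forall x y, psi (x + y) = psi x + psi y).

(** Serves twice: for the free algebra on all generators acting on the vacuum, with psi the
    identity, and for its projection to U, with psi the evaluation in U. *)
Lemma phi_act t : ac (phi t) v = psi t.
Proof.
elim/Tind: t => [|i t IH|a t IH|t u IHt IHu].
- by rewrite phi1.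
- by rewrite phi_genM; apply: psi_genM.
- by rewrite phiZ acZ IH psiZ.
by rewrite phiD acD IHt IHu psiD.
Qed.

End Evaluation.

Section FreeEvaluation.
Variables (R : comUnitRingType) (A : algType R) (e : nat -> A).

Definition feval (t : falg R nat) : A := act (fun i => lmul (e i)) t 1.

Lemma feval1 : feval 1 = 1. Proof. exact: act1. Qed.

Lemma feval_genM i t : feval (falg_gen R i * t) = e i * feval t.
Proof. exact: act_genM. Qed.

Lemma fevalZ a t : feval (a *: t) = a *: feval t. Proof. exact: actZ. Qed.

Lemma fevalD t u : feval (t + u) = feval t + feval u. Proof. exact: actD. Qed.

Lemma falg_gen_ind (I : choiceType) : gen_ind (@falg_gen R I).
Proof. exact: falg_ind. Qed.

Lemma feval_monomial s L : feval (monomial s (@falg_gen R nat) L) = monomial s e L.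
Proof. exact: (phi_monomial (@falg_gen_ind _) feval1 feval_genM fevalZ fevalD). Qed.

Lemma fevalM t u : feval (t * u) = feval t * feval u.
Proof. exact: (phiM (@falg_gen_ind _) feval1 feval_genM fevalZ fevalD). Qed.

Lemma feval_subalg t : subalg_gen (fun x => exists i, x = e i) (feval t).
Proof. exact: (phi_subalg (@falg_gen_ind _) feval1 feval_genM fevalZ fevalD). Qed.

Lemma feval_gen i : feval (falg_gen R i) = e i.
Proof. exact: (phi_gen feval1 feval_genM). Qed.

End FreeEvaluation.

Lemma scale_mul_scale (R : comNzRingType) (A : algType R) (a b c : R) (x y z : A) :
  x * y = z -> c = a * b -> c *: z = a *: (x * (b *: y)).
Proof. by move=> <- ->; rewrite -scalerAr scalerA. Qed.

Lemma mul_sub_scale (R : comNzRingType) (A : algType R) (c : R) (x y y' z z' : A) :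
  y = y' -> z = z' -> x * y - c *: z = x * y' - c *: z'.
Proof. by move=> -> ->. Qed.

(* The free algebra on the e_i as a Verma module: the f_i lower words and annihilate
   the empty one, on which the w_i and w'_i act as 1. *)
Section FreeVerma.
Variables (K : fieldType) (r s : K).
Hypotheses (r0 : r != 0) (s0 : s != 0).
Notation T := (falg K nat).
Notation gen := (@falg_gen K nat).

Definition diag (h : nat -> K) : {linear T -> T} :=
  GRing.Linear.clone _ _ _ _ _ (lext (fun m : {fmonom nat} => falg_prod h m *: (<< m >> : T))).

Let genU i (m : {fmonom nat}) : gen i * << m >> = << mmul (fmu i) m >>.
Proof. by rewrite malgM_def [LHS]fgmulUU mulr1. Qed.

Lemma diag1 h : diag h 1 = 1.
Proof. by apply: (etrans (lextU _ _)); rewrite /falg_prod fm1 big_nil scale1r. Qed.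

Lemma diag_genM h i t : diag h (gen i * t) = h i *: (gen i * diag h t).
Proof.
pose f : {linear T -> T} := GRing.Linear.clone _ _ _ _ _ (diag h \o lmul (gen i)).
pose g : {linear T -> T} := GRing.Linear.clone _ _ _ _ _ (h i \*: (lmul (gen i) \o diag h)).
suff fg : f =1 g by exact: (fg t).
apply: linear_malg_eq => m; rewrite /f /g /=.
rewrite /lmul lextU; apply: (etrans (congr1 (diag h) (genU i m))); apply: (etrans (lextU _ _)).
apply: scale_mul_scale; first exact: genU.
by rewrite /falg_prod fmM fmU big_cons.
Qed.

Let torus j : {linear T -> T} := GRing.Linear.clone _ _ _ _ _
  (diag (wchar r s j) \- diag (wchar' r s j)).

(** The recursion is f_j e_i = e_i f_j - delta_ij (w_j - w'_j) / (r - s), starting from f_j 1 =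
    0. *)
Fixpoint lower_word (j : nat) (w : seq nat) : T :=
  if w is i :: w' then
    gen i * lower_word j w' - lcst r s i j *: torus j (\prod_(l <- w') gen l)
  else 0.

Definition lower j : {linear T -> T} :=
  GRing.Linear.clone _ _ _ _ _ (lext (fun m : {fmonom nat} => lower_word j m)).

Lemma lower1 j : lower j 1 = 0.
Proof. by apply: (etrans (lextU _ _)); rewrite fm1. Qed.

Lemma lower_genM j i t : lower j (gen i * t) =
  gen i * lower j t - lcst r s i j *: (diag (wchar r s j) t - diag (wchar' r s j) t).
Proof.
pose f : {linear T -> T} := GRing.Linear.clone _ _ _ _ _ (lower j \o lmul (gen i)).
pose g : {linear T -> T} := GRing.Linear.clone _ _ _ _ _
  ((lmul (gen i) \o lower j) \- (lcst r s i j \*: torus j)).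
suff fg : f =1 g by exact: (fg t).
apply: linear_malg_eq => m; rewrite /f /g /=.
apply: (etrans (congr1 (lower j) (genU i m))); apply: (etrans (lextU _ _)).
have W : (mmul (fmu i) m : seq nat) = i :: m by rewrite fmM fmU.
apply: (etrans (congr1 (lower_word j) W)); apply: mul_sub_scale; first exact/esym/lextU.
exact: (congr1 (torus j) (esym (falg_word K m))).
Qed.

(** Acting on the vacuum 1, an element t in the e_i gives back t itself, so [verma_ideal] places t
    in the Serre ideal. *)
Lemma serre_of_urel (t : T) :
  ideal_gen (urel r s (@falg_gen K ugen)) (feval (fun i => falg_gen K (Ue i)) t) ->
  ideal_gen (serre r s gen) t.
Proof.
pose ac := act (verma_op r s gen diag lower).
move/(verma_ideal r0 s0 (@falg_gen_ind _ _) diag1 diag_genM lower1 lower_genM (ac := ac)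
  (@falg_gen_ind _ _) (@act1 _ _ _ _) (@actM _ _ _ _) (@actD _ _ _ _) (@actZ _ _ _ _)
  (@act_gen _ _ _ _) 1).
suff -> : ac (feval (fun i => falg_gen K (Ue i)) t) 1 = t by [].
apply: (phi_act (@falg_gen_ind _ _) (feval1 _) (feval_genM _) (fevalZ _) (fevalD _) (psi := id)) => //.
- exact: act1.
- move=> i x u xu; apply: (etrans (act_genM _ _ _ _)).
  by rewrite [act _ x 1]xu.
- by move=> a x; exact: actZ.
by move=> x y; exact: actD.
Qed.

End FreeVerma.

(** * The isomorphism *)

Lemma serre_morph (K : fieldType) (r s : K) (F A : algType K) (pi : {linear F -> A})
    (eF : nat -> F) x y : {morph pi : u v / u * v} ->
  serre r s (fun i => pi (eF i)) x y -> exists2 x', serre r s eF x' 0 & x = pi x' /\ y = 0.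
Proof.
move=> piM; case=> {x y} [i j ij|i|i].
- by eexists; [exact: (Serre_ee _ _ _ ij) | rewrite linearB /= !piM].
- by eexists; [exact: (Serre_eeS _ _ _ i) | rewrite !expr2 linearD linearB !linearZ /= !piM].
by eexists; [exact: (Serre_eSS _ _ _ i) | rewrite !expr2 linearD linearB !linearZ /= !piM].
Qed.

Lemma urel_serre (K : fieldType) (r s : K) (A : algType K) (G : ugen -> A) x y :
  serre r s (fun i => G (Ue i)) x y -> urel r s G x y.
Proof. by case=> *; [apply: Rel_ee | apply: Rel_eeS | apply: Rel_eSS]. Qed.

Lemma malg_eq0_of_image (K : fieldType) (X Y : choiceType) (c : {malg K[X]}) (a : X -> K)
    (f : X -> Y) : {in msupp c &, injective f} -> (forall x, a x != 0) ->
  \sum_(x <- msupp c) c@_x *: (a x *: (<< f x >> : {malg K[Y]})) = 0 -> c = 0.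
Proof.
move=> f_inj a0 /malgP c0; apply/malgP=> x; rewrite mcoeff0.
have [xc|] := boolP (x \in msupp c); last exact: mcoeff_outdom.
have := c0 (f x); rewrite mcoeff0 mcoeff_sum (big_fsetD1 x) //= !mcoeffZ mcoeffUU.
rewrite big1_fset => [/eqP|y].
  by rewrite addr0 mulr1 mulf_eq0 (negbTE (a0 x)) orbF => /eqP.
rewrite !inE => /andP[yx yc] _; rewrite !mcoeffZ mcoeffU; case: eqP => [/f_inj e|_].
  by case/eqP: yx; apply: e.
by rewrite !mulr0.
Qed.

Section Isomorphism.
Variables (K : fieldType) (r s : K).
Hypotheses (r0 : r != 0) (s0 : s != 0) (rsX : forall n, (0 < n)%N -> r ^+ n != s ^+ n).

Let q := r / s.
Let q_eq : q * s = r. Proof. by rewrite /q mulfVK. Qed.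

Let rs0 : r + s != 0.
Proof. by apply: contra (rsX (isT : (0 < 2)%N)) => /eqP e; rewrite -subr_eq0 subr_sqr e mulr0. Qed.

(** Multiplied by q - 1 it becomes q ^ (n + 1) - 1, which is nonzero as r and s have different
    powers. *)
Lemma qnum_neq0 n : qnum q n.+1 != 0.
Proof.
have e : (q - 1) * qnum q n.+1 = q ^+ n.+1 - 1 by rewrite -subrX1.
apply: contra (rsX (isT : (0 < n.+1)%N)) => /eqP h; move: e; rewrite h mulr0 => /eqP.
rewrite eq_sym subr_eq0 exprMn exprVn => /eqP e.
by rewrite -[r ^+ _](mulfVK (_ : s ^+ n.+1 != 0)) ?expf_neq0 // e mul1r.
Qed.

Lemma mon_coef_neq0 L : mon_coef q s L != 0.
Proof.
elim: L => [|p L IH] /=; first exact: oner_neq0.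
rewrite mulf_neq0 // /rcoef !mulf_neq0 ?qnum_neq0 ?expf_neq0 ?expfz_neq0 //.
by rewrite mulf_neq0 ?invr_neq0.
Qed.

Let F := falg K ugen.
Let urelF := urel r s (@falg_gen K ugen).
Let pi : {linear F -> Ursl r s} := GRing.Linear.clone _ _ _ _ _ (@lquot_pi K F (ideal_pred urelF)).
Let e i : Ursl r s := Ursl_gen r s (Ue i).
Let eF i : F := falg_gen K (Ue i).

Let pi_eq x y : pi x = pi y <-> ideal_gen urelF (x - y).
Proof.
apply: (iff_trans (lquot_piE _ _ _)); rewrite ideal_predE; split=> [/asboolP//|h]; exact/asboolP.
Qed.

Let piM x y : pi (x * y) = pi x * pi y.
Proof.
apply: esym; apply/pi_eq; rewrite -/(pi x) -/(pi y).
have Ix : ideal_gen urelF (repr (pi x) - x) by apply/pi_eq/lquot_repr.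
have Iy : ideal_gen urelF (repr (pi y) - y) by apply/pi_eq/lquot_repr.
have -> : repr (pi x) * repr (pi y) - x * y =
    (repr (pi x) - x) * repr (pi y) + x * (repr (pi y) - y).
  by rewrite mulrBl mulrBr addrA subrK.
by apply: IdealD; [apply: ideal_genMr | apply: ideal_genMl].
Qed.

Let serre_Ursl x y : serre r s e x y -> x = y.
Proof.
move=> /(serre_morph (pi := pi) (eF := eF) piM)[x' /urel_serre x'0 [-> ->]].
by rewrite -(linear0 pi); apply/pi_eq; have := IdealRel 1 1 x'0; rewrite mul1r mulr1.
Qed.

Let feval_pi t : pi (feval eF t) = feval e t.
Proof.
pose ac (x : F) (_ : Ursl r s) := pi x.
have ac1 : ac 1 0 = feval e 1 by exact/esym/feval1.
have acM i x u : ac x 0 = feval e u -> ac (eF i * x) 0 = feval e (falg_gen K i * u).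
  by rewrite /ac => xu; rewrite piM xu; exact/esym/feval_genM.
have acZ a x : ac (a *: x) 0 = a *: ac x 0 by exact: linearZ.
have acD x y : ac (x + y) 0 = ac x 0 + ac y 0 by exact: linearD.
exact: (phi_act (@falg_gen_ind _ _) (feval1 _) (feval_genM _) (fevalZ _) (fevalD _)
  ac1 acM acZ acD (fevalZ e) (fevalD e)).
Qed.

Let u0 : Hall K := << zero_class >>.
Let H (t : falg K nat) : Hall K := act (lop q s) t u0.

Let HZ a t : H (a *: t) = a *: H t. Proof. exact: actZ. Qed.
Let HD t u : H (t + u) = H t + H u. Proof. exact: actD. Qed.

Let H_eq0 t : feval e t = 0 -> H t = 0.
Proof.
rewrite -feval_pi -(linear0 pi) => /pi_eq; rewrite subr0 => /(serre_of_urel r0 s0).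
by rewrite -{1}q_eq; apply: serre_act_eq0.
Qed.

Let H_eq t u : feval e t = feval e u -> H t = H u.
Proof.
move=> tu; have h : feval e (t + (-1) *: u) = 0.
  by apply: (etrans (fevalD _ _ _)); rewrite fevalZ tu scaleN1r subrr.
by move: (H_eq0 h); rewrite HD HZ scaleN1r => /eqP; rewrite subr_eq0 => /eqP.
Qed.

Let HM t u : H (t * u) = hall_mul r s (H t) (H u).
Proof.
apply: (etrans (actM _ _ _ _)); rewrite -[act _ u u0](hall_mul_zerol r s).
exact: (act_hall_mul r s0).
Qed.

Let Uplus_feval (x : Uplus r s) : exists t, feval e t = Uplus_val x.
Proof.
case: x => x /= /asboolP.
elim=> {x} [_ [i ->]||c _ _ [t <-]|_ _ _ [t <-] _ [u <-]|_ _ _ [t <-] _ [u <-]].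
- by exists (falg_gen K i); exact: feval_gen.
- by exists 1; exact: feval1.
- by exists (c *: t); exact: fevalZ.
- by exists (t + u); exact: fevalD.
by exists (t * u); exact: fevalM.
Qed.

Let feval_Uplus t : feval e t \in @Uplus_pred K r s.
Proof.
exact/asboolP/feval_subalg.
Qed.

(** A lift of x to the free algebra is chosen; [H_eq] makes the value independent of the choice. *)
Definition hall_iso (x : Uplus r s) : Hall K := H (sval (cid (Uplus_feval x))).

Let hall_isoE x t : feval e t = Uplus_val x -> hall_iso x = H t.
Proof. by move=> tx; apply: H_eq; rewrite tx; case: cid. Qed.

Let feval_lift x : exists2 t, feval e t = Uplus_val x & hall_iso x = H t.
Proof. by have [t tx] := Uplus_feval x; exists t; [exact: tx | exact: hall_isoE]. Qed.

Lemma hall_iso_linear : linear hall_iso.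
Proof.
move=> a x y; have [t tx ->] := feval_lift x; have [u uy ->] := feval_lift y.
rewrite -HZ -HD; apply: hall_isoE; apply: (etrans (fevalD _ _ _)); rewrite fevalZ tx uy.
by [].
Qed.

Let eta : {linear Uplus r s -> Hall K} :=
  HB.pack hall_iso (GRing.isLinear.Build K (Uplus r s) (Hall K) _ hall_iso hall_iso_linear).

Lemma hall_iso_mul x y : hall_iso (x * y) = hall_mul r s (hall_iso x) (hall_iso y).
Proof.
have [t tx ->] := feval_lift x; have [u uy ->] := feval_lift y.
by rewrite -HM; apply: hall_isoE; apply: (etrans (fevalM _ _ _)); rewrite tx uy.
Qed.

Lemma hall_iso1 : hall_iso 1 = u0.
Proof.
have E : feval e 1 = Uplus_val (1 : Uplus r s) by exact: feval1.
exact: (etrans (hall_isoE E) (act1 _ _)).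
Qed.

Lemma hall_iso_gen i : hall_iso (Uplus_e r s i) = hall_u K (class_of_root (simple_root i)).
Proof.
have E : feval e (falg_gen K i) = Uplus_val (Uplus_e r s i) by exact: feval_gen.
apply: (etrans (hall_isoE E)); apply: (etrans (act_simple_zero q s i)).
congr << _ >>; apply/fsfunP=> b; rewrite incrE zero_classE add0n fsfunE inE.
by rewrite (_ : mkroot i i = simple_root i); [case: eqP | apply/val_inj/mkrootE].
Qed.

Let H_monomial L : sorted root_ge L ->
  H (monomial s (@falg_gen K nat) L) = mon_coef q s L *: << list_class L >>.
Proof. by apply: act_monomial; rewrite unitfE. Qed.

Lemma hall_iso_inj : injective hall_iso.
Proof.
apply: (raddf_inj (f := eta)) => z z0; have /asboolP zU := Uplus_valP z.
have [n zn] := subalg_pbw_span r0 rs0 serre_Ursl zU.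
have [c cs zE] := pbw_span_sum zn.
pose t := \sum_(L <- msupp c) c@_L *: monomial s (@falg_gen K nat) L.
have tz : feval e t = Uplus_val z.
  rewrite zE lextE /t (big_morph (feval e) (fevalD e) (act0 _ _)); apply: eq_bigr => L _.
  by rewrite fevalZ feval_monomial.
have {}z0 : H t = 0 by exact: (etrans (esym (hall_isoE tz)) z0).
have HtE : H t = \sum_(L <- msupp c) c@_L *: (mon_coef q s L *: << list_class L >>).
  apply: (etrans (big_morph H HD (act0 _ _) _ _ _)); apply: eq_big_seq => L Lc.
  by rewrite HZ H_monomial ?cs.
suff c0 : c = 0 by apply/val_inj; rewrite /= zE c0 linear0.
apply: (malg_eq0_of_image (f := list_class) (a := mon_coef q s)); last by rewrite -HtE.
  by move=> L L' Lc L'c; apply: list_class_inj; apply: cs.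
exact: mon_coef_neq0.
Qed.

Lemma hall_iso_surj y : exists x, hall_iso x = y.
Proof.
suff [t ty] : exists t, H t = y.
  by exists (MkUplus (feval_Uplus t)); rewrite -ty; exact: hall_isoE.
elim/malg_ind: y => [|al|a _ [t <-]|_ _ [t <-] [u <-]].
- by exists 0; exact: act0.
- have [L Ls <-] := list_class_exists al.
  exists ((mon_coef q s L)^-1 *: monomial s (@falg_gen K nat) L).
  by rewrite HZ H_monomial // scalerA mulVf ?mon_coef_neq0 // scale1r.
- by exists (a *: t).
by exists (t + u).
Qed.

Theorem hall_isomorphism : exists eta : {linear Uplus r s -> Hall K},
  [/\ forall i, eta (Uplus_e r s i) = hall_u K (class_of_root (simple_root i)),
      bijective eta, eta 1 = hall_u K zero_class
    & forall x y, eta (x * y) = hall_mul r s (eta x) (eta y)].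
Proof.
exists eta; split; [exact: hall_iso_gen | | exact: hall_iso1 | exact: hall_iso_mul].
have [g gK] := choice hall_iso_surj.
by exists g => // x; apply: hall_iso_inj; rewrite gK.
Qed.

End Isomorphism.

Lemma var_r_neq0 : var_r != 0.
Proof. by rewrite tofrac_eq0 polyC_eq0 polyX_eq0. Qed.

Lemma var_s_neq0 : var_s != 0.
Proof. by rewrite tofrac_eq0 polyX_eq0. Qed.

(** As polynomials in s, r ^ n is a constant, whereas s ^ n has degree n. *)
Lemma var_powers n : (0 < n)%N -> var_r ^+ n != var_s ^+ n.
Proof.
move=> n0; rewrite -!rmorphXn tofrac_eq /=; apply/eqP => /(congr1 (fun p => size (p : {poly _}))).
rewrite size_polyXn => h; have := size_polyC_leq1 (('X : {poly rat}) ^+ n).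
by rewrite h ltnS leqNgt n0.
Qed.

Theorem theorem2p7 :
  exists eta : {linear Uplus var_r var_s -> Hall Qrs},
    [/\ forall i : nat, eta (Uplus_e var_r var_s i) =
          hall_u Qrs (class_of_root (simple_root i)),
        bijective eta,
        eta 1 = hall_u Qrs zero_class
      & forall x y : Uplus var_r var_s,
          eta (x * y) = hall_mul var_r var_s (eta x) (eta y)].
Proof. exact: (hall_isomorphism var_r_neq0 var_s_neq0 var_powers). Qed.
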